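(* Let $(V(f),0)\subseteq(\mathbb{C}^n,0)$ be an isolated hypersurface singularity defined by $f$, and let $k\ge 0$ be an integer. Then the tangent space $T\,\mathrm{Def}_k^{V(f)}$ of the deformation functor $\mathrm{Def}_k^{V(f)}$ of $k$-pointed deformations of $(V(f),0)$ is isomorphic to $$\frac{(f,m^k)}{\left(f,\,m^kJ(f)\right)}.$$ Therefore $$\dim T\,\mathrm{Def}_k^{V(f)}=\tau_k-\dim \mathcal{O}/(f,m^k).$$
   Context: $\mathcal{O}=\mathbb{C}[[x_1,\dots,x_n]]$ is the local algebra of $(\mathbb{C}^n,0)$, with maximal ideal $m$ (and $m^0=\mathcal{O}$). The function $f=f(x_1,\dots,x_n)$ is complex analytic with an isolated critical point at the origin, $V(f)$ is its zero locus, and $J(f)=(\partial f/\partial x_1,\dots,\partial f/\partial x_n)\subseteq\mathcal{O}$ is its Jacobian ideal. The $k$-th Tjurina algebra is $A_k(f)=\mathcal{O}/(f,m^kJ(f))$, and the $k$-th Tjurina number is $\tau_k=\dim_{\mathbb{C}}A_k(f)$. All dimensions are over $\mathbb{C}$. Write $X=(V(f),0)$, with local ring $\mathcal{O}_X=\mathcal{O}/(f)$ and maximal ideal $m_X$. The $k$-residue fat point $P$ of $X$ is the fat point at the origin with structure algebra $\mathcal{O}_X/m_X^k=\mathcal{O}/(f,m^k)$. The morphism $P\to X$ corresponds to the quotient map $\mathcal{O}_X\to\mathcal{O}_X/m_X^k$. A deformation of $X$ over a germ $(\mathcal{T},0)$ is a (flat) germ projection $\mathcal{X}\to\mathcal{T}$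 together with a germ embedding $X\to\mathcal{X}$ such that the square formed by $X\to\mathcal{X}$, $X\to 0$, $\mathcal{X}\to\mathcal{T}$ and $0\to\mathcal{T}$ is Cartesian. Deformations of $P$ are understood in the same way. Two deformations $\mathcal{X}\to\mathcal{T}$ and $\mathcal{X}'\to\mathcal{T}'$ of the same germ are equivalent if there are isomorphisms $\mathcal{X}\to\mathcal{X}'$ and $\mathcal{T}\to\mathcal{T}'$ commuting with the projections to the bases and with the embeddings of the deformed germ and of the base point $0$. A $k$-pointed deformation of $X$ over $\mathcal{T}$ is a chain of morphisms $\mathcal{P}\to\mathcal{X}\to\mathcal{T}$ together with embeddings $P\to\mathcal{P}$ and $X\to\mathcal{X}$ such that: (1) the pullback of the chain to $0\in\mathcal{T}$ is $P\to X\to 0$, i.e. the two squares relating $P\to X\to 0$ to $\mathcal{P}\to\mathcal{X}\to\mathcal{T}$ are Cartesian; (2) $\mathcal{X}\to\mathcal{T}$ is a deformation of $X$ over $\mathcal{T}$; (3) $\mathcal{P}\to\mathcal{T}$ is equivalent to a trivial deformation of $P$ over $\mathcal{T}$, and $\mathcal{P}\to\mathcal{X}$ is an embedding. Two $k$-pointed deformations $\mathcal{P}\to\mathcal{X}\to\mathcal{T}$ and $\mathcal{P}'\to\mathcal{X}'\to\mathcal{T}'$ of $X$ are equivalent if there are isomorphisms $\mathcal{P}\to\mathcal{P}'$, $\mathcal{X}\to\mathcal{X}'$, $\mathcal{T}\to\mathcal{T}'$ that commute with the morphisms of the two chains and with the embeddings of $P$, $X$ and $0$ into $\mathcal{P},\mathcal{P}'$,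 into $\mathcal{X},\mathcal{X}'$ and into $\mathcal{T},\mathcal{T}'$ respectively. The functor $\mathrm{Def}_k^X$ from the category of local analytic germs to the category of sets sends a germ $\mathcal{T}$ to the collection of equivalence classes of $k$-pointed deformations of $X$ over $\mathcal{T}$. Let $\mathcal{T}_\epsilon$ be the germ with structure algebra $\mathbb{C}[\epsilon]$, $\epsilon^2=0$. The tangent space of the functor is defined as $T\,\mathrm{Def}_k^X=\mathrm{Def}_k^X(\mathcal{T}_\epsilon)$.
   Formalization: The trivialization of P over T in condition (3) is made part of a k-pointed deformation and must be preserved by equivalences (else false for k=2, f=x^3+y^3), and classes over T use the identity of T as the base isomorphism (else no vector space). *)

(* Defs.v *)
From HB Require Import structures.
From mathcomp Require Import all_boot all_order all_algebra.
From mathcomp Require Import generic_quotient ring_quotient.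
From mathcomp Require Import -(notations) mpoly.
From mathcomp Require Import boolp classical_sets reals ereal.
From mathcomp Require Import topology normedtype sequences.
From mathcomp Require Import complex.

Set Implicit Arguments.
Unset Strict Implicit.
Unset Printing Implicit Defensive.

Import Order.TTheory GRing.Theory Num.Theory.
Import numFieldNormedType.Exports.

Local Open Scope classical_set_scope.
Local Open Scope ring_scope.

(* mpoly is used qualified: its notations clash with those of topology. *)
Local Notation mon := mpoly.multinom.
Local Notation bmon := mpoly.bmultinom.
Local Notation mdeg := mpoly.mdeg.
Local Notation mon0 := (mpoly.mnm0).
Local Notation mon1 := mpoly.mnm1.
Local Notation monD := mpoly.mnm_add.

Record series (K : comNzRingType) (n : nat) :=
  Series { scoef : mon n -> K }.

Section Series.
Variables (K : comNzRingType) (n : nat).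
Local Notation O := (series K n).
Implicit Types f g h : O.

HB.instance Definition _ := gen_eqMixin O.
HB.instance Definition _ := gen_choiceMixin O.

Lemma seriesP f g : scoef f =1 scoef g -> f = g.
Proof. by case: f g => [f] [g] /= /funext ->. Qed.

Definition szero : O := Series (fun=> 0).
Definition sadd f g : O := Series (fun m => scoef f m + scoef g m).
Definition sopp f : O := Series (fun m => - scoef f m).
Definition sone : O := Series (fun m => (m == mon0)%:R).
Definition smul f g : O :=
  Series (fun m =>
    \sum_(k : bmon n (mdeg m).+1 * bmon n (mdeg m).+1 |
            m == monD k.1 k.2) scoef f k.1 * scoef g k.2).
Definition sscale (c : K) f : O := Series (fun m => c * scoef f m).

Lemma saddA : associative sadd.
Proof. by move=> f g h; apply: seriesP => m /=; rewrite addrA. Qed.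
Lemma saddC : commutative sadd.
Proof. by move=> f g; apply: seriesP => m /=; rewrite addrC. Qed.
Lemma sadd0 : left_id szero sadd.
Proof. by move=> f; apply: seriesP => m /=; rewrite add0r. Qed.
Lemma saddN : left_inverse szero sopp sadd.
Proof. by move=> f; apply: seriesP => m /=; rewrite addNr. Qed.

HB.instance Definition _ := GRing.isZmodule.Build O saddA saddC sadd0 saddN.

(* The ring laws are inherited from {mpoly K[n]} through truncation. *)
Let trunc d f : mpoly.mpoly n K :=
  \sum_(m : bmon n d) scoef f m *: mpoly.mpolyX K m.

Let mcoeff_trunc d f m : (mdeg m < d)%N -> mpoly.mcoeff m (trunc d f) = scoef f m.
Proof. exact: mpoly.mcoeff_mpoly. Qed.

Let eq_mcoeffM d (p p' q q' : mpoly.mpoly n K) m : (mdeg m < d)%N ->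
  (forall k, (mdeg k < d)%N -> mpoly.mcoeff k p = mpoly.mcoeff k p') ->
  (forall k, (mdeg k < d)%N -> mpoly.mcoeff k q = mpoly.mcoeff k q') ->
  mpoly.mcoeff m (p * q) = mpoly.mcoeff m (p' * q').
Proof.
move=> md pp qq; rewrite !mpoly.mcoeffM; apply: eq_bigr => k _.
by rewrite pp ?qq //; apply: leq_ltn_trans md; rewrite -ltnS mpoly.bmdeg.
Qed.

Let scoefM d f g m : (mdeg m < d)%N ->
  scoef (smul f g) m = mpoly.mcoeff m (trunc d f * trunc d g).
Proof.
move=> md; rewrite mpoly.mcoeffM /=; apply: eq_bigr => k _.
by rewrite !mcoeff_trunc //; apply: leq_ltn_trans md; rewrite -ltnS mpoly.bmdeg.
Qed.

Lemma smulC : commutative smul.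
Proof.
by move=> f g; apply: seriesP => m; rewrite !(scoefM _ _ (ltnSn _)) mulrC.
Qed.

Lemma smulA : associative smul.
Proof.
move=> f g h; apply: seriesP => m.
have trM u v k : (mdeg k < (mdeg m).+1)%N ->
    mpoly.mcoeff k (trunc (mdeg m).+1 (smul u v)) =
    mpoly.mcoeff k (trunc (mdeg m).+1 u * trunc (mdeg m).+1 v).
  by move=> km; rewrite mcoeff_trunc ?(scoefM _ _ km).
rewrite !(scoefM _ _ (ltnSn _)).
rewrite (eq_mcoeffM (ltnSn _) (fun _ _ => erefl) (trM g h)) mulrA.
by rewrite -(eq_mcoeffM (ltnSn _) (trM f g) (fun _ _ => erefl)).
Qed.

Lemma smul1 : left_id sone smul.
Proof.
move=> f; apply: seriesP => m; rewrite (scoefM _ _ (ltnSn _)).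
have tr1 k : (mdeg k < (mdeg m).+1)%N ->
    mpoly.mcoeff k (trunc (mdeg m).+1 sone) = mpoly.mcoeff k 1.
  by move=> km; rewrite mcoeff_trunc // mpoly.mcoeff1.
by rewrite (eq_mcoeffM (ltnSn _) tr1 (fun _ _ => erefl)) mul1r mcoeff_trunc.
Qed.

Lemma smulDl : left_distributive smul +%R.
Proof.
move=> f g h; apply: seriesP => m /=; rewrite -big_split /=.
by apply: eq_bigr => k _; rewrite mulrDl.
Qed.

Lemma sone_neq0 : sone != 0.
Proof.
apply/eqP => /(congr1 (fun f => scoef f mon0)) /= /eqP.
by rewrite eqxx oner_eq0.
Qed.

HB.instance Definition _ :=
  GRing.Zmodule_isComNzRing.Build O smulA smulC smul1 smulDl sone_neq0.

Lemma sscaleA a b f : sscale a (sscale b f) = sscale (a * b) f.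
Proof. by apply: seriesP => m /=; rewrite mulrA. Qed.
Lemma sscale1 : left_id 1 sscale.
Proof. by move=> f; apply: seriesP => m /=; rewrite mul1r. Qed.
Lemma sscaleDr : right_distributive sscale +%R.
Proof. by move=> c f g; apply: seriesP => m /=; rewrite mulrDr. Qed.
Lemma sscaleDl f : {morph sscale^~ f : a b / a + b}.
Proof. by move=> a b; apply: seriesP => m /=; rewrite mulrDl. Qed.

HB.instance Definition _ :=
  GRing.Zmodule_isLmodule.Build K O sscaleA sscale1 sscaleDr sscaleDl.

Lemma sscaleAl (c : K) f g : c *: (f * g) = (c *: f) * g.
Proof.
apply: seriesP => m /=; rewrite mulr_sumr.
by apply: eq_bigr => k _; rewrite mulrA.
Qed.

HB.instance Definition _ := GRing.Lmodule_isLalgebra.Build K O sscaleAl.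
HB.instance Definition _ := GRing.Lalgebra_isComAlgebra.Build K O.

Definition sderiv (i : 'I_n) f : O :=
  Series (fun m => (m i).+1%:R * scoef f (monD m (mon1 i))).

End Series.

Record ideal (A : comNzRingType) := Ideal {
  ideal_set :> set A;
  ideal0 : ideal_set 0;
  idealD : forall x y, ideal_set x -> ideal_set y -> ideal_set (x + y);
  idealM : forall a x, ideal_set x -> ideal_set (a * x)
}.

Section Ideals.
Variable A : comNzRingType.
Implicit Types (S : set A) (I J : ideal A).

Definition gen_set S : set A :=
  [set x | exists (r : nat) (a s : 'I_r -> A),
             (forall i, S (s i)) /\ x = \sum_i a i * s i].

Lemma gen_set0 S : gen_set S 0.
Proof.
by exists 0%N, (fun=> 0), (fun=> 0); split; [case | rewrite big_ord0].
Qed.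

Lemma gen_setD S x y : gen_set S x -> gen_set S y -> gen_set S (x + y).
Proof.
move=> [p [a [s [sS ->]]]] [q [b [t [tS ->]]]].
pose c (T : Type) (u : 'I_p -> T) v (i : 'I_(p + q)) :=
  match split i with inl j => u j | inr j => v j end.
exists (p + q)%N, (c A a b), (c A s t); split=> [i|].
  by rewrite /c; case: split.
rewrite big_split_ord /=; congr (_ + _); apply: eq_bigr => i _; rewrite /c.
  by rewrite -[lshift q i]/(unsplit (inl i)) unsplitK.
by rewrite -[rshift p i]/(unsplit (inr i)) unsplitK.
Qed.

Lemma gen_setM S a x : gen_set S x -> gen_set S (a * x).
Proof.
move=> [p [b [s [sS ->]]]]; exists p, (fun i => a * b i), s; split=> //.
by rewrite mulr_sumr; apply: eq_bigr => i _; rewrite mulrA.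
Qed.

Definition gen_ideal S : ideal A := Ideal (gen_set0 S) (@gen_setD S) (@gen_setM S).

Definition mul_ideal I J : ideal A :=
  gen_ideal [set a * b | a in I & b in J].

Fixpoint pow_ideal I (k : nat) : ideal A :=
  if k is k'.+1 then mul_ideal I (pow_ideal I k') else gen_ideal [set 1].

Definition adjoin f I : ideal A := gen_ideal ([set f] `|` I).

Lemma sub_gen_ideal S : S `<=` gen_ideal S.
Proof.
move=> x Sx; exists 1%N, (fun=> 1), (fun=> x); split=> //.
by rewrite big_ord1 mul1r.
Qed.

Lemma gen_ideal_sub S I : S `<=` I -> gen_ideal S `<=` I.
Proof.
move=> SI _ [p [a [s [sS ->]]]].
elim/big_ind: _ => [|x y|i _]; [exact: ideal0|exact: idealD|].
exact/idealM/SI.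
Qed.

Definition ideal_pred I : {pred A} := [pred x | `[< ideal_set I x >]].

Lemma ideal_predE I x : (x \in ideal_pred I) = `[< ideal_set I x >].
Proof. by []. Qed.

Lemma ideal_zmod_closed I : zmod_closed (ideal_pred I).
Proof.
split=> [|x y]; rewrite !ideal_predE; first exact/asboolP/ideal0.
move=> /asboolP Ix /asboolP Iy; apply/asboolP/idealD => //.
by rewrite -mulN1r; apply: idealM.
Qed.

HB.instance Definition _ I :=
  GRing.isZmodClosed.Build A (ideal_pred I) (ideal_zmod_closed I).

(* MathComp's quotient rings only cover proper ideals; the underlying
   Z-module quotient is reused here for arbitrary ones. *)
Definition quo I := Quotient.quot (ideal_pred I : zmodClosed A).
HB.instance Definition _ I := Choice.on (quo I).
HB.instance Definition _ I := GRing.Zmodule.on (quo I).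

Definition cls I (x : A) : quo I := \pi_(quo I)%qT x.

Lemma clsP I x y : cls I x = cls I y <-> ideal_set I (x - y).
Proof.
split=> [/eqP|Ixy]; last apply/eqP.
  by rewrite -[_ == _]/(x == y %[mod quo I])%qT -Quotient.idealrBE => /asboolP.
by rewrite -[_ == _]/(x == y %[mod quo I])%qT -Quotient.idealrBE; apply/asboolP.
Qed.

Lemma cls_surj I (u : quo I) : exists x, u = cls I x.
Proof. by exists (repr u); rewrite /cls reprK. Qed.

End Ideals.

Section QuotientRing.
Variables (A : comNzRingType) (I : ideal A).
Local Notation Q := (quo I).

Let idealMr x a : ideal_set I x -> ideal_set I (x * a).
Proof. by rewrite mulrC; exact: idealM. Qed.

Definition quo_one : Q := cls I 1.
Definition quo_mul (u v : Q) : Q := cls I (repr u * repr v).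

Let repr_cls x : ideal_set I (repr (cls I x) - x).
Proof. by apply/clsP; rewrite /cls reprK. Qed.

Lemma clsM x y : cls I (x * y) = quo_mul (cls I x) (cls I y).
Proof.
apply/esym/clsP; set x' := repr _; set y' := repr _.
have -> : x' * y' - x * y = x' * (y' - y) + (x' - x) * y.
  by rewrite mulrBr mulrBl addrA subrK.
by apply: idealD; [apply: idealM | apply: idealMr]; apply: repr_cls.
Qed.

Lemma clsB : zmod_morphism (cls I).
Proof. by move=> x y; rewrite /cls !piE. Qed.

HB.instance Definition _ := GRing.isZmodMorphism.Build A Q (cls I) clsB.

Lemma quo_mulA : associative quo_mul.
Proof.
move=> u v w; have [[x ->] [y ->] [z ->]] := And3 (cls_surj u) (cls_surj v) (cls_surj w).
by rewrite -!clsM mulrA.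
Qed.
Lemma quo_mulC : commutative quo_mul.
Proof. by move=> u v; rewrite /quo_mul mulrC. Qed.
Lemma quo_mul1 : left_id quo_one quo_mul.
Proof. by move=> u; have [x ->] := cls_surj u; rewrite -clsM mul1r. Qed.
Lemma quo_mulDl : left_distributive quo_mul +%R.
Proof.
move=> u v w; have [[x ->] [y ->] [z ->]] := And3 (cls_surj u) (cls_surj v) (cls_surj w).
by rewrite -raddfD -!clsM mulrDl raddfD.
Qed.

HB.instance Definition _ :=
  GRing.Zmodule_isComPzRing.Build Q quo_mulA quo_mulC quo_mul1 quo_mulDl.

Lemma cls_monoid : monoid_morphism (cls I).
Proof. by split=> // x y; rewrite clsM. Qed.

HB.instance Definition _ := GRing.isMonoidMorphism.Build A Q (cls I) cls_monoid.
End QuotientRing.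

Section QuotientModule.
Variables (K : fieldType) (A : comAlgType K) (I : ideal A).
Local Notation Q := (quo I).

Definition quo_scale (c : K) (u : Q) : Q := cls I c%:A * u.

Lemma quo_scaleA a b u : quo_scale a (quo_scale b u) = quo_scale (a * b) u.
Proof. by rewrite /quo_scale mulrA -rmorphM /= -scalerAl mul1r scalerA. Qed.
Lemma quo_scale1 : left_id 1 quo_scale.
Proof. by move=> u; rewrite /quo_scale scale1r rmorph1 mul1r. Qed.
Lemma quo_scaleDr : right_distributive quo_scale +%R.
Proof. by move=> c u v; rewrite /quo_scale mulrDr. Qed.
Lemma quo_scaleDl u : {morph quo_scale^~ u : a b / a + b}.
Proof. by move=> a b; rewrite /quo_scale scalerDl raddfD mulrDl. Qed.

HB.instance Definition _ :=
  GRing.Zmodule_isLmodule.Build K Q quo_scaleA quo_scale1 quo_scaleDr quo_scaleDl.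

Lemma cls_scalable : scalable (cls I).
Proof.
by move=> c x; rewrite /GRing.scale /= /quo_scale -rmorphM -scalerAl mul1r.
Qed.

HB.instance Definition _ := GRing.isScalable.Build K A Q *:%R (cls I) cls_scalable.

(* The image of J in A / I; this is J / I when I is contained in J. *)
Definition subquo_pred (J : ideal A) : {pred Q} :=
  [pred u | `[< exists2 x, ideal_set J x & u = cls I x >]].

Lemma subquo_submod_closed (J : ideal A) : submod_closed (subquo_pred J).
Proof.
split=> [|c u v].
  by apply/asboolP; exists 0; [exact: ideal0 | rewrite raddf0].
move=> /asboolP [x Jx ->] /asboolP [y Jy ->]; apply/asboolP.
exists (c *: x + y); last by rewrite linearP.
by apply: idealD => //; rewrite -[x]mul1r scalerAl; apply: idealM.
Qed.

HB.instance Definition _ (J : ideal A) :=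
  GRing.isSubmodClosed.Build K Q (subquo_pred J) (subquo_submod_closed J).

Record subquo (J : ideal A) := Subquo {
  subquo_val : Q;
  subquo_valP : subquo_val \in subquo_pred J
}.

HB.instance Definition _ J := [isSub for @subquo_val J].
HB.instance Definition _ J := [Choice of subquo J by <:].
HB.instance Definition _ J := [SubChoice_isSubLmodule of subquo J by <:].
End QuotientModule.

(* Values in {0, 1, 2, ..., +oo}. *)
Definition dimension (R : realType) (K : fieldType) (V : lmodType K) : \bar R :=
  ereal_sup [set (r%:R)%:E | r in [set r | exists v : 'I_r -> V,
    forall c : 'I_r -> K, \sum_i c i *: v i = 0 -> forall i, c i = 0]].

(* A K-algebra given by its structure map. The zero ring is allowed, since the
   0-residue fat point has structure algebra O/(f, m^0) = 0; this rules out
   MathComp's comAlgType. *)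
Record calg (K : fieldType) := CAlg {
  calg_ring :> comPzRingType;
  calg_const : {rmorphism K -> calg_ring}
}.

Record algHom (K : fieldType) (A B : calg K) := AlgHom {
  algHom_fun :> {rmorphism A -> B};
  algHom_const : forall c, algHom_fun (calg_const A c) = calg_const B c
}.

Section Germs.
Variable K : fieldType.

Definition series_alg n : calg K := CAlg (GRing.in_alg (series K n)).

Definition quo_alg (A : comAlgType K) (I : ideal A) : calg K :=
  CAlg (cls I \o GRing.in_alg A).

(* A germ is given by its structure algebra, a quotient of K[[x_1, ..., x_N]]. *)
Record germ := Germ {
  galg :> calg K;
  galgP : exists N (p : algHom (series_alg N) galg), forall a, exists s, p s = a
}.
Implicit Types S T U V W X Y Z : germ.

(* A morphism S -> T is its comorphism O_T -> O_S; [u a] is the pullback to S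
   of the function a on T. *)
Definition mor S T := algHom T S.
Definition mor_fun S T (u : mor S T) : T -> S := u.
Coercion mor_fun : mor >-> Funclass.

Definition idm S : mor S S := AlgHom (algHom_fun := idfun) (fun=> erefl).

Lemma comp_const S T U (v : mor T U) (u : mor S T) c :
  (algHom_fun u \o algHom_fun v) (calg_const U c) = calg_const S c.
Proof. by rewrite /= !algHom_const. Qed.

Definition comp S T U (v : mor T U) (u : mor S T) : mor S U :=
  AlgHom (comp_const v u).

Definition mor_eq S T (u v : mor S T) := forall a, u a = v a.
Local Notation "u ≡ v" := (mor_eq u v) (at level 70).
Local Notation "v ∘ u" := (comp v u) (at level 40, left associativity).

Definition iso S T (u : mor S T) :=
  exists v : mor T S, v ∘ u ≡ idm S /\ u ∘ v ≡ idm T.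

Definition embedding S T (u : mor S T) := forall a : S, exists b : T, u b = a.

(*   W --a--> X
     |        |
     b        c
     v        v
     Y --d--> Z   *)
Definition cartesian W X Y Z
    (a : mor W X) (b : mor W Y) (c : mor X Z) (d : mor Y Z) :=
  c ∘ a ≡ d ∘ b /\
  forall V (u : mor V X) (v : mor V Y), c ∘ u ≡ d ∘ v ->
    exists w : mor V W, [/\ a ∘ w ≡ u, b ∘ w ≡ v &
      forall w' : mor V W, a ∘ w' ≡ u -> b ∘ w' ≡ v -> w' ≡ w].

Definition product W X Y (p : mor W X) (q : mor W Y) :=
  forall V (u : mor V X) (v : mor V Y),
    exists w : mor V W, [/\ p ∘ w ≡ u, q ∘ w ≡ v &
      forall w' : mor V W, p ∘ w' ≡ u -> q ∘ w' ≡ v -> w' ≡ w].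

(* [tensor_eq0 phi s] says that the sum of the elements n ⊗ b, for (n, b) in s,
   vanishes in N ⊗_A B, where B is an A-module through phi: by the universal
   property of the tensor product, all balanced maps out of N x B kill it. *)
Definition balanced (A B : comPzRingType) (phi : {rmorphism A -> B})
    (N : lmodType A) (Q : zmodType) (beta : N -> B -> Q) :=
  [/\ forall x, {morph beta x : b b' / b + b'},
      forall b, {morph beta^~ b : x x' / x + x'} &
      forall a x b, beta (a *: x) b = beta x (phi a * b)].

Definition tensor_eq0 (A B : comPzRingType) (phi : {rmorphism A -> B})
    (N : lmodType A) (s : seq (N * B)) :=
  forall (Q : zmodType) (beta : N -> B -> Q), balanced phi beta ->
    \sum_(x <- s) beta x.1 x.2 = 0.

Definition flat_rmorphism (A B : comPzRingType) (phi : {rmorphism A -> B}) :=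
  forall (N N' : lmodType A) (j : {linear N -> N'}), injective j ->
  forall s : seq (N * B),
    tensor_eq0 phi [seq (j x.1, x.2) | x <- s] -> tensor_eq0 phi s.

Definition flat S T (u : mor S T) := flat_rmorphism (algHom_fun u).

Lemma quo_algP n (I : ideal (series K n)) :
  exists N (p : algHom (series_alg N) (quo_alg I)), forall a, exists s, p s = a.
Proof.
have pP c : (cls I : {rmorphism series K n -> quo I})
  (calg_const (series_alg n) c) = calg_const (quo_alg I) c by [].
exists n, (@AlgHom _ (series_alg n) (quo_alg I) _ pP) => a.
by have [s ->] := cls_surj a; exists s.
Qed.

(* The germ at 0 of the zero locus of I in affine n-space. *)
Definition locus n (I : ideal (series K n)) : germ := Germ (quo_algP I).

Section SubLocus.
Variables (n : nat) (I J : ideal (series K n)) (IJ : ideal_set I `<=` ideal_set J).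

Definition sub_locus_fun (u : quo I) : quo J := cls J (repr u).

Lemma sub_locusE x : sub_locus_fun (cls I x) = cls J x.
Proof. by apply/clsP/IJ/clsP; rewrite /cls reprK. Qed.

Lemma sub_locusB : zmod_morphism sub_locus_fun.
Proof.
move=> u v; have [[x ->] [y ->]] := conj (cls_surj u) (cls_surj v).
by rewrite -raddfB !sub_locusE raddfB.
Qed.

Lemma sub_locusM : monoid_morphism sub_locus_fun.
Proof.
split=> [|u v]; first exact: sub_locusE.
have [[x ->] [y ->]] := conj (cls_surj u) (cls_surj v).
by rewrite -rmorphM !sub_locusE rmorphM.
Qed.

HB.instance Definition _ :=
  GRing.isZmodMorphism.Build (quo I) (quo J) sub_locus_fun sub_locusB.
HB.instance Definition _ :=
  GRing.isMonoidMorphism.Build (quo I) (quo J) sub_locus_fun sub_locusM.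

Lemma sub_locus_const c :
  sub_locus_fun (calg_const (quo_alg I) c) = calg_const (quo_alg J) c.
Proof. exact: sub_locusE. Qed.

Definition sub_locus : mor (locus J) (locus I) :=
  @AlgHom _ (quo_alg I) (quo_alg J) sub_locus_fun sub_locus_const.
End SubLocus.

Lemma pt_algP :
  exists N (p : algHom (series_alg N) (CAlg (idfun : {rmorphism K -> K}))),
    forall a, exists s, p s = a.
Proof.
pose ev (f : series K 0) := scoef f mon0.
have evB : zmod_morphism ev by [].
have evM : monoid_morphism ev.
  split=> [|f g]; rewrite /ev /= ?eqxx //.
  have lt0 : (mdeg (mon0 (n := 0)) < (mdeg (mon0 (n := 0))).+1)%N by [].
  pose b := mpoly.BMultinom lt0.
  rewrite (bigD1 (b, b)) /=; last by apply/eqP/mpoly.mnmP => -[].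
  rewrite big1 ?addr0 // => -[[k1 ?] [k2 ?]] /= /andP[_ /eqP[]].
  by congr pair; apply: val_inj; apply/mpoly.mnmP => -[].
pose evr := HB.pack_for {rmorphism series K 0 -> K} ev
  (GRing.isZmodMorphism.Build _ _ ev evB)
  (GRing.isMonoidMorphism.Build _ _ ev evM).
have evc c : evr (calg_const (series_alg 0) c) = c.
  by rewrite /= /ev /= eqxx mulr1.
exists 0%N, (@AlgHom _ (series_alg 0) (CAlg (idfun : {rmorphism K -> K})) evr evc) => a.
exists (Series (fun=> a)); exact: erefl.
Qed.

Definition pt : germ := Germ pt_algP.

Definition to_pt S : mor S pt :=
  @AlgHom _ (CAlg (idfun : {rmorphism K -> K})) S (calg_const S) (fun=> erefl).
End Germs.

(* K[e_1, ..., e_d] / (e_1, ..., e_d)^2; for d = 1 the dual numbers, for d = 2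
   the fibre product over K of two copies of the dual numbers. *)
Record first_order (K : fieldType) (d : nat) :=
  FirstOrder { fo_const : K; fo_lin : 'rV[K]_d }.

Section FirstOrder.
Variables (K : fieldType) (d : nat).
Local Notation D := (first_order K d).

HB.instance Definition _ := gen_eqMixin D.
HB.instance Definition _ := gen_choiceMixin D.

Definition fo_zero : D := FirstOrder 0 0.
Definition fo_opp (u : D) : D := FirstOrder (- fo_const u) (- fo_lin u).
Definition fo_add (u v : D) : D :=
  FirstOrder (fo_const u + fo_const v) (fo_lin u + fo_lin v).
Definition fo_one : D := FirstOrder 1 0.
Definition fo_mul (u v : D) : D :=
  FirstOrder (fo_const u * fo_const v)
             (fo_const u *: fo_lin v + fo_const v *: fo_lin u).

Lemma fo_addA : associative fo_add.
Proof. by move=> u v w; congr FirstOrder; apply: addrA. Qed.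
Lemma fo_addC : commutative fo_add.
Proof. by move=> u v; congr FirstOrder; apply: addrC. Qed.
Lemma fo_add0 : left_id fo_zero fo_add.
Proof. by case=> a u; congr FirstOrder; apply: add0r. Qed.
Lemma fo_addN : left_inverse fo_zero fo_opp fo_add.
Proof. by move=> u; congr FirstOrder; apply: addNr. Qed.

HB.instance Definition _ := GRing.isZmodule.Build D fo_addA fo_addC fo_add0 fo_addN.

Lemma fo_mulA : associative fo_mul.
Proof.
move=> u v w; congr FirstOrder => /=; first exact: mulrA.
rewrite !scalerDr !scalerA -addrA; congr (_ + (_ + _)).
  by rewrite mulrC.
by rewrite mulrC.
Qed.
Lemma fo_mulC : commutative fo_mul.
Proof. by move=> u v; congr FirstOrder; [exact: mulrC | exact: addrC]. Qed.
Lemma fo_mul1 : left_id fo_one fo_mul.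
Proof.
by case=> a u; congr FirstOrder => /=; rewrite ?mul1r // scale1r scaler0 addr0.
Qed.
Lemma fo_mulDl : left_distributive fo_mul +%R.
Proof.
move=> u v w; congr FirstOrder => /=; first exact: mulrDl.
by rewrite scalerDl scalerDr addrACA.
Qed.
Lemma fo_one_neq0 : fo_one != 0.
Proof. by apply/eqP => /(congr1 (@fo_const K d))/eqP; rewrite oner_eq0. Qed.

HB.instance Definition _ :=
  GRing.Zmodule_isComNzRing.Build D fo_mulA fo_mulC fo_mul1 fo_mulDl fo_one_neq0.

Definition fo_scalar (c : K) : D := FirstOrder c 0.

Lemma fo_scalarB : zmod_morphism fo_scalar.
Proof. by move=> a b; congr FirstOrder => /=; rewrite ?subr0 ?oppr0. Qed.
Lemma fo_scalarM : monoid_morphism fo_scalar.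
Proof. by split=> // a b; congr FirstOrder => /=; rewrite !scaler0 addr0. Qed.

HB.instance Definition _ := GRing.isZmodMorphism.Build K D fo_scalar fo_scalarB.
HB.instance Definition _ := GRing.isMonoidMorphism.Build K D fo_scalar fo_scalarM.

Definition fo_alg : calg K := CAlg fo_scalar.

Lemma fo_constB : zmod_morphism (@fo_const K d). Proof. by []. Qed.
Lemma fo_constM : monoid_morphism (@fo_const K d). Proof. by []. Qed.

HB.instance Definition _ :=
  GRing.isZmodMorphism.Build D K (@fo_const K d) fo_constB.
HB.instance Definition _ :=
  GRing.isMonoidMorphism.Build D K (@fo_const K d) fo_constM.

Definition jet1 (f : series K d) : D :=
  FirstOrder (scoef f mon0) (\row_i scoef f (mon1 i)).

Lemma jet1B : zmod_morphism jet1.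
Proof.
move=> f g; congr FirstOrder => //=.
by apply/rowP => i; rewrite !mxE.
Qed.

Lemma mon1_neq0 (i : 'I_d) : mon1 i != mon0.
Proof. by rewrite -mpoly.mdeg_eq0 mpoly.mdeg1. Qed.

Lemma jet1M : monoid_morphism jet1.
Proof.
split=> [|f g]; congr FirstOrder => /=.
- by rewrite eqxx.
- by apply/rowP => i; rewrite !mxE (negbTE (mon1_neq0 i)).
- have lt0 : (mdeg (mon0 (n := d)) < (mdeg (mon0 (n := d))).+1)%N by [].
  pose b := mpoly.BMultinom lt0.
  rewrite (bigD1 (b, b)) /= ?mpoly.add0m //.
  rewrite big1 ?addr0 // => -[[k1 d1] [k2 d2]] /= /andP[/eqP E /eqP[]].
  have /andP[/eqP E1 /eqP E2] : (k1 == mon0) && (k2 == mon0).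
    by rewrite -!mpoly.mdeg_eq0 -addn_eq0 -mpoly.mdegD -E mpoly.mdeg0.
  by congr pair; apply: val_inj.
apply/rowP => i; rewrite !mxE /=.
have lt0 : (mdeg (mon0 (n := d)) < (mdeg (mon1 i)).+1)%N by rewrite mpoly.mdeg0.
have lt1 : (mdeg (mon1 i) < (mdeg (mon1 i)).+1)%N by [].
pose b0 := mpoly.BMultinom lt0; pose b1 := mpoly.BMultinom lt1.
rewrite (bigD1 (b0, b1)) /= ?mpoly.add0m // (bigD1 (b1, b0)) /=; last first.
  rewrite mpoly.addm0 eqxx /=; apply/eqP => /(congr1 (fun p => val p.1)) /= /eqP.
  by rewrite (negbTE (mon1_neq0 i)).
rewrite big1 ?addr0 ?[scoef f _ * scoef g mon0]mulrC //.
move=> [[k1 d1] [k2 d2]] /= /andP[/andP[/eqP Ek /eqP N1] /eqP N2].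
case: (boolP (k1 == mon0)) => [/eqP E1|k1N].
  case: N1; congr pair; apply: val_inj => //=.
  by rewrite Ek E1 mpoly.add0m.
case: (boolP (k2 == mon0)) => [/eqP E2|k2N].
  case: N2; congr pair; apply: val_inj => //=.
  by rewrite Ek E2 mpoly.addm0.
move: k1N k2N (congr1 (@mpoly.mdeg d) Ek).
rewrite -!mpoly.mdeg_eq0 mpoly.mdegD mpoly.mdeg1.
by case: (mdeg k1) => // a; case: (mdeg k2) => // b _ _; rewrite addnS.
Qed.

HB.instance Definition _ := GRing.isZmodMorphism.Build (series K d) D jet1 jet1B.
HB.instance Definition _ := GRing.isMonoidMorphism.Build (series K d) D jet1 jet1M.

Lemma jet1_const c : jet1 (calg_const (series_alg K d) c) = calg_const fo_alg c.
Proof.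
congr FirstOrder => /=; first by rewrite eqxx mulr1.
by apply/rowP => i; rewrite !mxE (negbTE (mon1_neq0 i)) mulr0.
Qed.

Lemma fo_algP :
  exists N (p : algHom (series_alg K N) fo_alg), forall a, exists s, p s = a.
Proof.
exists d, (@AlgHom _ (series_alg K d) fo_alg jet1 jet1_const) => -[a u].
exists (Series (fun m => if m == mon0 then a else
  \sum_(i | m == mon1 i) u ord0 i)).
congr FirstOrder => /=; first by rewrite eqxx.
apply/rowP => i; rewrite !mxE (negbTE (mon1_neq0 i)) (bigD1 i) //=.
rewrite big1 ?addr0 // => j /andP[/eqP/mpoly.mnmP /(_ j)].
rewrite !mpoly.mnm1E eqxx eq_sym.
by case: eqP.
Qed.

Definition fo_germ : germ K := Germ fo_algP.

Definition fo_pt : mor (pt K) fo_germ :=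
  @AlgHom _ fo_alg (CAlg (idfun : {rmorphism K -> K})) (@fo_const K d)
    (fun=> erefl).
End FirstOrder.

Section FirstOrderMor.
Variables (K : fieldType) (d e : nat) (M : 'M[K]_(d, e)).

Definition fo_subst (u : first_order K d) : first_order K e :=
  FirstOrder (fo_const u) (fo_lin u *m M).

Lemma fo_substB : zmod_morphism fo_subst.
Proof. by move=> u v; congr FirstOrder => /=; rewrite mulmxBl. Qed.
Lemma fo_substM : monoid_morphism fo_subst.
Proof.
split=> [|u v]; congr FirstOrder => /=; first by rewrite mul0mx.
by rewrite mulmxDl -!scalemxAl.
Qed.

HB.instance Definition _ := GRing.isZmodMorphism.Build
  (first_order K d) (first_order K e) fo_subst fo_substB.
HB.instance Definition _ := GRing.isMonoidMorphism.Build
  (first_order K d) (first_order K e) fo_subst fo_substM.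

Lemma fo_subst_const c :
  fo_subst (calg_const (fo_alg K d) c) = calg_const (fo_alg K e) c.
Proof. by congr FirstOrder => /=; rewrite mul0mx. Qed.

(* The morphism whose comorphism is e_i |-> \sum_j M i j e_j. *)
Definition fo_mor : mor (fo_germ K e) (fo_germ K d) :=
  @AlgHom _ (fo_alg K d) (fo_alg K e) fo_subst fo_subst_const.
End FirstOrderMor.

Section Deformations.
Variable K : fieldType.
Local Notation "u ≡ v" := (mor_eq u v) (at level 70).
Local Notation "v ∘ u" := (comp v u) (at level 40, left associativity).

Record base := Base { base_germ :> germ K; base_pt : mor (pt K) base_germ }.

Definition fo_base d : base := Base (fo_pt K d).

Record deformation (S : germ K) (T : base) := Deformation {
  tot : germ K;
  proj : mor tot T;
  emb : mor S tot;
  proj_flat : flat proj;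
  emb_embedding : embedding emb;
  def_cartesian : cartesian emb (to_pt S) proj (base_pt T)
}.

(* An equivalence, over T, of D with the trivial deformation P x T -> T,
   encoded by its component q : tot D ~ P x T -> P. *)
Definition trivialization (P : germ K) (T : base) (D : deformation P T) (q : mor (tot D) P) :=
  product q (proj D) /\ q ∘ emb D ≡ idm P.

Variables (P X : germ K) (i : mor P X).

Record pointed_def (T : base) := PointedDef {
  pd_X : deformation X T;
  pd_P : deformation P T;
  pd_inc : mor (tot pd_P) (tot pd_X);
  pd_inc_embedding : embedding pd_inc;
  pd_inc_proj : proj pd_X ∘ pd_inc ≡ proj pd_P;
  pd_cartesian : cartesian (emb pd_P) i pd_inc (emb pd_X);
  pd_triv : mor (tot pd_P) P;
  pd_trivP : trivialization pd_triv
}.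

(* The trivialization is part of the data and is preserved by equivalences:
   were the equivalences only required to induce the identity on P, an
   infinitesimal automorphism of P x T could be nontrivial and, for instance,
   x^3 + y^3 + e x^2 y would be a trivial 2-pointed first order deformation of
   x^3 + y^3. *)
Definition pd_equiv (T T' : base) (h : mor T T') (D : pointed_def T) (D' : pointed_def T') :=
  [/\ iso h, h ∘ base_pt T ≡ base_pt T' &
    exists (a : mor (tot (pd_P D)) (tot (pd_P D')))
           (b : mor (tot (pd_X D)) (tot (pd_X D'))),
      [/\ iso a, iso b &
        [/\ pd_inc D' ∘ a ≡ b ∘ pd_inc D,
            proj (pd_X D') ∘ b ≡ h ∘ proj (pd_X D),
            a ∘ emb (pd_P D) ≡ emb (pd_P D'),
            b ∘ emb (pd_X D) ≡ emb (pd_X D') &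
            pd_triv D' ∘ a ≡ pd_triv D]]].

(* Def(T) classifies deformations over the fixed base T: the isomorphism
   between the bases has to be the identity, since otherwise pulling back
   along T' -> T would not be well defined on classes. *)
Definition pd_class (T : base) (D : pointed_def T) : pointed_def T -> Prop :=
  fun D' => pd_equiv (idm T) D D'.

Definition Def (T : base) := {c : pointed_def T -> Prop | exists D, c = pd_class D}.

Definition def_class (T : base) (D : pointed_def T) : Def T :=
  exist _ (pd_class D) (ex_intro _ D erefl).

Definition pd_pullback (T T' : base) (h : mor T' T)
    (D : pointed_def T) (D' : pointed_def T') :=
  exists (a : mor (tot (pd_P D')) (tot (pd_P D)))
         (b : mor (tot (pd_X D')) (tot (pd_X D))),
    [/\ cartesian a (proj (pd_P D')) (proj (pd_P D)) h,
        cartesian b (proj (pd_X D')) (proj (pd_X D)) h &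
      [/\ pd_inc D ∘ a ≡ b ∘ pd_inc D',
          a ∘ emb (pd_P D') ≡ emb (pd_P D),
          b ∘ emb (pd_X D') ≡ emb (pd_X D) &
          pd_triv D ∘ a ≡ pd_triv D']].

Definition def_pullback (T T' : base) (h : mor T' T) (t : Def T) (t' : Def T') :=
  exists D D', [/\ t = def_class D, t' = def_class D' & pd_pullback h D D'].

(* The vector space structure of Def(T_eps) induced by the functor Def, whose
   action on morphisms is the relation def_pullback: c acts through
   e |-> c e, and t1 + t2 is the restriction to the diagonal of a class over
   K[e_1, e_2] / (e_1, e_2)^2 whose restrictions to the axes are t1 and t2. *)
Definition T_eps : base := fo_base 1.

Definition tan_scale (c : K) (t t' : Def T_eps) :=
  def_pullback (fo_mor (c%:M : 'M[K]_(1, 1)) : mor T_eps T_eps) t t'.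

Definition tan_add (t1 t2 t : Def T_eps) :=
  exists s : Def (fo_base 2),
    [/\ def_pullback (fo_mor (delta_mx 0 0) : mor T_eps (fo_base 2)) s t1,
        def_pullback (fo_mor (delta_mx 1 0) : mor T_eps (fo_base 2)) s t2 &
        def_pullback (fo_mor (const_mx 1) : mor T_eps (fo_base 2)) s t].

Record tangent_space := TangentSpace {
  tan_space :> lmodType K;
  tan_coord : Def T_eps -> tan_space;
  tan_coord_bij : bijective tan_coord;
  tan_coordD : forall t1 t2 t,
    tan_add t1 t2 t <-> tan_coord t = tan_coord t1 + tan_coord t2;
  tan_coordZ : forall c t t',
    tan_scale c t t' <-> tan_coord t' = c *: tan_coord t
}.
End Deformations.

Section Hypersurface.
Variables (K : fieldType) (n : nat).
Local Notation O := (series K n).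
Implicit Types f : O.

Definition maxi_set : set O := [set g | scoef g mon0 = 0].

Lemma maxi0 : maxi_set 0. Proof. by []. Qed.
Lemma maxiD g h : maxi_set g -> maxi_set h -> maxi_set (g + h).
Proof. by rewrite /maxi_set /= => -> ->; rewrite addr0. Qed.
Lemma maxiM a g : maxi_set g -> maxi_set (a * g).
Proof.
rewrite /maxi_set /= => g0; apply: big1 => -[[k1 ?] [k2 ?]] /= /eqP E.
suff -> : k2 = mon0 by rewrite g0 mulr0.
apply/eqP; rewrite -mpoly.mdeg_eq0; have : (mdeg k1 + mdeg k2 == 0)%N.
  by rewrite -mpoly.mdegD -E mpoly.mdeg0.
by rewrite addn_eq0 => /andP[].
Qed.

Definition maxi : ideal O := Ideal maxi0 maxiD maxiM.

Definition jacobian f : ideal O := gen_ideal (range (fun i => sderiv i f)).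

Definition fat_ideal f k : ideal O := adjoin f (pow_ideal maxi k).
Definition tjurina_ideal f k : ideal O :=
  adjoin f (mul_ideal (pow_ideal maxi k) (jacobian f)).
Definition tjurina_algebra f k := quo (tjurina_ideal f k).

Definition hypersurface f : germ K := locus (gen_ideal [set f]).
Definition fat_point f k : germ K := locus (fat_ideal f k).

Lemma fat_point_sub f k :
  ideal_set (gen_ideal [set f]) `<=` ideal_set (fat_ideal f k).
Proof. by apply: gen_ideal_sub => _ ->; apply: sub_gen_ideal; left. Qed.

Definition fat_point_mor f k : mor (fat_point f k) (hypersurface f) :=
  sub_locus (@fat_point_sub f k).

Definition tjurina_quotient f k := subquo (tjurina_ideal f k) (fat_ideal f k).

Definition TDef f k := tangent_space (fat_point_mor f k).
End Hypersurface.

Section Analytic.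
Variables (R : realType) (n : nat).
Local Notation C := (R[i])%C.
Implicit Types f : series C n.

Definition convergent f :=
  exists r M : C, 0 < r /\ forall m, `|scoef f m| * r ^+ mdeg m <= M.

(* f(z) = w, summing by total degree. *)
Definition has_value f (z : 'I_n -> C) (w : C^o) :=
  (fun d => \sum_(m : bmon n d) scoef f m * \prod_i z i ^+ m i : C^o) @ \oo --> w.

Definition critical_point f (z : 'I_n -> C) :=
  forall i, has_value (sderiv i f) z 0.

Definition isolated_singularity f :=
  [/\ convergent f, scoef f mon0 = 0, critical_point f (fun=> 0) &
    exists r : C, 0 < r /\ forall z, (forall i, `|z i| < r) ->
      critical_point f z -> forall i, z i = 0].
End Analytic.

(* Main.v *)
From HB Require Import structures.
From mathcomp Require Import all_boot all_order all_algebra.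
From mathcomp Require Import -(notations) mpoly.
From mathcomp Require Import boolp classical_sets reals ereal.
From mathcomp Require Import topology normedtype.
From mathcomp Require Import complex ring.
Require Import Defs.

(** Write O = K[[x_1, ..., x_n]], I = (f, m^k), J = (f, m^k J(f)) and
D = K[e_1, ..., e_d] / (e_1, ..., e_d)^2. The claim is that a pointed deformation
over D is the same thing as an equation f + e_1 g_1 + ... + e_d g_d = 0 with all
g_i in I, and that the g_i matter only modulo J. For d = 1 this identifies the
tangent space with I / J; for d = 2 and for the linear maps between the bases it
identifies the vector space structure, since a base change with matrix M
replaces the g_i by their combinations with coefficients M.

The equation exists because coordinates of the hypersurface lift to the total
space, and the lifts can be chosen constant along the trivialized family of fat
points ([has_equation_exists]). Flatness over D says that the e_i have only the
obvious syzygies ([syzygies_of_flat], [flat_of_syzygies]), so that the total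
space is O[e] / (f + e g), and g vanishes on the fat point because the
latter is contained in the total space ([presents_ker], [presents_fat]). This
description is a universal property ([presents_univ]); equivalences and
pullbacks are obtained from it ([equation_pd_equiv], [equation_pd_pullback]).
Conversely every such g occurs: O[e] / (f + e g) is flat because f is
not a zero divisor ([equation_realized]).

Two choices of coordinates on the same deformation differ by a derivation
O -> O / (f). It takes values in I / (f) because the fat point does not move, it
is a combination of the partial derivatives with coefficients in I, and it
changes the equation by its value at f, an element of J modulo f
([presents_unique]); all of J arises in this way ([has_equation_change]). That
derivations and homomorphisms are determined by their values on the variables
is a matter of divisibility ([var_linear_divisible]) and of the closedness of
the ideal (f) ([principal_closed]), which holds because f <> 0: every point is
critical for the zero series.

The dimension formula is rank-nullity for the exact sequence
0 -> I / J -> O / J -> O / I -> 0, whose last term is spanned by the monomials of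
degree less than k ([dimension_kernel], [fat_point_spanning]). *)

Set Implicit Arguments.
Unset Strict Implicit.
Unset Printing Implicit Defensive.

Import Order.TTheory GRing.Theory Num.Theory.
Import numFieldNormedType.Exports.

Local Open Scope classical_set_scope.
Local Open Scope ring_scope.

Local Notation mon := mpoly.multinom.
Local Notation bmon := mpoly.bmultinom.
Local Notation mdeg := mpoly.mdeg.
Local Notation mon0 := (mpoly.mnm0).
Local Notation mon1 := mpoly.mnm1.
Local Notation monD := mpoly.mnm_add.

(** * Orders and divisibility in power series rings *)

Section SeriesTheory.
Variables (K : fieldType) (n : nat).
Local Notation O := (series K n).
Implicit Types f g h s t : O.

(** Identities between series are transferred from polynomials: truncation below
degree d is multiplicative up to terms of degree at least d. *)
Definition trunc d s : mpoly.mpoly n K :=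
  \sum_(m : bmon n d) scoef s m *: mpoly.mpolyX K m.

Lemma mcoeff_trunc d s m : (mdeg m < d)%N ->
  mpoly.mcoeff m (trunc d s) = scoef s m.
Proof. exact: mpoly.mcoeff_mpoly. Qed.

Lemma scoefM_poly s t p q m :
  (forall k, (mdeg k <= mdeg m)%N -> scoef s k = mpoly.mcoeff k p) ->
  (forall k, (mdeg k <= mdeg m)%N -> scoef t k = mpoly.mcoeff k q) ->
  scoef (s * t) m = mpoly.mcoeff m (p * q).
Proof.
move=> sp tq; rewrite mpoly.mcoeffM /=; apply: eq_bigr => k _.
by rewrite sp ?tq // -ltnS mpoly.bmdeg.
Qed.

Lemma scoef_sum (I : Type) (r : seq I) (P : pred I) (F : I -> O) m :
  scoef (\sum_(i <- r | P i) F i) m = \sum_(i <- r | P i) scoef (F i) m.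
Proof. by elim/big_rec2: _ => [|i a b _ <-]. Qed.

Lemma scoefB s t m : scoef (s - t) m = scoef s m - scoef t m.
Proof. by []. Qed.

Lemma in_algE (c : K) : GRing.in_alg O c = Series (fun m => c * (m == mon0)%:R).
Proof. by []. Qed.

Definition order_ge N s := forall m, (mdeg m < N)%N -> scoef s m = 0.

Lemma order_ge0 s : order_ge 0 s. Proof. by []. Qed.
Lemma order_ge_zero N : order_ge N 0. Proof. by []. Qed.
Lemma order_geD N s t : order_ge N s -> order_ge N t -> order_ge N (s + t).
Proof. by move=> Ns Nt m mN /=; rewrite Ns ?Nt ?addr0. Qed.
Lemma order_geN N s : order_ge N s -> order_ge N (- s).
Proof. by move=> Ns m mN /=; rewrite Ns ?oppr0. Qed.
Lemma order_geB N s t : order_ge N s -> order_ge N t -> order_ge N (s - t).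
Proof. by move=> Ns Nt; apply/order_geD/order_geN. Qed.
Lemma order_ge_sum N (I : Type) (r : seq I) (F : I -> O) :
  (forall i, order_ge N (F i)) -> order_ge N (\sum_(i <- r) F i).
Proof.
by move=> NF; elim/big_ind: _ => // s t; apply: order_geD.
Qed.
Lemma order_ge_le M N s : (M <= N)%N -> order_ge N s -> order_ge M s.
Proof. by move=> MN Ns m mM; apply: Ns; apply: leq_trans MN. Qed.

Lemma order_geM M N s t : order_ge M s -> order_ge N t -> order_ge (M + N) (s * t).
Proof.
move=> Ms Nt m mMN /=; apply: big1 => -[[k1 ?] [k2 ?]] /= /eqP E.
have [k1M|Mk1] := ltnP (mdeg k1) M; first by rewrite Ms ?mul0r.
rewrite Nt ?mulr0 // -(ltn_add2l M); apply: leq_trans mMN.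
by rewrite E mpoly.mdegD ltnS leq_add2r.
Qed.

Lemma order_geMl N s t : order_ge N t -> order_ge N (s * t).
Proof. by move=> Nt; rewrite -[N]add0n; apply: order_geM. Qed.

Lemma order_geX N s j : order_ge N s -> order_ge (N * j) (s ^+ j).
Proof.
move=> Ns; elim: j => [|j IH]; first by rewrite muln0.
by rewrite mulnS exprS; apply: order_geM.
Qed.

Lemma order_ge_eq0 s : (forall N, order_ge N s) -> s = 0.
Proof. by move=> s0; apply: seriesP => m; apply: (s0 (mdeg m).+1). Qed.

Lemma order_ge1P s : order_ge 1 s <-> scoef s mon0 = 0.
Proof.
split=> [|s0 m]; first by apply; rewrite mpoly.mdeg0.
by rewrite ltnS leqn0 mpoly.mdeg_eq0 => /eqP ->.
Qed.

Lemma order_geB_congr N s s' t t' : order_ge N (s - s') -> order_ge N (t - t') ->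
  order_ge N (s - t - (s' - t')).
Proof.
move=> Ns Nt; rewrite (_ : _ - _ = (s - s') - (t - t')); last by ring.
exact: order_geB.
Qed.

Lemma order_geM_congr N s s' t t' : order_ge N (s - s') -> order_ge N (t - t') ->
  order_ge N (s * t - s' * t').
Proof.
move=> Ns Nt; rewrite (_ : _ - _ = t * (s - s') + s' * (t - t')); last by ring.
by apply: order_geD; apply: order_geMl.
Qed.

Lemma order_ge_trans N s t u :
  order_ge N (s - t) -> order_ge N (u - t) -> order_ge N (s - u).
Proof.
move=> Ns Nt; rewrite (_ : _ - _ = (s - t) - (u - t)); last by ring.
exact: order_geB.
Qed.

Definition svar (i : 'I_n) : O := Series (fun m => (m == mon1 i)%:R).

Lemma scoef_svarM i s m :
  scoef (svar i * s) m = if (0 < m i)%N then scoef s (mpoly.mnm_sub m (mon1 i)) else 0.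
Proof.
have Ei (l : mon n) : (monD (mon1 i) l) i = (l i).+1.
  by rewrite mpoly.mnmDE mpoly.mnm1E eqxx.
case: ltnP => [mi|]; last first.
  rewrite leqn0 => /eqP mi; apply: big1 => -[[k1 ?] [k2 ?]] /= /eqP E.
  case: eqP => [E1|]; last by rewrite mul0r.
  by move: (congr1 (fun l : mon n => l i) E); rewrite /= E1 Ei mi.
have Em : m = monD (mon1 i) (mpoly.mnm_sub m (mon1 i)).
  rewrite mpoly.addmC mpoly.submK //; apply/mpoly.mnm_lepP => j.
  by rewrite mpoly.mnm1E; case: eqP => // <-.
set m' := mpoly.mnm_sub _ _ in Em *.
have Dm : mdeg m = (mdeg (mon1 i) + mdeg m')%N by rewrite [in LHS]Em mpoly.mdegD.
have lt1 : (mdeg (mon1 i) < (mdeg m).+1)%N by rewrite Dm ltnS leq_addr.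
have lt' : (mdeg m' < (mdeg m).+1)%N by rewrite Dm ltnS leq_addl.
rewrite /= (bigD1 (mpoly.BMultinom lt1, mpoly.BMultinom lt')) /=; last exact/eqP.
rewrite eqxx mul1r big1 ?addr0 // => -[[k1 ?] [k2 ?]] /= /andP[/eqP E].
case: (k1 =P mon1 i) => [E1 /eqP[]|]; last by rewrite mul0r.
congr pair; apply: val_inj => //=.
by apply: (@mpoly.addmI _ (mon1 i)); rewrite -Em E E1.
Qed.

Lemma order_ge_svar i : order_ge 1 (svar i).
Proof.
by apply/order_ge1P => /=; rewrite eq_sym mpoly.mnm1_eq0.
Qed.

(** The monomials of a series other than 1 are distributed among the variables
according to the first variable that they contain. *)
Definition sdiv (s : O) (i : 'I_n) : O := Series (fun m =>
  if [pick j | 0 < monD m (mon1 i) j]%N == Some i then scoef s (monD m (mon1 i)) else 0).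

Lemma series_decomp s :
  s = GRing.in_alg O (scoef s mon0) + \sum_i svar i * sdiv s i.
Proof.
apply: seriesP => m; rewrite in_algE /= scoef_sum.
under eq_bigr => i _ do rewrite scoef_svarM.
have [->|m0] := eqVneq m mon0.
  by rewrite mulr1 big1 ?addr0 // => i _; rewrite mpoly.mnm0E.
rewrite mulr0 add0r.
have Em i : (0 < m i)%N -> monD (mpoly.mnm_sub m (mon1 i)) (mon1 i) = m.
  move=> mi; rewrite mpoly.submK //; apply/mpoly.mnm_lepP => j.
  by rewrite mpoly.mnm1E; case: eqP => // <-.
have [i0 mi0 pi0] : exists2 i, (0 < m i)%N & [pick j | 0 < m j]%N = Some i.
  case: pickP => [i mi|mN]; first by exists i.
  case/eqP: m0; apply/mpoly.mnmP => i; rewrite mpoly.mnm0E; apply/eqP.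
  by rewrite -leqn0 leqNgt mN.
rewrite (bigD1 i0) //= mi0 Em // pi0 eqxx big1 ?addr0 // => i /negbTE ii0.
by case: ifP => // mi; rewrite Em // pi0 (inj_eq Some_inj) eq_sym ii0.
Qed.

Lemma order_ge_sdiv N s i : order_ge N.+1 s -> order_ge N (sdiv s i).
Proof.
move=> Ns m mN /=; case: ifP => // _; apply: Ns.
by rewrite mpoly.mdegD mpoly.mdeg1 addn1.
Qed.

Lemma pow_maxi_order N s : ideal_set (pow_ideal (maxi K n) N) s <-> order_ge N s.
Proof.
split; elim: N s => [|N IH] s //=.
- move=> [r [a [t [tS ->]]]]; apply: order_ge_sum => i; apply: order_geMl.
  have [u /order_ge1P u1 [v /IH vN <-]] := tS i.
  exact: (@order_geM 1 N).
- move=> _; exists 1%N, (fun=> s), (fun=> 1); split=> //.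
  by rewrite big_ord1 mulr1.
- move=> sN; rewrite (series_decomp s) sN ?mpoly.mdeg0 // rmorph0 add0r.
  exists n, (fun=> 1), (fun i => svar i * sdiv s i); split=> [i|].
    exists (svar i); first exact/order_ge1P/order_ge_svar.
    by exists (sdiv s i) => //; apply/IH/order_ge_sdiv.
  by apply: eq_bigr => i _; rewrite mul1r.
Qed.

(** An additive map out of the power series ring which is linear over the
variables and kills the constants is infinitely divisible by them. Both the
difference of two homomorphisms that agree on the variables and a derivation
that kills the variables are of this kind, so that both vanish when the target
is separated. *)
Lemma var_linear_divisible (R : comPzRingType) (psi : {rmorphism O -> R})
    (Delta : {additive O -> R}) :
  (forall c, Delta (GRing.in_alg O c) = 0) ->
  (forall i s, Delta (svar i * s) = psi (svar i) * Delta s) ->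
  forall N s, exists (r : nat) (t : 'I_r -> O) (b : 'I_r -> R),
    (forall j, order_ge N (t j)) /\ Delta s = \sum_j psi (t j) * b j.
Proof.
move=> D0 DX; elim=> [|N IH] s.
  exists 1%N, (fun=> 1), (fun=> Delta s); split=> //.
  by rewrite big_ord1 rmorph1 mul1r.
have /choice [r] : forall i, exists r, exists (t : 'I_r -> O) (b : 'I_r -> R),
    (forall j, order_ge N (t j)) /\ Delta (sdiv s i) = \sum_j psi (t j) * b j.
  by move=> i; apply: IH.
move=> /(_ _)/cid-/all_sig[t] /(_ _)/cid-/all_sig[b] tb.
(* The expressions for all the [sdiv s i] are concatenated. *)
pose c (p : {i & 'I_(r i)}) := psi (svar (tag p) * t (tag p) (tagged p)) * b (tag p) (tagged p).
exists #|{: {i & 'I_(r i)}}|, (fun j => svar (tag (enum_val j)) * t _ (tagged (enum_val j))),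
  (fun j => b _ (tagged (enum_val j))); split=> [j|].
  by rewrite -add1n; apply: order_geM; [apply: order_ge_svar | apply: (tb _).1].
rewrite [in LHS](series_decomp s) raddfD /= D0 add0r raddf_sum.
transitivity (\sum_p c p); last by rewrite big_enum_val.
rewrite -(sig_big_dep xpredT (fun _ => xpredT)
  (fun i (j : 'I_(r i)) => c (Tagged (fun i => 'I_(r i)) j))) /=.
apply: eq_bigr => i _; rewrite DX (tb i).2 mulr_sumr; apply: eq_bigr => j _.
by rewrite /c /= rmorphM mulrA.
Qed.

Lemma sderivM i s t : sderiv i (s * t) = sderiv i s * t + s * sderiv i t.
Proof.
apply: seriesP => m; set d := (mdeg m).+2.
have dtr u (k : mon n) : (mdeg k <= mdeg m)%N ->
    scoef (sderiv i u) k = mpoly.mcoeff k (mpoly.mderiv i (trunc d u)).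
  move=> km; rewrite mpoly.mcoeff_deriv mcoeff_trunc /= ?mulr_natl //.
  by rewrite mpoly.mdegD mpoly.mdeg1 addn1 !ltnS.
have tr u (k : mon n) : (mdeg k < d)%N -> scoef u k = mpoly.mcoeff k (trunc d u).
  by move=> kd; rewrite mcoeff_trunc.
have ltd (k : mon n) : (mdeg k <= mdeg m)%N -> (mdeg k < d)%N.
  by move=> km; rewrite ltnS (leq_trans km).
have -> : scoef (sderiv i (s * t)) m =
    mpoly.mcoeff m (mpoly.mderiv i (trunc d s * trunc d t)).
  rewrite mpoly.mcoeff_deriv -mulr_natl.
  transitivity ((m i).+1%:R * scoef (s * t) (monD m (mon1 i))) => //; congr (_ * _).
  rewrite (scoefM_poly (p := trunc d s) (q := trunc d t)) // => k;
    by rewrite mpoly.mdegD mpoly.mdeg1 addn1 => kd; apply: tr.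
rewrite mpoly.mderivM mpoly.mcoeffD; congr (_ + _); symmetry;
  [rewrite (scoefM_poly (p := mpoly.mderiv i (trunc d s)) (q := trunc d t)) //
  |rewrite (scoefM_poly (p := trunc d s) (q := mpoly.mderiv i (trunc d t))) //];
  by move=> k km; rewrite ?dtr // tr // ltd.
Qed.

Lemma sderivC i c : sderiv i (GRing.in_alg O c) = 0.
Proof.
apply: seriesP => m /=; rewrite mpoly.mnmD_eq0 mpoly.mnm1_eq0 andbF.
by rewrite !mulr0.
Qed.

Lemma sderiv_svar i j : sderiv i (svar j) = (i == j)%:R.
Proof.
apply: seriesP => m /=.
have -> : scoef ((i == j)%:R : O) m = (i == j)%:R * (m == mon0)%:R.
  by case: eqP => _; rewrite ?mul1r ?mul0r.
have [->|ij] := eqVneq i j.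
  rewrite -[X in _ == X]mpoly.add0m (can_eq (mpoly.addmK _)) mul1r.
  by case: eqP => [->|]; rewrite ?mulr0 // mpoly.mnm0E mulr1.
rewrite mul0r; case: eqP => [/mpoly.mnmP /(_ i)|]; last by rewrite mulr0.
by rewrite mpoly.mnmDE !mpoly.mnm1E eqxx eq_sym (negbTE ij) addn1.
Qed.

(** The product of two nonzero initial forms is nonzero, hence multiplication
by a nonzero series shifts orders by a constant. *)
Lemma order_ge_cancel f : f != 0 ->
  exists r, forall N h, order_ge (N + r) (h * f) -> order_ge N h.
Proof.
have order_of u : u != 0 -> exists r, order_ge r u /\ ~ order_ge r.+1 u.
  move=> u0; have /asboolPn exN : ~ (forall N, order_ge N u).
    by move/order_ge_eq0/eqP; apply/negP.
  have {}exN : exists N, `[< ~ order_ge N u >].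
    by move/asboolP: exN => /existsNP[N ?]; exists N; apply/asboolP.
  case: (ex_minnP exN) => -[|N] /asboolP uN minN; first by case: uN.
  exists N; split=> //; apply: contrapT => uN'.
  by have := minN N (asboolT uN'); rewrite ltnn.
move=> f0; have [r [rf rf']] := order_of f f0; exists r => N h Nhf.
have [->|h0] := eqVneq h 0; first exact: order_ge_zero.
have [q [qh qh']] := order_of h h0.
apply: (@order_ge_le _ q) => //; rewrite leqNgt; apply/negP => qN.
have hom u p : order_ge p u ->
    forall m : mon n, mdeg m != p -> mpoly.mcoeff m (trunc p.+1 u) = 0.
  move=> pu m mp; have [mp'|pm] := ltnP (mdeg m) p.+1.
    rewrite mcoeff_trunc // pu // ltn_neqAle mp /=; exact: mp'.
  rewrite /trunc raddf_sum /=; apply: big1 => k _.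
  rewrite mpoly.mcoeffZ mpoly.mcoeffX; case: eqP => [E|]; last by rewrite mulr0.
  by move: (mpoly.bmdeg k); rewrite E ltnNge pm.
have nz u p : ~ order_ge p.+1 u -> trunc p.+1 u != 0.
  move=> pu; apply/eqP => u0; apply: pu => m mp.
  by rewrite -(mcoeff_trunc u mp) u0 mpoly.mcoeff0.
(* These truncations are the initial forms of h and f. *)
suff : trunc q.+1 h * trunc r.+1 f = 0.
  by move/eqP; rewrite mulf_eq0 (negbTE (nz _ _ qh')) (negbTE (nz _ _ rf')).
apply/mpoly.mpolyP => m; rewrite mpoly.mcoeff0.
have [mqr|mqr] := eqVneq (mdeg m) (q + r)%N; last first.
  rewrite mpoly.mcoeffM; apply: big1 => -[[k1 ?] [k2 ?]] /= /eqP E.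
  have [k1q|/eqP k1q] := eqVneq (mdeg k1) q; last by rewrite (hom h) ?mul0r //; apply/eqP.
  rewrite (hom f) ?mulr0 //; apply: contra mqr => /eqP k2r.
  by rewrite E mpoly.mdegD k1q k2r.
rewrite -[RHS](Nhf m); last by rewrite mqr ltn_add2r.
rewrite mpoly.mcoeffM; apply: eq_bigr => -[[k1 ?] [k2 ?]] /= /eqP E.
have Eqr : (mdeg k1 + mdeg k2 = q + r)%N by rewrite -mpoly.mdegD -E.
have [k1q|k1q] := ltnP q (mdeg k1).
  rewrite [scoef f k2]rf ?mulr0 ?(hom h) ?mul0r ?gtn_eqF //.
  by rewrite -(ltn_add2l q) -Eqr ltn_add2r.
have [k2r|k2r] := ltnP r (mdeg k2).
  rewrite [scoef h k1]qh ?mul0r ?(hom f) ?mulr0 ?gtn_eqF //.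
  by rewrite -(ltn_add2r r) -Eqr ltn_add2l.
by rewrite !mcoeff_trunc.
Qed.

Lemma series_mulIf f h : f != 0 -> h * f = 0 -> h = 0.
Proof.
move=> /order_ge_cancel[r fr] hf0; apply: order_ge_eq0 => N.
by apply: fr; rewrite hf0; apply: order_ge_zero.
Qed.

Lemma principalP (A : comNzRingType) (x y : A) :
  ideal_set (gen_ideal [set x]) y <-> exists a, y = a * x.
Proof.
split=> [[r [a [s [sx ->]]]]|[a ->]]; last exact/idealM/sub_gen_ideal.
exists (\sum_i a i); rewrite mulr_suml.
by apply: eq_bigr => i _; rewrite (sx i).
Qed.

(** Principal ideals are closed: quotients by [f] of approximations of [s] form
a Cauchy sequence because orders can be cancelled, and their limit is a
quotient of [s]. *)
Lemma principal_closed f s : f != 0 ->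
  (forall N, exists h, order_ge N (s - h * f)) -> ideal_set (gen_ideal [set f]) s.
Proof.
move=> /order_ge_cancel[r fr] /choice[h sh]; apply/principalP.
(* The coefficient of h N at a monomial m is stationary from N = mdeg m + 1 + r on. *)
pose H := Series (fun m => scoef (h ((mdeg m).+1 + r)%N) m) : O.
exists H; apply/subr0_eq/order_ge_eq0 => N.
have -> : s - H * f = (s - h (N + r)%N * f) - (H - h (N + r)%N) * f.
  by ring.
apply: order_geB; first by apply: order_ge_le (sh _); apply: leq_addr.
rewrite mulrC; apply: order_geMl => m mN.
rewrite -[LHS]/(scoef (h ((mdeg m).+1 + r)%N - h (N + r)%N) m).
apply: (fr (mdeg m).+1) => //.
rewrite (_ : _ * f = (s - h (N + r)%N * f) - (s - h ((mdeg m).+1 + r)%N * f)); last by ring.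
by apply: order_geB => //; apply: order_ge_le (sh _); rewrite leq_add2r.
Qed.

End SeriesTheory.

(** * Substitution and units *)

Section Substitution.
Variables (K : fieldType) (N M : nat) (G : 'I_N -> series K M).
Hypothesis G_maxi : forall i, order_ge 1 (G i).
Local Notation eval := (mpoly.mmap (GRing.in_alg (series K M)) G).

(** Substituting series without constant term converges because it does not
lower orders. *)
Lemma eval_order_ge d (p : mpoly.mpoly N K) :
  (forall m, (mdeg m < d)%N -> mpoly.mcoeff m p = 0) -> order_ge d (eval p).
Proof.
move=> pd; apply: order_ge_sum => m.
have [md|dm] := ltnP (mdeg m) d; first by rewrite pd // rmorph0 mul0r.
apply: order_geMl; apply: order_ge_le dm _; rewrite mpoly.mdegE /mpoly.mmap1.
elim: (index_enum _) => [|i r IH]; first by rewrite big_nil; apply: order_ge0.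
rewrite !big_cons; apply: order_geM => //; rewrite -[X in order_ge X]mul1n.
exact: order_geX.
Qed.

Definition subst (s : series K N) : series K M :=
  Series (fun m => scoef (eval (trunc (mdeg m).+1 s)) m).

Lemma substE d s p : (forall m, (mdeg m < d)%N -> mpoly.mcoeff m p = scoef s m) ->
  order_ge d (subst s - eval p).
Proof.
move=> ps m md; rewrite scoefB -[scoef (subst s) m]/(scoef (eval _) m) -scoefB.
rewrite -rmorphB; apply: (@eval_order_ge (mdeg m).+1) => // k km.
by rewrite mpoly.mcoeffB mcoeff_trunc // ps ?subrr // (leq_trans km).
Qed.

Lemma subst_eq s t : (forall d, exists p : mpoly.mpoly N K,
    (forall m, (mdeg m < d)%N -> mpoly.mcoeff m p = scoef s m) /\
    order_ge d (t - eval p)) -> subst s = t.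
Proof.
move=> st; apply/subr0_eq/order_ge_eq0 => d; have [p [ps tp]] := st d.
by apply: order_ge_trans tp; apply: substE.
Qed.

Lemma substB : zmod_morphism subst.
Proof.
move=> s t; apply: subst_eq => d; exists (trunc d s - trunc d t).
split=> [m md|]; first by rewrite mpoly.mcoeffB !mcoeff_trunc.
rewrite rmorphB; apply: order_geB_congr; by apply: substE => m md; rewrite mcoeff_trunc.
Qed.

Lemma substM : monoid_morphism subst.
Proof.
split=> [|s t]; apply: subst_eq => d.
  exists 1; split=> [m md|]; first by rewrite mpoly.mcoeff1.
  by rewrite rmorph1 subrr; apply: order_ge_zero.
exists (trunc d s * trunc d t); split=> [m md|].
  rewrite (scoefM_poly (p := trunc d s) (q := trunc d t)) // => k km;
  by rewrite mcoeff_trunc // (leq_ltn_trans km).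
rewrite rmorphM; apply: order_geM_congr; by apply: substE => m md; rewrite mcoeff_trunc.
Qed.

HB.instance Definition _ := GRing.isZmodMorphism.Build _ _ subst substB.
HB.instance Definition _ := GRing.isMonoidMorphism.Build _ _ subst substM.

Lemma subst_const c :
  subst (calg_const (series_alg K N) c) = calg_const (series_alg K M) c.
Proof.
apply: subst_eq => d; exists (mpoly.mpolyC _ c); split=> [m md|].
  by rewrite mpoly.mcoeffC.
by rewrite mpoly.mmapC /= subrr; apply: order_ge_zero.
Qed.

Definition subst_hom : algHom (series_alg K N) (series_alg K M) :=
  @AlgHom _ (series_alg K N) (series_alg K M) subst subst_const.

Lemma subst_svar i : subst (svar K i) = G i.
Proof.
apply: subst_eq => d; exists (mpoly.mpolyX K (mon1 i)); split=> [m md|].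
  by rewrite mpoly.mcoeffX eq_sym.
by rewrite mpoly.mmapX mpoly.mmap1U subrr; apply: order_ge_zero.
Qed.
End Substitution.

Section Units.
Variables (K : fieldType) (n : nat).
Implicit Types s w : series K n.

(** The inverse of 1 - w is the geometric series in one variable evaluated at w. *)
Lemma geometric_inverse w : order_ge 1 w -> exists v, (1 - w) * v = 1.
Proof.
move=> w1; pose G (_ : 'I_1) := w; have G1 i : order_ge 1 (G i) by [].
pose geo : series K 1 := Series (fun=> 1).
have geoE : (1 - svar K 0) * geo = 1.
  rewrite mulrBl mul1r; apply: seriesP => m.
  transitivity (1 - scoef (svar K 0 * geo) m) => //; rewrite scoef_svarM.
  transitivity ((m == mon0)%:R : K) => //.
  rewrite -mpoly.mdeg_eq0 mpoly.mdegE big_ord1.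
  by case: (m _) => [|k]; rewrite ?subr0 ?subrr.
exists (subst_hom G1 geo).
have -> : w = subst_hom G1 (svar K 0) by rewrite /= subst_svar.
by rewrite -(rmorph1 (subst_hom G1)) -rmorphB -rmorphM geoE.
Qed.

Lemma series_unit s : scoef s mon0 != 0 -> exists v, s * v = 1.
Proof.
set c := scoef s mon0 => c0.
have [|v v1] := @geometric_inverse (1 - c^-1 *: s).
  by apply/order_ge1P; rewrite /= eqxx mulVf // subrr.
exists (c^-1 *: v); rewrite -v1; apply: seriesP => m.
by rewrite opprB addrC subrK -scalerAr scalerAl.
Qed.
End Units.

(** * First order neighbourhoods *)

(** The difference of two homomorphisms is linear over the variables on which
they agree. *)
Lemma hom_agree (K : fieldType) n (R : comPzRingType)
    (phi1 phi2 : {rmorphism series K n -> R}) :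
  (forall c, phi1 (GRing.in_alg _ c) = phi2 (GRing.in_alg _ c)) ->
  (forall i, phi1 (svar K i) = phi2 (svar K i)) ->
  forall N s, exists (r : nat) (t : 'I_r -> series K n) (b : 'I_r -> R),
    (forall j, order_ge N (t j)) /\ phi1 s - phi2 s = \sum_j phi2 (t j) * b j.
Proof.
move=> phiC phiX N s.
apply: (@var_linear_divisible K n R phi2 (phi1 \- phi2)) => /= [c|i t].
  by rewrite phiC subrr.
by rewrite !rmorphM phiX mulrBr.
Qed.

(** Comorphisms out of a total space are defined on representatives: the total
space is only known as the image of a ring in which computations are possible. *)
Lemma factor_surj (K : fieldType) (E A V : calg K) (p : algHom E A) (u : algHom E V) :
  (forall a, exists x, p x = a) -> (forall x, p x = 0 -> u x = 0) ->
  exists w : algHom A V, forall x, w (p x) = u x.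
Proof.
move=> /choice[s sK] pu; pose w a := u (s a).
have wE x : w (p x) = u x.
  by apply/subr0_eq; rewrite /w -rmorphB; apply: pu; rewrite rmorphB sK subrr.
have wB : zmod_morphism w.
  by move=> a b; rewrite -[a]sK -[b]sK -rmorphB !wE rmorphB.
have wM : monoid_morphism w.
  split=> [|a b]; first by rewrite -(rmorph1 p) wE rmorph1.
  by rewrite -[a]sK -[b]sK -rmorphM !wE rmorphM.
pose wr := HB.pack_for {rmorphism A -> V} w
  (GRing.isZmodMorphism.Build _ _ w wB) (GRing.isMonoidMorphism.Build _ _ w wM).
have wc c : wr (calg_const A c) = calg_const V c.
  by rewrite -(algHom_const p) /= wE algHom_const.
by exists (AlgHom wc).
Qed.

(** The ring R[e_1, ..., e_d] / (e_1, ..., e_d)^2. *)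
Record ext (R : comNzRingType) (d : nat) := Ext { ext_c : R; ext_l : 'rV[R]_d }.

Section Ext.
Variables (R : comNzRingType) (d : nat).
Local Notation E := (ext R d).

HB.instance Definition _ := gen_eqMixin E.
HB.instance Definition _ := gen_choiceMixin E.

Definition ext_zero : E := Ext 0 0.
Definition ext_opp (u : E) : E := Ext (- ext_c u) (- ext_l u).
Definition ext_add (u v : E) : E := Ext (ext_c u + ext_c v) (ext_l u + ext_l v).
Definition ext_one : E := Ext 1 0.
Definition ext_mul (u v : E) : E :=
  Ext (ext_c u * ext_c v) (ext_c u *: ext_l v + ext_c v *: ext_l u).

Lemma ext_addA : associative ext_add.
Proof. by move=> u v w; congr Ext; apply: addrA. Qed.
Lemma ext_addC : commutative ext_add.
Proof. by move=> u v; congr Ext; apply: addrC. Qed.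
Lemma ext_add0 : left_id ext_zero ext_add.
Proof. by case=> a u; congr Ext; apply: add0r. Qed.
Lemma ext_addN : left_inverse ext_zero ext_opp ext_add.
Proof. by move=> u; congr Ext; apply: addNr. Qed.

HB.instance Definition _ := GRing.isZmodule.Build E ext_addA ext_addC ext_add0 ext_addN.

Lemma ext_mulA : associative ext_mul.
Proof.
move=> u v w; congr Ext => /=; first exact: mulrA.
by rewrite !scalerDr !scalerA -addrA; congr (_ + (_ + _)); rewrite mulrC.
Qed.
Lemma ext_mulC : commutative ext_mul.
Proof. by move=> u v; congr Ext; [exact: mulrC | exact: addrC]. Qed.
Lemma ext_mul1 : left_id ext_one ext_mul.
Proof. by case=> a u; congr Ext => /=; rewrite ?mul1r // scale1r scaler0 addr0. Qed.
Lemma ext_mulDl : left_distributive ext_mul +%R.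
Proof.
move=> u v w; congr Ext => /=; first exact: mulrDl.
by rewrite scalerDl scalerDr addrACA.
Qed.
Lemma ext_one_neq0 : ext_one != 0.
Proof. by apply/eqP => /(congr1 (@ext_c R d))/eqP; rewrite oner_eq0. Qed.

HB.instance Definition _ :=
  GRing.Zmodule_isComNzRing.Build E ext_mulA ext_mulC ext_mul1 ext_mulDl ext_one_neq0.

Lemma ext_eq (u v : E) : ext_c u = ext_c v ->
  (forall i, ext_l u 0 i = ext_l v 0 i) -> u = v.
Proof. by case: u v => [a u] [b v] /= -> uv; congr Ext; apply/rowP. Qed.

Definition ext_const (a : R) : E := Ext a 0.
Lemma ext_constB : zmod_morphism ext_const.
Proof. by move=> a b; congr Ext => /=; rewrite subr0. Qed.
Lemma ext_constM : monoid_morphism ext_const.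
Proof. by split=> // a b; congr Ext => /=; rewrite !scaler0 addr0. Qed.
HB.instance Definition _ := GRing.isZmodMorphism.Build R E ext_const ext_constB.
HB.instance Definition _ := GRing.isMonoidMorphism.Build R E ext_const ext_constM.

Lemma ext_cB : zmod_morphism (@ext_c R d). Proof. by []. Qed.
Lemma ext_cM : monoid_morphism (@ext_c R d). Proof. by []. Qed.
HB.instance Definition _ := GRing.isZmodMorphism.Build E R (@ext_c R d) ext_cB.
HB.instance Definition _ := GRing.isMonoidMorphism.Build E R (@ext_c R d) ext_cM.

Lemma ext_lB : zmod_morphism (@ext_l R d). Proof. by []. Qed.
HB.instance Definition _ := GRing.isZmodMorphism.Build E 'rV[R]_d (@ext_l R d) ext_lB.
End Ext.

Section FirstOrderAlgebras.
Variables (K : fieldType) (d : nat).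
Local Notation D := (fo_alg K d).

Definition fo_e (i : 'I_d) : D := FirstOrder 0 (delta_mx 0 i).

Lemma fo_linB : zmod_morphism (@fo_lin K d). Proof. by []. Qed.
HB.instance Definition _ :=
  GRing.isZmodMorphism.Build (first_order K d) 'rV[K]_d (@fo_lin K d) fo_linB.

Lemma fo_eM i j : fo_e i * fo_e j = 0.
Proof. by congr FirstOrder => /=; rewrite ?mulr0 // !scale0r addr0. Qed.

Lemma fo_decomp (u : D) : u = calg_const D (fo_const u) +
  \sum_i calg_const D (fo_lin u 0 i) * fo_e i.
Proof.
case: u => a u; set S := \sum_i _.
have Sc : fo_const S = 0.
  by rewrite /S raddf_sum /=; apply: big1 => i _; rewrite /= mulr0.
have Sl : fo_lin S = u.
  rewrite /S raddf_sum [RHS]row_sum_delta; apply: eq_bigr => i _ /=.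
  by rewrite scale0r addr0.
congr FirstOrder => /=; first by rewrite Sc addr0.
by rewrite Sl add0r.
Qed.

Variables (A : calg K) (th : algHom D A).

Lemma fo_homE u : th u = calg_const A (fo_const u) +
  \sum_i calg_const A (fo_lin u 0 i) * th (fo_e i).
Proof.
rewrite [in LHS](fo_decomp u) rmorphD algHom_const rmorph_sum; congr (_ + _).
by apply: eq_bigr => i _; rewrite rmorphM algHom_const.
Qed.

Lemma fo_homM i j : th (fo_e i) * th (fo_e j) = 0.
Proof. by rewrite -rmorphM fo_eM rmorph0. Qed.

(** The ideal of A generated by the e_i. *)
Definition small (a : A) := exists b, a = \sum_i th (fo_e i) * b i.

Lemma small0 : small 0.
Proof. by exists (fun=> 0); rewrite big1 // => i _; rewrite mulr0. Qed.
Lemma smallD a b : small a -> small b -> small (a + b).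
Proof.
move=> [a' ->] [b' ->]; exists (fun i => a' i + b' i).
by rewrite -big_split; apply: eq_bigr => i _; rewrite mulrDr.
Qed.
Lemma smallMl c a : small a -> small (c * a).
Proof.
move=> [b ->]; exists (fun i => c * b i).
by rewrite mulr_sumr; apply: eq_bigr => i _; rewrite mulrCA.
Qed.
Lemma smallN a : small a -> small (- a).
Proof. by rewrite -mulN1r; apply: smallMl. Qed.
Lemma small_e i a : small (th (fo_e i) * a).
Proof.
exists (fun j => if j == i then a else 0); rewrite (bigD1 i) //= eqxx big1 ?addr0 //.
by move=> j /negbTE ->; rewrite mulr0.
Qed.
Lemma small_sum b : small (\sum_i th (fo_e i) * b i). Proof. by exists b. Qed.
Lemma small_mul_e i a : small a -> th (fo_e i) * a = 0.
Proof.
by case=> b ->; rewrite mulr_sumr big1 // => j _; rewrite mulrA fo_homM mul0r.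
Qed.
Lemma small_eM i a b : small (a - b) -> th (fo_e i) * a = th (fo_e i) * b.
Proof. by move=> ab; apply/subr0_eq; rewrite -mulrBr small_mul_e. Qed.

Lemma fo_hom_small u : small (th u - calg_const A (fo_const u)).
Proof.
rewrite fo_homE addrC addKr; exists (fun i => calg_const A (fo_lin u 0 i)).
by apply: eq_bigr => i _; rewrite mulrC.
Qed.
End FirstOrderAlgebras.

Section ExtSeries.
Variables (K : fieldType) (n d : nat).
Local Notation O := (series K n).
Local Notation D := (fo_alg K d).

Definition ext_alg : calg K := CAlg (@ext_const O d \o GRing.in_alg O).

Lemma ext_const_alg c : ext_const d (calg_const (series_alg K n) c) = calg_const ext_alg c.
Proof. by []. Qed.
Definition ext_constH : algHom (series_alg K n) ext_alg :=
  @AlgHom _ (series_alg K n) ext_alg (@ext_const O d) ext_const_alg.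

Definition ext_base (u : D) : ext_alg :=
  Ext (GRing.in_alg O (fo_const u)) (map_mx (GRing.in_alg O) (fo_lin u)).
Lemma ext_baseB : zmod_morphism ext_base.
Proof. by move=> u v; congr Ext; [apply: rmorphB | apply: raddfB]. Qed.
Lemma ext_baseM : monoid_morphism ext_base.
Proof.
split=> [|u v]; first by congr Ext; [apply: rmorph1 | apply: raddf0].
congr Ext; first exact: rmorphM.
by rewrite /= raddfD /= !map_mxZ.
Qed.
HB.instance Definition _ :=
  GRing.isZmodMorphism.Build (first_order K d) (ext O d) ext_base ext_baseB.
HB.instance Definition _ :=
  GRing.isMonoidMorphism.Build (first_order K d) (ext O d) ext_base ext_baseM.
Lemma ext_base_const c : ext_base (calg_const D c) = calg_const ext_alg c.
Proof. by congr Ext; apply: raddf0. Qed.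
Definition ext_baseH : algHom D ext_alg := @AlgHom _ D ext_alg ext_base ext_base_const.

Lemma ext_base_eM i (x : O) : ext_base (fo_e K i) * ext_const d x =
  Ext 0 (x *: delta_mx 0 i).
Proof.
congr Ext => /=; first by rewrite scale0r mul0r.
rewrite scaler0 add0r; congr (_ *: _).
by apply/matrixP => a b; rewrite !mxE rmorph_nat.
Qed.

Lemma ext_decomp (u : ext O d) : u = ext_const d (ext_c u) +
  \sum_i ext_base (fo_e K i) * ext_const d (ext_l u 0 i).
Proof.
under eq_bigr => i _ do rewrite ext_base_eM.
set S := \sum_i _; have Sc : ext_c S = 0.
  by rewrite /S (raddf_sum (@ext_c O d)) big1.
have Sl : ext_l S = ext_l u by rewrite /S raddf_sum [RHS]row_sum_delta.
case: u @S Sc Sl => a u S Sc Sl; congr Ext => /=; first by rewrite Sc addr0.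
by rewrite Sl add0r.
Qed.

(** O[e] is the coproduct of O and D. *)
Section Pairing.
Variables (A : calg K) (phi : algHom (series_alg K n) A) (th : algHom D A).

Definition ext_pair (u : ext_alg) : A :=
  phi (ext_c u) + \sum_i th (fo_e K i) * phi (ext_l u 0 i).

Lemma ext_pairB : zmod_morphism ext_pair.
Proof.
move=> u v; rewrite /ext_pair rmorphB opprD addrACA; congr (_ + _).
by rewrite -sumrB; apply: eq_bigr => i _; rewrite !mxE rmorphB mulrBr.
Qed.

Lemma ext_pairM : monoid_morphism ext_pair.
Proof.
split=> [|u v]; rewrite /ext_pair.
  by rewrite rmorph1 big1 ?addr0 // => i _; rewrite mxE rmorph0 mulr0.
rewrite mulrDr !mulrDl -!addrA rmorphM; congr (_ + _).
rewrite [X in _ + (_ + X)](_ : _ = 0) ?addr0; last first.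
  rewrite mulr_sumr big1 // => i _; rewrite mulrCA small_mul_e //.
  by rewrite mulrC; apply/smallMl/small_sum.
rewrite addrC mulr_suml mulr_sumr -big_split; apply: eq_bigr => i _.
rewrite !mxE rmorphD !rmorphM mulrDr /=; congr (_ + _); first by rewrite mulrCA.
by rewrite -mulrA [phi (ext_c v) * _]mulrC.
Qed.

HB.instance Definition _ := GRing.isZmodMorphism.Build ext_alg A ext_pair ext_pairB.
HB.instance Definition _ := GRing.isMonoidMorphism.Build ext_alg A ext_pair ext_pairM.

Lemma ext_pair_const c : ext_pair (calg_const ext_alg c) = calg_const A c.
Proof.
rewrite /ext_pair -(algHom_const phi) big1 ?addr0 // => i _.
by rewrite mxE rmorph0 mulr0.
Qed.
Definition ext_pairH : algHom ext_alg A := AlgHom (algHom_fun := ext_pair) ext_pair_const.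

Lemma ext_pair_c x : ext_pair (ext_const d x) = phi x.
Proof. by rewrite /ext_pair big1 ?addr0 // => i _; rewrite mxE rmorph0 mulr0. Qed.

Lemma ext_pair_e i : ext_pair (ext_base (fo_e K i)) = th (fo_e K i).
Proof.
rewrite /ext_pair /= scale0r rmorph0 add0r (bigD1 i) //= big1 ?addr0.
  by rewrite !mxE !eqxx mulr1n !rmorph1 mulr1.
by move=> j /negbTE ji; rewrite !mxE ji andbF mulr0n !rmorph0 mulr0.
Qed.

Lemma ext_pair_base u : ext_pair (ext_base u) = th u.
Proof.
rewrite -[LHS]/((ext_pairH : {rmorphism _ -> _}) (ext_baseH u)).
rewrite fo_homE [in RHS]fo_homE rmorphD rmorph_sum /= -ext_pair_const; congr (_ + _).
apply: eq_bigr => i _; rewrite -ext_pair_const -ext_pair_e.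
by rewrite -[LHS]/((ext_pairH : {rmorphism _ -> _}) _) rmorphM.
Qed.
End Pairing.

(** Evaluating a series in n + d variables at e, to first order in e: the
linear part in e consists of the partial derivatives with respect to the last d
variables. *)
Section Jet.
Variable rho : algHom (series_alg K (n + d)) (series_alg K n).

Definition ext_jet (s : series K (n + d)) : ext_alg :=
  Ext (rho s) (\row_j rho (sderiv (rshift n j) s)).

Lemma ext_jetB : zmod_morphism ext_jet.
Proof.
move=> s t; congr Ext; first exact: rmorphB.
apply/rowP => j; rewrite !mxE -rmorphB; congr (rho _).
by apply: seriesP => m /=; rewrite mulrBr.
Qed.
Lemma ext_jetM : monoid_morphism ext_jet.
Proof.
split=> [|s t]; congr Ext; first exact: rmorph1.
- apply/rowP => j; rewrite !mxE -(rmorph1 (GRing.in_alg (series K (n + d)))).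
  by rewrite sderivC rmorph0.
- exact: rmorphM.
apply/rowP => j; rewrite mxE sderivM (rmorphD rho) !(rmorphM rho) !mxE.
by rewrite addrC [_ * rho t]mulrC.
Qed.
HB.instance Definition _ := GRing.isZmodMorphism.Build _ (ext O d) ext_jet ext_jetB.
HB.instance Definition _ := GRing.isMonoidMorphism.Build _ (ext O d) ext_jet ext_jetM.

Lemma ext_jet_const c :
  ext_jet (calg_const (series_alg K (n + d)) c) = calg_const ext_alg c.
Proof.
congr Ext; first exact: (algHom_const rho).
by apply/rowP => j; rewrite !mxE sderivC rmorph0.
Qed.
Definition ext_jetH : algHom (series_alg K (n + d)) ext_alg :=
  @AlgHom _ (series_alg K (n + d)) ext_alg ext_jet ext_jet_const.

Lemma ext_jet_surj u : (forall i, rho (svar K (lshift d i)) = svar K i) ->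
  (forall j, rho (svar K (rshift n j)) = 0) -> exists s, ext_jetH s = u.
Proof.
move=> rhol rhor.
pose iota := subst_hom (fun i => order_ge_svar K (lshift d i)) :
  algHom (series_alg K n) (series_alg K (n + d)).
have iotaX i : iota (svar K i) = svar K (lshift d i).
  by apply: subst_svar => j; apply: order_ge_svar.
have iotaE x : ext_jet (iota x) = ext_const d x.
  apply/subr0_eq.
  pose phi1 := ext_jetH \o iota : {rmorphism O -> ext O d}.
  have C c : phi1 (GRing.in_alg _ c) = ext_const d (GRing.in_alg _ c).
    rewrite -[LHS]/(ext_jetH (iota (calg_const (series_alg K n) c))) (algHom_const iota).
    exact: (algHom_const ext_jetH).
  have X i : phi1 (svar K i) = ext_const d (svar K i).
    rewrite -[LHS]/(ext_jet (iota (svar K i))) iotaX.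
    apply: ext_eq => [|j] /=; first exact: rhol.
    by rewrite !mxE sderiv_svar eq_rlshift rmorph0.
  set u0 := _ - _.
  have step N : exists (r : nat) (t : 'I_r -> O) (b : 'I_r -> ext O d),
      (forall j, order_ge N (t j)) /\ u0 = \sum_j ext_const d (t j) * b j.
    exact: hom_agree C X N x.
  apply: ext_eq => [|i]; last rewrite [RHS]mxE; apply: order_ge_eq0 => N;
    have [r [t [b [tN ->]]]] := step N.
    by rewrite (raddf_sum (@ext_c O d)); apply: order_ge_sum => j;
      rewrite /= mulrC; apply: order_geMl.
  rewrite raddf_sum summxE; apply: order_ge_sum => j.
  by rewrite /= scaler0 addr0 mxE mulrC; apply: order_geMl.
exists (iota (ext_c u) + \sum_i svar K (rshift n i) * iota (ext_l u 0 i)).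
have jetX i : ext_jetH (svar K (rshift n i)) = ext_base (fo_e K i).
  apply: ext_eq => [|j] /=; first by rewrite rhor scale0r.
  by rewrite !mxE sderiv_svar eq_rshift eqxx !rmorph_nat.
rewrite [RHS]ext_decomp -!iotaE rmorphD rmorph_sum; congr (_ + _).
by apply: eq_bigr => i _; rewrite rmorphM jetX -iotaE.
Qed.
End Jet.

Lemma ext_alg_series : exists p : algHom (series_alg K (n + d)) ext_alg,
  forall u, exists s, p s = u.
Proof.
pose v (i : 'I_(n + d)) : O := if split i is inl j then svar K j else 0.
have v1 i : order_ge 1 (v i).
  by rewrite /v; case: split => j; [apply: order_ge_svar | apply: order_ge_zero].
exists (ext_jetH (subst_hom v1)) => u; apply: ext_jet_surj => i.
  rewrite /= subst_svar // /v.
  by rewrite -[lshift d i]/(unsplit (inl i)) unsplitK.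
by rewrite /= subst_svar // /v -[rshift n i]/(unsplit (inr i)) unsplitK.
Qed.

Section QuotientGerm.
Variable I : ideal (ext O d).

Definition ext_quo : calg K := CAlg (cls I \o calg_const ext_alg).
Lemma ext_cls_const c : cls I (calg_const ext_alg c) = calg_const ext_quo c.
Proof. by []. Qed.
Definition ext_cls : algHom ext_alg ext_quo :=
  @AlgHom _ ext_alg ext_quo (cls I) ext_cls_const.

Definition compH (A B C : calg K) (v : algHom B C) (u : algHom A B) : algHom A C :=
  @AlgHom _ A C (algHom_fun v \o algHom_fun u)
    (fun c => etrans (congr1 v (algHom_const u c)) (algHom_const v c)).

Lemma ext_quoP : exists N (p : algHom (series_alg K N) ext_quo),
  forall a, exists s, p s = a.
Proof.
have [p p_surj] := ext_alg_series; exists (n + d)%N, (compH ext_cls p) => a.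
by have [x ->] := cls_surj a; have [s <-] := p_surj x; exists s.
Qed.
Definition ext_germ : germ K := Germ ext_quoP.
End QuotientGerm.
End ExtSeries.

(** * Flatness over the first order base *)

(** A maximal subspace that meets W trivially is a complement of W. The scalars
act through a ring of which the space is a module, so that modules over
K-algebras are covered. *)
Lemma subspace_projection (K : fieldType) (D : pzRingType) (c : {rmorphism K -> D})
    (V : lmodType D) (W : set V) :
  W 0 -> (forall u v, W u -> W v -> W (u + v)) -> (forall k u, W u -> W (c k *: u)) ->
  exists pi : V -> V, [/\ {morph pi : u v / u + v},
    forall k v, pi (c k *: v) = c k *: pi v,
    forall v, W (pi v) & forall v, W v -> pi v = v].
Proof.
move=> W0 WD WZ.
have WN u : W u -> W (- u) by move=> /(WZ (-1)); rewrite rmorphN rmorph1 scaleN1r.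
pose P (U : set V) := [/\ forall u v, U u -> U v -> U (u + v),
  forall k u, U u -> U (c k *: u) & forall u, U u -> W u -> u = 0].
have chain (F : set (set V)) : F `<=` P -> total_on F subset -> P (\bigcup_(X in F) X).
  move=> FP Ftot; split=> [u v [X FX Xu] [Y FY Yv]|k u [X FX Xu]|u [X FX Xu]].
  - have [XY|YX] := Ftot _ _ FX FY.
      by exists Y => //; have [YD _ _] := FP _ FY; apply: YD => //; apply: XY.
    by exists X => //; have [XD _ _] := FP _ FX; apply: XD => //; apply: YX.
  - by exists X => //; have [_ XZ _] := FP _ FX; apply: XZ.
  - by have [_ _] := FP _ FX; apply.
have [U [[UD UZ UW] Umax]] := Zorn_bigcup chain.
have U0 : U 0.
  apply: contrapT => U0; apply: (Umax [set 0]).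
    by split=> [u Uu|/(_ 0 erefl)//]; case: U0; rewrite -(scale0r u) -(rmorph0 c); apply: UZ.
  split=> [u v -> ->|k u ->|u -> //]; last exact: scaler0.
  exact: addr0.
have UN u : U u -> U (- u) by move=> /(UZ (-1)); rewrite rmorphN rmorph1 scaleN1r.
have dec v : exists w, W w /\ U (v - w).
  apply: contrapT => vN; apply: (Umax [set x | exists u k, U u /\ x = u + c k *: v]).
    split=> [u Uu|sub]; first by exists u, 0; rewrite rmorph0 scale0r addr0.
    apply: vN; exists 0; rewrite subr0; split=> //; apply: sub.
    by exists 0, 1; rewrite rmorph1 scale1r add0r.
  split=> [_ _ [u [k [Uu ->]]] [u' [k' [Uu' ->]]]|k _ [u [k' [Uu ->]]]|_ [u [k [Uu ->]]] Wx].
  - exists (u + u'), (k + k'); split; first exact: UD.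
    by rewrite rmorphD scalerDl addrACA.
  - exists (c k *: u), (k * k'); split; first exact: UZ.
    by rewrite scalerDr scalerA rmorphM.
  have [k0|k0] := eqVneq k 0.
    by move: Wx; rewrite k0 rmorph0 scale0r addr0; apply: UW.
  case: vN; exists (c k^-1 *: (u + c k *: v)); split; first exact: WZ.
  rewrite scalerDr scalerA -rmorphM mulVf // rmorph1 scale1r opprD addrCA subrr addr0.
  exact/UN/UZ.
have uniq v w w' : W w -> U (v - w) -> W w' -> U (v - w') -> w = w'.
  move=> Ww Uw Ww' Uw'; apply/subr0_eq/UW; last exact/WD/WN.
  rewrite (_ : w - w' = (v - w') - (v - w)); first exact/UD/UN.
  by rewrite opprB [RHS]addrC addrA subrK.
have /choice[pi piP] := dec; exists pi; split=> [u v|k v|v|v Wv].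
- apply: (uniq (u + v)); try exact: (piP _).1; try exact: (piP _).2.
    by apply: WD; apply: (piP _).1.
  by rewrite opprD addrACA; apply: UD; apply: (piP _).2.
- apply: (uniq (c k *: v)); try exact: (piP _).1; try exact: (piP _).2.
    exact/WZ/(piP _).1.
  by rewrite -scalerBr; apply/UZ/(piP _).2.
- exact: (piP v).1.
- by apply: (uniq v); rewrite ?subrr //; [exact: (piP _).1|exact: (piP _).2].
Qed.

Section Flatness.
Variables (K : fieldType) (d : nat).
Local Notation D := (fo_alg K d).
Variables (A : calg K) (th : algHom D A).

Lemma morphD0 (U V : zmodType) (b : U -> V) : {morph b : x y / x + y} -> b 0 = 0.
Proof. by move=> bD; apply: (addIr (b 0)); rewrite -bD !add0r. Qed.

Lemma morphD_sum (U V : zmodType) (b : U -> V) (I : Type) (r : seq I) (F : I -> U) :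
  {morph b : x y / x + y} -> b (\sum_(i <- r) F i) = \sum_(i <- r) b (F i).
Proof.
move=> bD; elim: r => [|i r IH]; first by rewrite !big_nil morphD0.
by rewrite !big_cons bD IH.
Qed.

Lemma morphDN (U V : zmodType) (b : U -> V) x : {morph b : x y / x + y} -> b (- x) = - b x.
Proof. by move=> bD; apply/eqP; rewrite -addr_eq0 -bD addNr (morphD0 bD). Qed.

(** Freeness of A over D: a complement of the ideal (e) as a K-vector space
generates A freely. *)
Lemma free_coordinates :
  (forall a : 'I_d -> A, \sum_i th (fo_e K i) * a i = 0 -> forall i, small th (a i)) ->
  exists (sg : A -> A) (tau : 'I_d -> A -> A),
    [/\ {morph sg : a b / a + b} /\ (forall i, {morph tau i : a b / a + b}),
        forall k a, sg (calg_const A k * a) = calg_const A k * sg a /\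
                    forall i, tau i (calg_const A k * a) = calg_const A k * tau i a,
        forall j a, sg (th (fo_e K j) * a) = 0 /\
                    forall i, tau i (th (fo_e K j) * a) = if i == j then sg a else 0 &
        forall a, a = sg a + \sum_i th (fo_e K i) * tau i a].
Proof.
move=> syz.
have [|||pi [piD piZ piS pi_id]] := @subspace_projection K A (calg_const A) A^o (small th).
- exact: small0.
- exact: smallD.
- by move=> k u; apply: smallMl.
have /choice[b bE] := piS.
pose sg (a : A) : A := a - pi a.
have sgD : {morph sg : x y / x + y}.
  by move=> x y; rewrite /sg piD opprD addrACA.
have sgZ k a : sg (calg_const A k * a) = calg_const A k * sg a.
  by rewrite /sg (piZ k a) mulrBr.
have sg_small a : small th a -> sg a = 0.
  by move=> sa; rewrite /sg pi_id // subrr.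
have sg_uniq (s t : 'I_d -> A) : \sum_i th (fo_e K i) * s i = \sum_i th (fo_e K i) * t i ->
    forall i, sg (s i) = sg (t i).
  move=> st i; apply/subr0_eq; rewrite -(morphDN _ sgD) -sgD.
  apply: sg_small; apply: (syz (fun i => s i - t i)).
  under eq_bigr => j _ do rewrite mulrBr.
  by rewrite sumrB st subrr.
have e_sg i a : th (fo_e K i) * sg a = th (fo_e K i) * a.
  by apply: small_eM; rewrite /sg addrAC subrr add0r; apply: smallN.
pose tau i a := sg (b a i); exists sg, tau.
have tau_uniq a (s : 'I_d -> A) : pi a = \sum_i th (fo_e K i) * s i ->
    forall i, tau i a = sg (s i).
  by move=> E; apply: sg_uniq; rewrite -bE.
split.
- split=> [//|i x y]; rewrite -sgD; apply: (tau_uniq _ (fun i => b x i + b y i)).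
  by rewrite piD bE (bE y) -big_split; apply: eq_bigr => j _; rewrite mulrDr.
- move=> k a; split=> [//|i]; rewrite -sgZ.
  apply: (tau_uniq _ (fun i => calg_const A k * b a i)).
  by rewrite (piZ k a) bE [LHS]mulr_sumr; apply: eq_bigr => j _; rewrite mulrCA.
- move=> j a; have sea := small_e th j a; split=> [|i]; first exact: sg_small.
  rewrite (tau_uniq _ (fun i => if i == j then a else 0)).
    by case: eqP => // _; apply: morphD0.
  rewrite pi_id // (bigD1 j) //= eqxx big1 ?addr0 // => l /negbTE ->.
  by rewrite mulr0.
- move=> a; rewrite -[in LHS](subrK (pi a) a) -/(sg a) bE; congr (_ + _).
  by apply: eq_bigr => i _; rewrite e_sg.
Qed.

Lemma fo_action_ind (P : D -> Prop) :
  (forall k, P (calg_const D k)) -> (forall i, P (fo_e K i)) ->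
  (forall u v, P u -> P v -> P (u + v)) -> (forall u v, P u -> P v -> P (u * v)) ->
  forall u, P u.
Proof.
move=> Pk Pe PD PM u; rewrite (fo_decomp u); apply: (PD) => //.
elim/big_ind: _ => [|x y|i _]; [|exact: PD|exact: PM].
by rewrite -(rmorph0 (calg_const D)).
Qed.

(** For modules N inside N', a K-linear retraction of N' onto N and free coordinates
on A extend balanced maps from N x A to N' x A: tensors that vanish in the
larger module vanish already in the smaller one. *)
Lemma flat_of_syzygies :
  (forall a : 'I_d -> A, \sum_i th (fo_e K i) * a i = 0 -> forall i, small th (a i)) ->
  flat_rmorphism th.
Proof.
move=> /free_coordinates[sg [tau [[sgD tauD] st_k st_e st_dec]]] N N' j j_inj s Hs Q beta.
move=> [betaDr betaDl betaZ].
have [|||pi [piD piZ piS pi_id]] := @subspace_projection K D (calg_const D) N' (range j).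
- by exists 0 => //; rewrite raddf0.
- by move=> _ _ [x _ <-] [y _ <-]; exists (x + y) => //; rewrite raddfD.
- by move=> k _ [x _ <-]; exists (calg_const D k *: x) => //; rewrite linearZ.
have /choice[r rE] : forall n', exists n, j n = pi n'.
  by move=> n'; have [n _ <-] := piS n'; exists n.
have rD : {morph r : x y / x + y}.
  by move=> x y; apply: j_inj; rewrite raddfD /= !rE piD.
have rZ k x : r (calg_const D k *: x) = calg_const D k *: r x.
  by apply: j_inj; rewrite linearZ /= !rE piZ.
have rj x : r (j x) = x by apply: j_inj; rewrite rE pi_id //; exists x.
pose beta' n' a := beta (r n') (sg a) + \sum_i beta (r (fo_e K i *: n')) (tau i a).
have beta'E n a : beta' (j n) a = beta n a.
  rewrite /beta' rj [in RHS](st_dec a) betaDr (morphD_sum _ _ (betaDr n)); congr (_ + _).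
  by apply: eq_bigr => i _; rewrite -betaZ -linearZ rj.
have beta'Dr n' : {morph beta' n' : a b / a + b}.
  move=> a b; rewrite /beta' sgD betaDr addrACA -big_split; congr (_ + _).
  by apply: eq_bigr => i _; rewrite tauD betaDr.
have beta'Dl a : {morph beta'^~ a : x y / x + y}.
  move=> x y; rewrite /beta' rD betaDl addrACA -big_split; congr (_ + _).
  by apply: eq_bigr => i _; rewrite scalerDr rD betaDl.
have beta'Z : forall u x a, beta' (u *: x) a = beta' x (th u * a).
  elim/fo_action_ind => [k x a|i x a|u v IHu IHv x a|u v IHu IHv x a].
  - rewrite algHom_const /beta' (st_k k a).1 rZ betaZ algHom_const; congr (_ + _).
    apply: eq_bigr => i _; rewrite (st_k k a).2 -[in RHS](algHom_const th) -betaZ.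
    by rewrite -rZ !scalerA mulrC.
  - rewrite /beta' (st_e i a).1 (morphD0 (betaDr _)) add0r [in RHS](bigD1 i) //= (st_e i a).2 eqxx.
    congr (_ + _); rewrite !big1 // => l.
      by move=> /negbTE li; rewrite (st_e i a).2 li (morphD0 (betaDr _)).
    by rewrite scalerA fo_eM scale0r (morphD0 rD) (morphD0 (betaDl _)).
  - by rewrite scalerDl rmorphD mulrDl beta'Dl beta'Dr IHu IHv.
  - by rewrite -scalerA IHu IHv rmorphM mulrA [th v * _]mulrC.
have := Hs Q beta' (And3 beta'Dr beta'Dl beta'Z).
by rewrite big_map => E; rewrite -[RHS]E; apply: eq_bigr => x _; rewrite beta'E.
Qed.

(** Conversely, flatness over D is tested on the inclusion of the ideal (e) in D. *)
Definition fo_ideal := 'rV[K]_d.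
HB.instance Definition _ := GRing.Zmodule.on fo_ideal.

Definition fo_ideal_scale (u : first_order K d) (v : fo_ideal) : fo_ideal :=
  fo_const u *: (v : 'rV[K]_d).
Lemma fo_ideal_scaleA u v x :
  fo_ideal_scale u (fo_ideal_scale v x) = fo_ideal_scale (u * v) x.
Proof. exact: scalerA. Qed.
Lemma fo_ideal_scale1 : left_id 1 fo_ideal_scale.
Proof. by move=> x; apply: scale1r. Qed.
Lemma fo_ideal_scaleDr : right_distributive fo_ideal_scale +%R.
Proof. by move=> u x y; apply: scalerDr. Qed.
Lemma fo_ideal_scaleDl x : {morph fo_ideal_scale^~ x : u v / u + v}.
Proof. by move=> u v; apply: scalerDl. Qed.
HB.instance Definition _ := GRing.Zmodule_isLmodule.Build (first_order K d) fo_ideal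
  fo_ideal_scaleA fo_ideal_scale1 fo_ideal_scaleDr fo_ideal_scaleDl.

Definition fo_ideal_incl (v : fo_ideal) : (first_order K d)^o := FirstOrder 0 v.
Lemma fo_ideal_inclB : zmod_morphism fo_ideal_incl.
Proof. by move=> u v; congr FirstOrder; rewrite subr0. Qed.
Lemma fo_ideal_inclZ : scalable fo_ideal_incl.
Proof. by move=> u v; congr FirstOrder; rewrite /= ?mulr0 // scale0r addr0. Qed.
HB.instance Definition _ :=
  GRing.isZmodMorphism.Build fo_ideal (first_order K d)^o fo_ideal_incl fo_ideal_inclB.
HB.instance Definition _ := GRing.isScalable.Build (first_order K d) fo_ideal
  (first_order K d)^o *:%R fo_ideal_incl fo_ideal_inclZ.

Lemma syzygies_of_flat (B : calg K) (chi : algHom A B) : flat_rmorphism th ->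
  (forall i, chi (th (fo_e K i)) = 0) ->
  forall a : 'I_d -> A, \sum_i th (fo_e K i) * a i = 0 -> forall i, chi (a i) = 0.
Proof.
move=> th_flat chi_e a a0 i.
have chi_small x : small th x -> chi x = 0.
  by case=> b ->; rewrite rmorph_sum big1 // => j _; rewrite rmorphM chi_e mul0r.
have incl_inj : injective fo_ideal_incl by move=> u v [].
pose s := [seq (delta_mx 0 j : fo_ideal, a j) | j <- index_enum 'I_d].
have s0 : tensor_eq0 th [seq (fo_ideal_incl x.1, x.2) | x <- s].
  move=> Q beta [betaDr betaDl betaZ]; rewrite -map_comp big_map /=.
  transitivity (beta 1 (\sum_j th (fo_e K j) * a j)); last by rewrite a0 (morphD0 (betaDr _)).
  rewrite (morphD_sum _ _ (betaDr _)); apply: eq_bigr => j _; rewrite -betaZ.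
  congr (beta _ _); rewrite -[RHS]/(fo_e K j * 1 : first_order K d) mulr1.
  by [].
pose beta (v : fo_ideal) x := chi (calg_const A (v 0 i) * x).
have betaP : balanced th beta.
  split=> [v x y|x v w|u v x]; rewrite /beta.
  - by rewrite mulrDr rmorphD.
  - by rewrite mxE rmorphD mulrDl rmorphD.
  rewrite -{1}[u *: v]/(fo_const u *: (v : 'rV[K]_d)) mxE (rmorphM (calg_const A)) -mulrA mulrCA.
  apply/subr0_eq; rewrite -rmorphB -mulrBr -mulrBl; apply: chi_small; apply: smallMl.
  by rewrite mulrC; apply: smallMl; rewrite -opprB; apply/smallN/fo_hom_small.
have := th_flat _ _ (fo_ideal_incl : {linear fo_ideal -> (first_order K d)^o}) incl_inj s s0
  _ beta betaP.
rewrite big_map (bigD1 i) //= big1 ?addr0 => [|j /negbTE ji].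
  by rewrite /beta mxE !eqxx rmorph1 mul1r.
by rewrite /beta mxE eq_sym ji andbF rmorph0 mul0r rmorph0.
Qed.
End Flatness.

(** * First order deformations and their equations *)

Section FirstOrderDeformations.
Variables (K : fieldType) (d : nat).
Local Notation T := (fo_base K d).

Definition embH (S : germ K) (X : deformation S T) : algHom (tot X) S := emb X.
Definition projH (S : germ K) (X : deformation S T) : algHom (fo_alg K d) (tot X) := proj X.

Lemma embH_projH (S : germ K) (X : deformation S T) u :
  embH X (projH X u) = calg_const S (fo_const u).
Proof. exact: (def_cartesian X).1. Qed.

Lemma embH_projH_e (S : germ K) (X : deformation S T) i :
  embH X (projH X (fo_e K i)) = 0.
Proof. by rewrite embH_projH rmorph0. Qed.

Lemma embH_surj (S : germ K) (X : deformation S T) s : exists a, embH X a = s.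
Proof. exact: emb_embedding. Qed.

(** The special fibre is cut out by e: the quotient of the total space by (e)
is a germ over the base point, so that it maps to the fibre product. *)
Lemma embH_small (S : germ K) (X : deformation S T) a :
  embH X a = 0 <-> small (projH X) a.
Proof.
split=> [a0|[b ->]]; last first.
  by rewrite rmorph_sum big1 // => i _; rewrite rmorphM embH_projH_e mul0r.
have [N [p p_surj]] := galgP (tot X).
pose J : set (series K N) := [set s | small (projH X) (p s)].
have J0 : J 0 by rewrite /J /= rmorph0; apply: small0.
have JD s t : J s -> J t -> J (s + t) by rewrite /J /= rmorphD; apply: smallD.
have JM s t : J t -> J (s * t) by rewrite /J /= rmorphM; apply: smallMl.
pose I := Ideal J0 JD JM.
have IE s : cls I s = 0 <-> small (projH X) (p s).
  by rewrite -[0](rmorph0 (cls I)) clsP subr0.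
pose clsH := @AlgHom _ (series_alg K N) (quo_alg I) (cls I) (fun=> erefl).
have [s|w wE] := factor_surj (u := clsH) p_surj.
  by move=> s0; apply/IE; rewrite s0; apply: small0.
have w_small b : small (projH X) b -> w b = 0.
  by have [s <-] := p_surj b => /IE; rewrite wE.
have [|v [vE _ _]] := (def_cartesian X).2 (locus I) w (to_pt _).
  move=> u; apply/subr0_eq; rewrite -[LHS]/(w (projH X u) - calg_const _ (fo_const u)).
  by rewrite -(algHom_const w) -rmorphB; apply/w_small/fo_hom_small.
have wa0 : w a = 0.
  rewrite -[LHS]/((w : mor (locus I) (tot X)) a) -vE.
  by rewrite -[LHS]/(algHom_fun v (embH X a)) a0 rmorph0.
by have [s sa] := p_surj a; rewrite -sa; apply/IE; rewrite -wE sa.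
Qed.

Lemma projH_syzygies (S : germ K) (X : deformation S T) (a : 'I_d -> tot X) :
  \sum_i projH X (fo_e K i) * a i = 0 -> forall i, embH X (a i) = 0.
Proof.
apply: syzygies_of_flat; last exact: embH_projH_e.
exact: (@proj_flat _ _ _ X).
Qed.
End FirstOrderDeformations.

Section Equations.
Variables (K : fieldType) (n : nat) (f : series K n) (k d : nat).
Local Notation O := (series K n).
Local Notation Oalg := (series_alg K n).
Local Notation D := (fo_alg K d).
Local Notation T := (fo_base K d).
Local Notation If := (gen_ideal [set f]).
Local Notation I := (fat_ideal f k).
Local Notation J := (tjurina_ideal f k).
Local Notation pointed := (pointed_def (fat_point_mor f k) T).
Implicit Types (g : 'rV[O]_d).

Lemma cls0P (A : comNzRingType) (L : ideal A) x : cls L x = 0 <-> ideal_set L x.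
Proof. by rewrite -[0](rmorph0 (cls L)) clsP subr0. Qed.

Definition clsH (L : ideal O) : algHom Oalg (locus L) :=
  @AlgHom _ Oalg (quo_alg L) (cls L) (fun=> erefl).

Lemma clsH0P (L : ideal O) x : clsH L x = 0 <-> ideal_set L x.
Proof. exact: cls0P. Qed.

Lemma clsH_surj (L : ideal O) (y : locus L) : exists x, y = clsH L x.
Proof. exact: cls_surj. Qed.

Definition incH (X : pointed) : algHom (tot (pd_X X)) (tot (pd_P X)) := pd_inc X.
Definition trivH (X : pointed) : algHom (fat_point f k) (tot (pd_P X)) := pd_triv X.

Lemma incH_surj (X : pointed) b : exists a, incH X a = b.
Proof. exact: pd_inc_embedding. Qed.

Lemma incH_projH (X : pointed) u : incH X (projH (pd_X X) u) = projH (pd_P X) u.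
Proof. exact: pd_inc_proj. Qed.

Lemma embH_incH (X : pointed) a : embH (pd_P X) (incH X a) =
  sub_locus_fun I (embH (pd_X X) a).
Proof. exact: (pd_cartesian X).1. Qed.

Lemma embH_trivH (X : pointed) y : embH (pd_P X) (trivH X y) = y.
Proof. exact: (pd_trivP X).2. Qed.

(** A V-valued point, over the first order base, of the hypersurface
f + e_1 g_1 + ... + e_d g_d = 0; psi gives the values of its coordinates. *)
Definition solves (V : calg K) (psi : algHom Oalg V) (th : algHom D V) g :=
  psi f + \sum_i th (fo_e K i) * psi (g 0 i) = 0.

(** Coordinates on the total space of a pointed deformation which restrict to
the standard coordinates of the hypersurface and, through the trivialization,
to the constant coordinates of the fat point, and in which the total space has
the equation f + e_1 g_1 + ... + e_d g_d = 0. *)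
Definition presents (X : pointed) g (phi : algHom Oalg (tot (pd_X X))) :=
  [/\ forall x, embH (pd_X X) (phi x) = clsH If x,
      forall x, incH X (phi x) = trivH X (clsH I x) &
      solves phi (projH (pd_X X)) g].

Definition has_equation (X : pointed) g := exists phi, @presents X g phi.

Lemma fat_idealP x : ideal_set I x <-> exists a b, x = a * f + b /\ order_ge k b.
Proof.
split=> [[r [a [s [sS ->]]]]|[a [b [-> /pow_maxi_order kb]]]].
  elim/big_ind: _ => [|_ _ [a1 [b1 [-> kb1]]] [a2 [b2 [-> kb2]]]|i _].
  - by exists 0, 0; rewrite mul0r addr0; split=> //; apply: order_ge_zero.
  - exists (a1 + a2), (b1 + b2); rewrite mulrDl addrACA; split=> //.
    exact: order_geD.
  case: (sS i) => [->|/pow_maxi_order ks].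
    by exists (a i), 0; rewrite addr0; split=> //; apply: order_ge_zero.
  by exists 0, (a i * s i); rewrite mul0r add0r; split=> //; apply: order_geMl.
apply: idealD; first by apply/idealM/sub_gen_ideal; left.
by apply: sub_gen_ideal; right.
Qed.

Lemma fat_ideal_f : ideal_set I f.
Proof. by apply: sub_gen_ideal; left. Qed.

Lemma tjurina_ideal_f : ideal_set J f.
Proof. by apply: sub_gen_ideal; left. Qed.

Lemma tjurina_ideal_principal x : ideal_set If x -> ideal_set J x.
Proof. by move=> /principalP[a ->]; apply/idealM/tjurina_ideal_f. Qed.

(** The Tjurina ideal consists, modulo f, of the derivatives of f along the
vector fields with coefficients in the ideal of the fat point. *)
Lemma tjurina_idealP x : ideal_set J x <-> exists c : 'I_n -> O,
  (forall j, ideal_set I (c j)) /\ ideal_set If (x - \sum_j c j * sderiv j f).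
Proof.
split=> [[r [a [s [sS ->]]]]|[c [cI xc]]]; last first.
  rewrite -[x](subrK (\sum_j c j * sderiv j f)); apply: idealD.
    exact: tjurina_ideal_principal.
  elim/big_ind: _ => [||j _]; [exact: ideal0 | by move=> ? ?; apply: idealD |].
  have [a [b [-> /pow_maxi_order kb]]] := (fat_idealP _).1 (cI j).
  rewrite mulrDl; apply: idealD.
    by rewrite mulrAC; apply/idealM/tjurina_ideal_f.
  apply: sub_gen_ideal; right; apply: sub_gen_ideal; exists b => //.
  by exists (sderiv j f) => //; apply: sub_gen_ideal; exists j.
pose P y := exists c : 'I_n -> O,
  (forall j, ideal_set I (c j)) /\ ideal_set If (y - \sum_j c j * sderiv j f).
have P0 : P 0.
  exists (fun=> 0); split=> [j|]; first exact: ideal0.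
  by rewrite big1 ?subrr => [|j _]; [apply: ideal0 | rewrite mul0r].
have PD y z : P y -> P z -> P (y + z).
  move=> [c [cI yc]] [c' [c'I zc']]; exists (fun j => c j + c' j).
  split=> [j|]; first exact: idealD.
  under eq_bigr => j _ do rewrite mulrDl.
  by rewrite big_split opprD addrACA; apply: idealD.
have PM y z : P z -> P (y * z).
  move=> [c [cI zc]]; exists (fun j => y * c j); split=> [j|]; first exact: idealM.
  under eq_bigr => j _ do rewrite -mulrA.
  by rewrite -mulr_sumr -mulrBr; apply: idealM.
elim/big_ind: _ => // i _; apply: (PM); case: (sS i) => [->|].
  exists (fun=> 0); split=> [j|]; first exact: ideal0.
  by rewrite big1 ?subr0 => [|j _]; [apply: sub_gen_ideal | rewrite mul0r].
move=> [q [b [t [tS ->]]]]; elim/big_ind: _ => // l _; apply: (PM).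
have [y ky [_ [p [e [w [wS ->]]]] <-]] := tS l; rewrite mulr_sumr.
elim/big_ind: _ => // m _; rewrite mulrCA; apply: (PM); have [j _ <-] := wS m.
exists (fun j' => if j' == j then y else 0); split=> [j'|].
  case: eqP => _; last exact: ideal0.
  by apply: sub_gen_ideal; right.
rewrite (_ : \sum_j' _ = y * sderiv j f) ?subrr; first exact: ideal0.
rewrite (bigD1 j) //= eqxx big1 ?addr0 // => j' /negbTE ->.
by rewrite mul0r.
Qed.

Lemma solves_small (V : calg K) (psi : algHom Oalg V) (th : algHom D V) g :
  solves psi th g -> small th (psi f).
Proof.
by move=> /eqP; rewrite addr_eq0 => /eqP ->; apply/smallN/small_sum.
Qed.

(** The elements h (f + e g) + e f l of O[e] vanish at every solution. *)
Lemma solves_ker (V : calg K) (psi : algHom Oalg V) (th : algHom D V) g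
    (u : ext_alg K n d) h :
  solves psi th g -> ext_c u = h * f ->
  (forall i, ideal_set If (ext_l u 0 i - h * g 0 i)) -> ext_pair psi th u = 0.
Proof.
move=> sol uc ul; rewrite /ext_pair uc rmorphM.
have -> : \sum_i th (fo_e K i) * psi (ext_l u 0 i) =
    psi h * \sum_i th (fo_e K i) * psi (g 0 i).
  rewrite mulr_sumr; apply: eq_bigr => i _; rewrite mulrCA -rmorphM.
  have [a E] := (principalP _ _).1 (ul i); apply: small_eM.
  by rewrite -rmorphB E rmorphM; apply/smallMl/(solves_small sol).
by rewrite -mulrDr sol mulr0.
Qed.

Section Presented.
Variables (X : pointed) (g : 'rV[O]_d) (phi : algHom Oalg (tot (pd_X X))).
Hypothesis phiP : presents g phi.
Local Notation th := (projH (pd_X X)).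

Lemma presents_lift a : exists x, small th (a - phi x).
Proof.
have [phiE _ _] := phiP; have [x ax] := clsH_surj (embH (pd_X X) a).
by exists x; apply/embH_small; rewrite rmorphB phiE ax subrr.
Qed.

Lemma presents_surj a : exists u, ext_pairH phi th u = a.
Proof.
have [x [b ab]] := presents_lift a; have /choice[y yb] i := presents_lift (b i).
exists (Ext x (\row_i y i)); rewrite -[RHS](subrK (phi x)) ab addrC.
by congr (_ + _); apply: eq_bigr => i _; rewrite mxE; apply/esym/small_eM.
Qed.

Lemma presents_indep (s : 'I_d -> O) :
  \sum_i th (fo_e K i) * phi (s i) = 0 -> forall i, ideal_set If (s i).
Proof.
move=> s0 i; have [phiE _ _] := phiP; apply/clsH0P.
by rewrite -phiE; apply: (projH_syzygies s0).
Qed.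

(** Dividing the constant term by f leaves a relation between the e_i, which
flatness turns into congruences modulo f. *)
Lemma presents_ker u : ext_pair phi th u = 0 -> exists h,
  ext_c u = h * f /\ forall i, ideal_set If (ext_l u 0 i - h * g 0 i).
Proof.
move=> u0; have [phiE _ sol] := phiP.
have /principalP[h uc] : ideal_set If (ext_c u).
  apply/clsH0P; rewrite -phiE; apply/embH_small.
  by move/eqP: u0; rewrite addr_eq0 => /eqP ->; apply/smallN/small_sum.
exists h; split=> //; apply: (presents_indep (s := fun i => ext_l u 0 i - h * g 0 i)).
under eq_bigr => i _ do rewrite rmorphB mulrBr rmorphM mulrCA.
rewrite sumrB -mulr_sumr; move/eqP: sol; rewrite addrC addr_eq0 => /eqP ->.
by rewrite mulrN opprK -rmorphM -uc addrC.
Qed.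

(** The total space represents the solutions of its equation. *)
Lemma presents_univ (V : calg K) (psi : algHom Oalg V) (th' : algHom D V) :
  solves psi th' g -> exists w : algHom (tot (pd_X X)) V,
    (forall x, w (phi x) = psi x) /\ (forall t, w (th t) = th' t).
Proof.
move=> sol; have [|w wE] := factor_surj (u := ext_pairH psi th') presents_surj.
  by move=> u /presents_ker[h [uc ul]]; apply: (solves_ker sol uc).
exists w; split=> [x|t].
  by rewrite -(ext_pair_c phi th) -(ext_pair_c psi th'); apply: wE.
by rewrite -(ext_pair_base phi th) -(ext_pair_base psi th'); apply: wE.
Qed.

Lemma presents_ext (V : calg K) (w w' : algHom (tot (pd_X X)) V) :
  (forall x, w (phi x) = w' (phi x)) -> (forall t, w (th t) = w' (th t)) -> w =1 w'.
Proof.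
move=> wx wt a; have [u <-] := presents_surj a; rewrite /= /ext_pair !rmorphD !rmorph_sum wx.
by congr (_ + _); apply: eq_bigr => i _; rewrite !rmorphM wx wt.
Qed.

(** Restricting the equation to the fat point, where the coordinates are constant,
leaves e_1 g_1 + ... + e_d g_d = 0. *)
Lemma presents_fat i : ideal_set I (g 0 i).
Proof.
have [phiE incE sol] := phiP; apply/clsH0P; rewrite -[LHS](embH_trivH X).
apply: (projH_syzygies (a := fun i => trivH X (clsH I (g 0 i)))).
transitivity (incH X (phi f + \sum_i th (fo_e K i) * phi (g 0 i))); last by rewrite sol rmorph0.
rewrite rmorphD incE (clsH0P _ _).2 ?rmorph0 ?add0r; last exact: fat_ideal_f.
by rewrite rmorph_sum; apply: eq_bigr => j _; rewrite rmorphM incH_projH incE.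
Qed.
End Presented.

Lemma triv_univ (X : pointed) (V : germ K) (u : algHom (fat_point f k) V) (v : algHom D V) :
  exists w : algHom (tot (pd_P X)) V,
    (forall y, w (trivH X y) = u y) /\ (forall t, w (projH (pd_P X) t) = v t).
Proof. by have [w [wu wv _]] := (pd_trivP X).1 V u v; exists w. Qed.

Lemma triv_ext (X : pointed) (V : germ K) (w w' : algHom (tot (pd_P X)) V) :
  (forall y, w (trivH X y) = w' (trivH X y)) ->
  (forall t, w (projH (pd_P X) t) = w' (projH (pd_P X) t)) -> w =1 w'.
Proof.
move=> wy wt a; have [w0 [_ _ uniq]] :=
  (pd_trivP X).1 V (comp (pd_triv X) (w : mor V _)) (comp (proj (pd_P X)) (w : mor V _)).
rewrite [LHS](uniq (w : mor V _)) // [RHS](uniq (w' : mor V _)) // => x.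
  by rewrite -[LHS]/(w' (trivH X x)) -wy.
by rewrite -[LHS]/(w' (projH (pd_P X) x)) -wt.
Qed.
End Equations.

(** * Existence and uniqueness of the equation *)

Section Classification.
Variables (K : fieldType) (n : nat) (f : series K n) (k : nat).
Hypotheses (f_neq0 : f != 0) (f_maxi : scoef f mon0 = 0).
Local Notation O := (series K n).
Local Notation Oalg := (series_alg K n).
Local Notation If := (gen_ideal [set f]).
Local Notation I := (fat_ideal f k).
Local Notation J := (tjurina_ideal f k).
Local Notation pointed d := (pointed_def (fat_point_mor f k) (fo_base K d)).

(** Separatedness of O / (f) restates that the ideal (f) is closed. *)
Lemma hypersurface_separated (y : hypersurface f) :
  (forall N, exists s, order_ge N s /\ y = clsH If s) -> y = 0.
Proof.
have [x ->] := clsH_surj y => yN; apply/clsH0P/(principal_closed f_neq0) => N.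
have [s [sN /eqP]] := yN N; rewrite -subr_eq0 -rmorphB => /eqP/clsH0P/principalP[h E].
by exists h; rewrite -E subKr.
Qed.

Lemma hypersurface_hom_eq (B : calg K) (phi : algHom Oalg B) (u : algHom B (hypersurface f)) :
  (forall i, u (phi (svar K i)) = clsH If (svar K i)) ->
  forall x, u (phi x) = clsH If x.
Proof.
move=> uX x; apply/subr0_eq/hypersurface_separated => N.
pose phi1 := u \o phi : {rmorphism O -> hypersurface f}.
have C c : phi1 (GRing.in_alg _ c) = clsH If (GRing.in_alg _ c).
  rewrite -[LHS]/(u (phi (calg_const Oalg c))) (algHom_const phi) (algHom_const u).
  exact/esym/(algHom_const (clsH If)).
have [r [t [b [tN E]]]] := hom_agree C uX N x.
have /choice[b' bE] := fun j => clsH_surj (b j).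
exists (\sum_j t j * b' j); split.
  by apply: order_ge_sum => j; rewrite mulrC; apply: order_geMl.
rewrite -[u (phi x)]/(phi1 x) E rmorph_sum; apply: eq_bigr => j _.
by rewrite bE rmorphM.
Qed.

Section Existence.
Variables (d : nat) (X : pointed d).
Local Notation th := (projH (pd_X X)).

Lemma coordinate_lift i : exists a, embH (pd_X X) a = clsH If (svar K i) /\
  incH X a = trivH X (clsH I (svar K i)).
Proof.
have [a ea] := embH_surj (pd_X X) (clsH If (svar K i)).
(* Any lift a of the coordinate induces the right function on the fat point at
   e = 0; the error is corrected by elements of (e), which come from the total space. *)
have [b ab] : small (projH (pd_P X)) (incH X a - trivH X (clsH I (svar K i))).
  apply/embH_small; rewrite rmorphB embH_incH ea embH_trivH.
  by rewrite [sub_locus_fun _ _](sub_locusE (@fat_point_sub _ _ f k)) subrr.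
have /choice[c cb] := fun j => incH_surj (b j).
exists (a - \sum_j th (fo_e K j) * c j); split.
  by rewrite rmorphB ea [X in _ - X](embH_small _).2 ?subr0 //; apply: small_sum.
rewrite rmorphB rmorph_sum; under eq_bigr => j _ do rewrite rmorphM incH_projH cb.
by rewrite -ab subKr.
Qed.

(** A power series with a nonzero constant term is a unit, and a coordinate on the
hypersurface is not one, since f has no constant term. *)
Lemma coordinate_maxi N (p : algHom (series_alg K N) (tot (pd_X X))) s i :
  embH (pd_X X) (p s) = clsH If (svar K i) -> order_ge 1 s.
Proof.
move=> ps; apply/order_ge1P/eqP; apply: contraT => /series_unit[v sv].
have [w vw] := clsH_surj (embH (pd_X X) (p v)).
have /clsH0P/principalP[h E] : clsH If (svar K i * w - 1) = 0.
  rewrite rmorphB rmorphM rmorph1 -ps -vw -(rmorphM (embH (pd_X X))) -(rmorphM p) sv.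
  by rewrite !rmorph1 subrr.
have [] : order_ge 1 (svar K i * w - h * f) /\ True.
  split=> //; apply: order_geB; first by rewrite mulrC; apply/order_geMl/order_ge_svar.
  exact/order_geMl/order_ge1P.
move=> /order_ge1P; rewrite -E subKr /= eqxx => /eqP.
by rewrite oner_eq0.
Qed.

(** The coordinates are lifted simultaneously to the total space and to the trivial
family of fat points; f evaluated at the lifts vanishes at e = 0, and expanding
it in the lifted coordinates gives the equation. *)
Lemma has_equation_exists : exists g : 'rV[O]_d, has_equation X g.
Proof.
have [N [p p_surj]] := galgP (tot (pd_X X)).
have /choice[a aP] := coordinate_lift.
have /choice[G GE] := fun i => p_surj (a i).
have G1 i : order_ge 1 (G i).
  by apply: (coordinate_maxi (p := p) (i := i)); rewrite GE; apply: (aP i).1.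
pose phi := compH p (subst_hom G1).
have phiX i : phi (svar K i) = a i by rewrite /= subst_svar.
have phi_emb : forall x, embH (pd_X X) (phi x) = clsH If x.
  by apply: hypersurface_hom_eq => i; rewrite phiX (aP i).1.
have phi_inc x : incH X (phi x) = trivH X (clsH I x).
  pose phi1 := incH X \o phi : {rmorphism O -> tot (pd_P X)}.
  pose phi2 := trivH X \o clsH I : {rmorphism O -> tot (pd_P X)}.
  have C c : phi1 (GRing.in_alg _ c) = phi2 (GRing.in_alg _ c).
    transitivity (calg_const (tot (pd_P X)) c).
      rewrite -[LHS]/(incH X (phi (calg_const Oalg c))) (algHom_const phi).
      exact: algHom_const.
    rewrite -[RHS]/(trivH X (clsH I (calg_const Oalg c))) (algHom_const (clsH I)).
    exact/esym/algHom_const.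
  have E i : phi1 (svar K i) = phi2 (svar K i).
    by rewrite -[LHS]/(incH X (phi (svar K i))) phiX (aP i).2.
  have [r [t [b [tk D]]]] := hom_agree C E k x.
  apply/subr0_eq; rewrite -[LHS]/(phi1 x - phi2 x) D big1 // => j _.
  rewrite -[phi2 _]/(trivH X (clsH I (t j))) (clsH0P _ _).2 ?rmorph0 ?mul0r //.
  by apply/fat_idealP; exists 0, (t j); rewrite mul0r add0r.
have [b fb] : small th (phi f).
  by apply/embH_small; rewrite phi_emb; apply/clsH0P/sub_gen_ideal.
have /choice[y yb] i : exists y, small th (b i - phi y).
  have [y yb] := clsH_surj (embH (pd_X X) (b i)).
  by exists y; apply/embH_small; rewrite rmorphB phi_emb yb subrr.
exists (\row_i - y i), phi; split=> //; rewrite /solves fb -big_split big1 // => i _.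
by rewrite mxE rmorphN mulrN /= (small_eM _ (yb i)) subrr.
Qed.
End Existence.

Section Uniqueness.
Variables (d : nat) (X : pointed d) (g g' : 'rV[O]_d).
Variables (phi phi' : algHom Oalg (tot (pd_X X))).
Hypotheses (phiP : presents g phi) (phiP' : presents g' phi').
Local Notation th := (projH (pd_X X)).

Lemma presents_diff : exists delta : O -> 'I_d -> O,
  forall x, phi' x - phi x = \sum_i th (fo_e K i) * phi (delta x i).
Proof.
have /choice[delta deltaE] : forall x, exists dx : 'I_d -> O,
    phi' x - phi x = \sum_i th (fo_e K i) * phi (dx i).
  move=> x; have [[phiE _ _] [phiE' _ _]] := (phiP, phiP').
  have [b ->] : small th (phi' x - phi x).
    by apply/embH_small; rewrite rmorphB phiE phiE' subrr.
  have /choice[y yb] := fun i => presents_lift phiP (b i).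
  by exists y; apply: eq_bigr => i _; apply: small_eM.
by exists delta.
Qed.

(** Two presentations differ by a derivation with values in the ideal of the
fat point, which changes the equation by an element of m^k J(f) modulo f. *)
Lemma presents_unique i : ideal_set J (g 0 i - g' 0 i).
Proof.
have [delta deltaE] := presents_diff.
have [[phiE phi_inc sol] [phiE' phi_inc' sol']] := (phiP, phiP').
have delta_uniq x (y : 'I_d -> O) :
    phi' x - phi x = \sum_i th (fo_e K i) * phi (y i) ->
    forall i, clsH If (delta x i) = clsH If (y i).
  move=> xy j; apply/subr0_eq; rewrite -rmorphB; apply/clsH0P.
  apply: (presents_indep phiP (s := fun i => delta x i - y i)).
  under eq_bigr => l _ do rewrite rmorphB mulrBr.
  by rewrite sumrB -deltaE xy subrr.
have phi'_small x : small th (phi' x - phi x) by rewrite deltaE; apply: small_sum.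
have deltaB j x y : clsH If (delta (x - y) j) = clsH If (delta x j - delta y j).
  apply: (delta_uniq _ (fun j => delta x j - delta y j)).
  under eq_bigr => l _ do rewrite rmorphB mulrBr.
  by rewrite sumrB -!deltaE !rmorphB opprD addrACA -opprD.
have deltaM j x y : clsH If (delta (x * y) j) =
    clsH If (x * delta y j + y * delta x j).
  apply: (delta_uniq _ (fun j => x * delta y j + y * delta x j)).
  have -> : phi' (x * y) - phi (x * y) =
      phi x * (phi' y - phi y) + phi' y * (phi' x - phi x).
    by rewrite !rmorphM; ring.
  rewrite !deltaE !mulr_sumr -big_split; apply: eq_bigr => l _.
  rewrite rmorphD mulrDr !rmorphM /= [phi x * _]mulrCA [phi' y * _]mulrCA; congr (_ + _).
  rewrite !mulrA [_ * phi' y]mulrC [_ * phi y]mulrC.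
  by congr (_ * _); rewrite ![_ * th _]mulrC; apply: small_eM.
have deltaC j c : clsH If (delta (GRing.in_alg O c) j) = 0.
  rewrite -(rmorph0 (clsH If)).
  apply: (delta_uniq _ (fun j => 0)); rewrite -[GRing.in_alg O c]/(calg_const Oalg c).
  by rewrite !algHom_const subrr big1 // => l _; rewrite rmorph0 mulr0.
have delta_fat x j : ideal_set I (delta x j).
  apply/clsH0P; rewrite -[LHS](embH_trivH X).
  apply: (projH_syzygies (a := fun j => trivH X (clsH I (delta x j)))).
  transitivity (incH X (phi' x - phi x)); last by rewrite rmorphB phi_inc phi_inc' subrr.
  rewrite deltaE rmorph_sum; apply: eq_bigr => l _.
  by rewrite rmorphM incH_projH phi_inc.
(* The difference between delta and the derivation by partial derivatives with the
   same values on the variables. *)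
pose E x : hypersurface f :=
  clsH If (delta x i) - \sum_j clsH If (sderiv j x * delta (svar K j) i).
have EB : zmod_morphism E.
  move=> x y; rewrite /E deltaB rmorphB opprD addrACA -opprD -sumrB; congr (_ - _).
  apply: eq_bigr => j _; rewrite -rmorphB -mulrBl; congr (clsH If (_ * _)).
  by apply: seriesP => m /=; rewrite mulrBr.
pose EA := HB.pack_for {additive O -> hypersurface f} E
  (GRing.isZmodMorphism.Build _ _ E EB).
have EC c : EA (GRing.in_alg O c) = 0.
  rewrite /= /E deltaC sub0r big1 ?oppr0 // => j _.
  by rewrite sderivC mul0r rmorph0.
have EX j x : EA (svar K j * x) = clsH If (svar K j) * EA x.
  have dX : \sum_l clsH If (sderiv l (svar K j * x) * delta (svar K l) i) =
      clsH If (x * delta (svar K j) i) +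
      clsH If (svar K j) * \sum_l clsH If (sderiv l x * delta (svar K l) i).
    under eq_bigr => l _ do rewrite sderivM sderiv_svar mulrDl rmorphD.
    rewrite big_split mulr_sumr; congr (_ + _).
      rewrite (bigD1 j) //= eqxx mul1r big1 ?addr0 // => l /negbTE lj.
      by rewrite lj !mul0r rmorph0.
    by apply: eq_bigr => l _; rewrite -mulrA rmorphM.
  by rewrite /= /E deltaM rmorphD rmorphM dX opprD addrA addrK mulrBr.
have E0 x : E x = 0.
  apply: hypersurface_separated => N.
  have [r [t [b [tN D]]]] := var_linear_divisible EC EX N x.
  have /choice[b' bE] := fun j => clsH_surj (b j).
  exists (\sum_j t j * b' j); split.
    by apply: order_ge_sum => j; rewrite mulrC; apply: order_geMl.
  rewrite -[LHS]/(EA x) D rmorph_sum; apply: eq_bigr => j _.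
  by rewrite bE rmorphM.
have gE : ideal_set If (g 0 i - g' 0 i - delta f i).
  apply: (presents_indep phiP (s := fun i => g 0 i - g' 0 i - delta f i)).
  under eq_bigr => l _ do rewrite !rmorphB !mulrBr -(small_eM _ (phi'_small (g' 0 l))).
  rewrite !sumrB -deltaE; move: sol sol'; rewrite /solves => /eqP.
  rewrite addrC addr_eq0 => /eqP -> /eqP; rewrite addrC addr_eq0 => /eqP ->.
  by ring.
apply/tjurina_idealP; exists (fun j => delta (svar K j) i); split=> //.
rewrite -[g 0 i - g' 0 i](subrK (delta f i)) -addrA; apply: idealD => //.
apply/clsH0P; rewrite rmorphB rmorph_sum /= -[RHS](E0 f); congr (_ - _).
by apply: eq_bigr => j _; rewrite mulrC.
Qed.
End Uniqueness.

(** A vector field with coefficients in the ideal of the fat point moves the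
coordinates without moving the fat point. *)
Lemma has_equation_change d (X : pointed d) (g g' : 'rV[O]_d) :
  has_equation X g -> (forall i, ideal_set J (g' 0 i - g 0 i)) -> has_equation X g'.
Proof.
move=> [phi phiP] gJ; have [phiE phi_inc sol] := phiP; set th := projH (pd_X X).
have /choice[c cP] := fun i => (tjurina_idealP _ _ _).1 (gJ i).
pose delta x i := - \sum_j c i j * sderiv j x.
pose D x : ext_alg K n d := Ext x (\row_i delta x i).
have DB : zmod_morphism D.
  move=> x y; congr Ext; apply/rowP => i; rewrite !mxE /delta -opprD; congr (- _).
  rewrite -sumrB; apply: eq_bigr => j _; rewrite -mulrBr; congr (_ * _).
  by apply: seriesP => m /=; rewrite mulrBr.
have DM : monoid_morphism D.
  split=> [|x y]; congr Ext; apply/rowP => i; rewrite !mxE /delta.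
    rewrite big1 ?oppr0 // => j _.
    by rewrite -(rmorph1 (GRing.in_alg O)) sderivC mulr0.
  rewrite !mulrN -opprD; congr (- _); rewrite !mulr_sumr -big_split.
  by apply: eq_bigr => j _ /=; rewrite sderivM; ring.
pose Dr := HB.pack_for {rmorphism O -> ext_alg K n d} D
  (GRing.isZmodMorphism.Build _ _ D DB) (GRing.isMonoidMorphism.Build _ _ D DM).
have Dc a : Dr (calg_const Oalg a) = calg_const (ext_alg K n d) a.
  congr Ext; apply/rowP => i; rewrite !mxE /delta big1 ?oppr0 // => j _.
  by rewrite sderivC mulr0.
pose DH := @AlgHom _ Oalg (ext_alg K n d) Dr Dc.
(* The new coordinates are phi - sum_ij e_i phi (c_ij * d/dx_j). *)
pose phi' := compH (ext_pairH phi th) DH.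
have phi'E x : phi' x = phi x + \sum_i th (fo_e K i) * phi (delta x i).
  by rewrite /= /ext_pair; congr (_ + _); apply: eq_bigr => i _; rewrite mxE.
have delta_fat x i : ideal_set I (delta x i).
  rewrite /delta -mulN1r; apply: idealM; elim/big_ind: _ => [|u v|j _].
  - exact: ideal0.
  - exact: idealD.
  by rewrite mulrC; apply/idealM/(cP i).1.
exists phi'; split=> [x|x|].
- rewrite phi'E rmorphD phiE [X in _ + X](embH_small _).2 ?addr0 //.
  exact: small_sum.
- rewrite phi'E rmorphD phi_inc rmorph_sum big1 ?addr0 // => i _.
  by rewrite rmorphM phi_inc (clsH0P _ _).2 // rmorph0 mulr0.
have e_phi' i x : th (fo_e K i) * phi' x = th (fo_e K i) * phi x.
  by apply: small_eM; rewrite phi'E addrC addKr; apply: small_sum.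
rewrite /solves phi'E -addrA; rewrite (eq_bigr _ (fun i _ => e_phi' i _)).
rewrite -big_split -[RHS]sol; congr (_ + _); apply: eq_bigr => i _ /=.
rewrite -mulrDr -rmorphD; apply: small_eM; rewrite -rmorphB.
have /principalP[h E] := (cP i).2.
have -> : delta f i + g' 0 i - g 0 i = h * f.
  by rewrite -E /delta; ring.
by rewrite rmorphM; apply/smallMl/(solves_small sol).
Qed.

(** * Equivalences and pullbacks *)

Lemma pd_equiv_equation d (X X' : pointed d) (g : 'rV[O]_d) :
  pd_equiv (idm (fo_base K d)) X X' -> has_equation X' g -> has_equation X g.
Proof.
move=> [_ _ [a [b [_ _ [inc_ab proj_b _ emb_b triv_a]]]]] [phi [phiE phi_inc sol]].
pose bH : algHom (tot (pd_X X')) (tot (pd_X X)) := b.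
exists (compH bH phi); split=> [x|x|].
- by rewrite -phiE; apply: (emb_b (phi x)).
- rewrite -[LHS](inc_ab (phi x)); rewrite -[RHS](triv_a (clsH I x)).
  by congr (algHom_fun a _); apply: phi_inc.
- transitivity (bH (phi f + \sum_i projH (pd_X X') (fo_e K i) * phi (g 0 i)));
    last by rewrite [X in bH X]sol rmorph0.
  rewrite rmorphD rmorph_sum; congr (_ + _).
  by apply: eq_bigr => i _; rewrite rmorphM; congr (_ * _); apply/esym/proj_b.
Qed.

(** The first order part of the equation after the substitution
e_i = sum_j M_ij e_j. *)
Definition pull_eq d d' (M : 'M[K]_(d, d')) (g : 'rV[O]_d) : 'rV[O]_d' :=
  \row_j \sum_i M i j *: g 0 i.

Definition fo_morH d d' (M : 'M[K]_(d, d')) : algHom (fo_alg K d) (fo_alg K d') := fo_mor M.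

Lemma fo_morH_e d d' (M : 'M[K]_(d, d')) i :
  fo_morH M (fo_e K i) = \sum_j calg_const (fo_alg K d') (M i j) * fo_e K j.
Proof.
rewrite [LHS](fo_decomp (fo_morH M (fo_e K i))) /= rmorph0 add0r.
by apply: eq_bigr => j _; rewrite -rowE mxE.
Qed.

Lemma algHomZ (A : calg K) (phi : algHom Oalg A) c x :
  phi (c *: x) = calg_const A c * phi x.
Proof. by rewrite -(algHom_const phi) -rmorphM /= mulr_algl. Qed.

Lemma solves_pull d d' (M : 'M[K]_(d, d')) (V : calg K) (psi : algHom Oalg V)
    (th : algHom (fo_alg K d') V) g :
  solves f psi (compH th (fo_morH M)) g <-> solves f psi th (pull_eq M g).
Proof.
rewrite /solves (_ : \sum_i compH th (fo_morH M) (fo_e K i) * psi (g 0 i) =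
  \sum_i th (fo_e K i) * psi (pull_eq M g 0 i)) //.
under eq_bigr => i _ do rewrite -[compH _ _ _]/(th (fo_morH M (fo_e K i))) fo_morH_e
  rmorph_sum mulr_suml.
rewrite exchange_big /=; apply: eq_bigr => j _; rewrite mxE rmorph_sum mulr_sumr.
apply: eq_bigr => i _; rewrite algHomZ rmorphM algHom_const.
by rewrite -mulrA mulrCA.
Qed.

Lemma pd_pullback_equation d d' (M : 'M[K]_(d, d')) (X : pointed d) (X' : pointed d') g :
  pd_pullback (fo_mor M : mor (fo_base K d') (fo_base K d)) X X' ->
  has_equation X g -> has_equation X' (pull_eq M g).
Proof.
move=> [a [b [[sq_a _] [sq_b _] [inc_ab _ emb_b triv_a]]]] [phi [phiE phi_inc sol]].
pose bH : algHom (tot (pd_X X)) (tot (pd_X X')) := b.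
exists (compH bH phi); split=> [x|x|].
- by rewrite -phiE; apply: (emb_b (phi x)).
- rewrite -[LHS](inc_ab (phi x)); rewrite -[RHS](triv_a (clsH I x)).
  by congr (algHom_fun a _); apply: phi_inc.
- apply/solves_pull; transitivity (bH (phi f + \sum_i projH (pd_X X) (fo_e K i) * phi (g 0 i)));
    last by rewrite [X in bH X]sol rmorph0.
  rewrite rmorphD rmorph_sum.
  congr (_ + _); apply: eq_bigr => i _; rewrite rmorphM; congr (_ * _).
  exact/esym/sq_b.
Qed.

End Classification.

Section Morphisms.
Variables (K : fieldType) (n : nat) (f : series K n) (k : nat).
Local Notation O := (series K n).
Local Notation Oalg := (series_alg K n).
Local Notation If := (gen_ideal [set f]).
Local Notation I := (fat_ideal f k).
Local Notation pointed d := (pointed_def (fat_point_mor f k) (fo_base K d)).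

(** A base change M carries the equation of a presented deformation to the
equation of another one as soon as the universal properties of the two
presentations can be compared. *)
Lemma presents_morphism d d' (M : 'M[K]_(d, d')) (X : pointed d) (X' : pointed d')
    (g : 'rV[O]_d) (phi : algHom Oalg (tot (pd_X X))) (phi' : algHom Oalg (tot (pd_X X'))) :
  presents g phi -> presents (pull_eq M g) phi' ->
  exists (a : algHom (tot (pd_P X)) (tot (pd_P X')))
         (b : algHom (tot (pd_X X)) (tot (pd_X X'))),
  [/\ (forall y, a (trivH X y) = trivH X' y) /\
        (forall t, a (projH (pd_P X) t) = projH (pd_P X') (fo_morH M t)),
      (forall x, b (phi x) = phi' x) /\
        (forall t, b (projH (pd_X X) t) = projH (pd_X X') (fo_morH M t)),
      forall x, a (incH X x) = incH X' (b x),
      forall x, embH (pd_P X') (a x) = embH (pd_P X) x &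
      forall x, embH (pd_X X') (b x) = embH (pd_X X) x].
Proof.
move=> phiP phiP'; have [[phiE phi_inc _] [phiE' phi_inc' sol']] := (phiP, phiP').
have [a [a_triv a_proj]] := triv_univ X (trivH X') (compH (projH (pd_P X')) (fo_morH M)).
have sol : solves f phi' (compH (projH (pd_X X')) (fo_morH M)) g by apply/solves_pull.
have [b [b_phi b_proj]] := presents_univ phiP sol.
exists a, b; split=> //.
- apply: (presents_ext phiP (w := compH a (incH X)) (w' := compH (incH X') b)) => [x|t].
    rewrite -[LHS]/(a (incH X (phi x))) -[RHS]/(incH X' (b (phi x))).
    by rewrite phi_inc a_triv b_phi phi_inc'.
  rewrite -[LHS]/(a (incH X (projH _ t))) -[RHS]/(incH X' (b (projH _ t))).
  by rewrite incH_projH a_proj b_proj incH_projH.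
- apply: (triv_ext (w := compH (embH (pd_P X')) a)) => [y|t].
    by rewrite -[LHS]/(embH _ (a (trivH X y))) a_triv !embH_trivH.
  by rewrite -[LHS]/(embH _ (a (projH _ t))) a_proj !embH_projH.
- apply: (presents_ext phiP (w := compH (embH (pd_X X')) b)) => [x|t].
    by rewrite -[LHS]/(embH _ (b (phi x))) b_phi phiE phiE'.
  by rewrite -[LHS]/(embH _ (b (projH _ t))) b_proj !embH_projH.
Qed.

Lemma fo_morH1 d t : fo_morH (1%:M : 'M[K]_d) t = t.
Proof. by case: t => c v; congr FirstOrder => /=; rewrite mulmx1. Qed.

Lemma pull_eq1 d (g : 'rV[O]_d) : pull_eq (1%:M : 'M[K]_d) g = g.
Proof.
apply/rowP => j; rewrite mxE (bigD1 j) //= mxE eqxx scale1r big1 ?addr0 // => i /negbTE ij.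
by rewrite mxE ij scale0r.
Qed.

(** Both total spaces represent the solutions of the same equation. *)
Lemma equation_pd_equiv d (X X' : pointed d) (g : 'rV[O]_d) :
  has_equation X g -> has_equation X' g -> pd_equiv (idm (fo_base K d)) X X'.
Proof.
move=> [phi phiP] [phi' phiP'].
have [|a [b [[a_triv a_proj] [b_phi b_proj] ab_inc a_emb b_emb]]] :=
  presents_morphism (M := 1%:M) phiP' (phi' := phi); first by rewrite pull_eq1.
have [|a' [b' [[a'_triv a'_proj] [b'_phi b'_proj] _ _ _]]] :=
  presents_morphism (M := 1%:M) phiP (phi' := phi'); first by rewrite pull_eq1.
split; [by exists (idm _); split | by [] |].
exists a, b; split; [exists a'; split | exists b'; split | split].
- apply: (triv_ext (w := compH a a') (w' := idm (tot (pd_P X)))) => [y|t].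
    by rewrite -[LHS]/(a (a' (trivH X y))) a'_triv a_triv.
  by rewrite -[LHS]/(a (a' (projH _ t))) a'_proj a_proj !fo_morH1.
- apply: (triv_ext (w := compH a' a) (w' := idm (tot (pd_P X')))) => [y|t].
    by rewrite -[LHS]/(a' (a (trivH X' y))) a_triv a'_triv.
  by rewrite -[LHS]/(a' (a (projH _ t))) a_proj a'_proj !fo_morH1.
- apply: (presents_ext phiP (w := compH b b') (w' := idm (tot (pd_X X)))) => [x|t].
    by rewrite -[LHS]/(b (b' (phi x))) b'_phi b_phi.
  by rewrite -[LHS]/(b (b' (projH _ t))) b'_proj b_proj !fo_morH1.
- apply: (presents_ext phiP' (w := compH b' b) (w' := idm (tot (pd_X X')))) => [x|t].
    by rewrite -[LHS]/(b' (b (phi' x))) b_phi b'_phi.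
  by rewrite -[LHS]/(b' (b (projH _ t))) b_proj b'_proj !fo_morH1.
- exact: ab_inc.
- by move=> t; rewrite -[RHS]/(projH (pd_X X) t) -[in RHS](fo_morH1 t); apply: b_proj.
- exact: a_emb.
- exact: b_emb.
- exact: a_triv.
Qed.

(** A point of the pullback is a solution of the equation whose parameters come
from the new base, hence a solution of the substituted equation. *)
Lemma equation_pd_pullback d d' (M : 'M[K]_(d, d')) (X : pointed d) (X' : pointed d')
    (g : 'rV[O]_d) :
  has_equation X g -> has_equation X' (pull_eq M g) ->
  pd_pullback (fo_mor M : mor (fo_base K d') (fo_base K d)) X X'.
Proof.
move=> [phi phiP] [phi' phiP'].
have [a [b [[a_triv a_proj] [b_phi b_proj] ab_inc a_emb b_emb]]] :=
  presents_morphism phiP phiP'.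
have [phiE phi_inc sol] := phiP.
exists a, b; split; [| |split].
- split=> [t|V u v uv]; first exact: a_proj.
  pose uH : algHom (tot (pd_P X)) V := u; pose vH : algHom (fo_alg K d') V := v.
  have [w [w_triv w_proj]] := triv_univ X' (compH uH (trivH X)) vH.
  exists w; split=> [x|t|w' w'a w'p].
  + apply: (triv_ext (w := compH w a) (w' := uH)) => [y|t].
      by rewrite -[LHS]/(w (a (trivH X y))) a_triv w_triv.
    rewrite -[LHS]/(w (a (projH _ t))) a_proj w_proj.
    exact/esym/uv.
  + exact: w_proj.
  apply: (triv_ext (w := (w' : algHom _ _))) => [y|t]; last by rewrite w_proj; apply: w'p.
  by rewrite w_triv -a_triv; apply: w'a.
- split=> [t|V u v uv]; first exact: b_proj.
  pose uH : algHom (tot (pd_X X)) V := u; pose vH : algHom (fo_alg K d') V := v.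
  have sol' : solves f (compH uH phi) vH (pull_eq M g).
    apply/solves_pull; transitivity
      (uH (phi f + \sum_i projH (pd_X X) (fo_e K i) * phi (g 0 i)));
      last by rewrite [X in uH X]sol rmorph0.
    rewrite rmorphD rmorph_sum; congr (_ + _); apply: eq_bigr => i _.
    by rewrite rmorphM; congr (_ * _); apply/esym/uv.
  have [w [w_phi w_proj]] := presents_univ phiP' sol'.
  exists w; split=> [x|t|w' w'b w'p].
  + apply: (presents_ext phiP (w := compH w b) (w' := uH)) => [y|t].
      by rewrite -[LHS]/(w (b (phi y))) b_phi w_phi.
    rewrite -[LHS]/(w (b (projH _ t))) b_proj w_proj.
    exact/esym/uv.
  + exact: w_proj.
  apply: (presents_ext phiP' (w := (w' : algHom _ _))) => [y|t]; last by rewrite w_proj; apply: w'p.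
  by rewrite w_phi -b_phi; apply: w'b.
- exact: ab_inc.
- exact: a_emb.
- exact: b_emb.
- exact: a_triv.
Qed.
End Morphisms.

(** * Families with a given equation *)

Section Models.
Variables (K : fieldType) (n d : nat).
Local Notation O := (series K n).
Local Notation Oalg := (series_alg K n).
Local Notation D := (fo_alg K d).
Local Notation E := (ext_alg K n d).

Lemma ext_cH_const c : ext_c (calg_const E c) = calg_const Oalg c.
Proof. by []. Qed.
Definition ext_cH : algHom E Oalg := @AlgHom _ E Oalg (@ext_c O d) ext_cH_const.

Section Quotient.
Variable Q : ideal (ext O d).

Definition ext_cls_hom : algHom E (ext_germ Q) := ext_cls Q.
Definition coord_quo : algHom Oalg (ext_germ Q) := compH ext_cls_hom (ext_constH K n d).
Definition proj_quo : algHom D (ext_germ Q) := compH ext_cls_hom (ext_baseH K n d).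

Lemma ext_cls_surj a : exists u, ext_cls_hom u = a.
Proof. by have [u ->] := @cls_surj _ Q a; exists u. Qed.

Lemma ext_cls0P u : ext_cls_hom u = 0 <-> ideal_set Q u.
Proof. exact: cls0P. Qed.

Lemma ext_cls_decomp u : ext_cls_hom u = coord_quo (ext_c u) +
  \sum_i proj_quo (fo_e K i) * coord_quo (ext_l u 0 i).
Proof.
have uE : u = ext_constH K n d (ext_c u) + \sum_i ext_baseH K n d (fo_e K i) *
    ext_constH K n d (ext_l u 0 i) :> E by exact: ext_decomp.
apply: (etrans (congr1 ext_cls_hom uE)).
rewrite (rmorphD ext_cls_hom).
rewrite (rmorph_sum ext_cls_hom).
apply: (congr2 +%R); first by [].
by apply: eq_bigr => i _; rewrite (rmorphM ext_cls_hom).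
Qed.

Lemma ext_quo_hom_eq (V : calg K) (w w' : algHom (ext_germ Q) V) :
  (forall x, w (coord_quo x) = w' (coord_quo x)) ->
  (forall t, w (proj_quo t) = w' (proj_quo t)) -> w =1 w'.
Proof.
move=> wc wp a; have [u <-] := ext_cls_surj a.
rewrite ext_cls_decomp !rmorphD !rmorph_sum wc; congr (_ + _).
by apply: eq_bigr => i _; rewrite !rmorphM wc wp.
Qed.

(** O[e] / Q is a deformation of O / L when L is the image of Q at e = 0 and
every equation e_i y_i = 0 modulo Q comes from L. *)
Lemma quotient_deformation (L : ideal O) :
  (forall u, ideal_set Q u -> ideal_set L (ext_c u)) ->
  (forall x, ideal_set L x -> small proj_quo (coord_quo x)) ->
  (forall y : 'rV[O]_d, ideal_set Q (Ext 0 y) -> forall i, ideal_set L (y 0 i)) ->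
  exists em : algHom (ext_germ Q) (locus L),
  [/\ forall u, em (ext_cls_hom u) = clsH L (ext_c u),
      flat (proj_quo : mor (ext_germ Q) (fo_base K d)),
      embedding (em : mor (locus L) (ext_germ Q)) &
      cartesian (em : mor (locus L) (ext_germ Q)) (to_pt (locus L))
        (proj_quo : mor (ext_germ Q) (fo_base K d)) (base_pt (fo_base K d))].
Proof.
move=> QL L_small Q_e.
have [u Qu|em emE] := factor_surj (u := compH (clsH L) ext_cH) ext_cls_surj.
  by apply/clsH0P/QL/ext_cls0P.
have em_surj y : exists a, em a = y.
  have [x ->] := clsH_surj y; exists (ext_cls_hom (ext_const d x)).
  exact: emE.
exists em; split=> //.
  apply: flat_of_syzygies => a.
  have /choice[u uE] := fun i => ext_cls_surj (a i).
  move=> a0 i; rewrite -uE ext_cls_decomp; apply: smallD; last exact: small_sum.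
  apply: L_small; suff /Q_e/(_ i) : ideal_set Q (Ext 0 (\row_i ext_c (u i))) by rewrite mxE.
  apply/ext_cls0P; rewrite -[RHS]a0 ext_cls_decomp rmorph0 add0r.
  apply: eq_bigr => j _; rewrite mxE -uE; apply: small_eM.
  rewrite ext_cls_decomp opprD addrA subrr sub0r; apply: smallN.
  exact: small_sum.
split=> [t|V u v uv].
  rewrite -[LHS]/(em (ext_cls_hom (ext_base n t))) emE /=.
  exact: (algHom_const (clsH L)).
pose uH : algHom (ext_germ Q) V := u.
have u_e i : uH (proj_quo (fo_e K i)) = 0.
  by rewrite [LHS]uv -[LHS]/(algHom_fun v (fo_const (fo_e K i))) rmorph0.
have [x /clsH0P/L_small[b bE]|w wE] :=
  factor_surj (u := compH uH coord_quo) (fun y => let: ex_intro x e := clsH_surj y in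
    ex_intro (fun x => clsH L x = y) x (esym e)).
  rewrite -[LHS]/(uH (coord_quo x)) bE rmorph_sum big1 // => i _.
  by rewrite rmorphM u_e mul0r.
have w_em a : w (em a) = uH a.
  have [y <-] := ext_cls_surj a; rewrite emE [RHS]/= ext_cls_decomp rmorphD rmorph_sum.
  rewrite [X in _ + X]big1 ?addr0 => [|i _]; last by rewrite rmorphM u_e mul0r.
  exact: wE.
exists w; split=> [a|c|w' w'u _ y].
- exact: w_em.
- by rewrite -[LHS]/(w (calg_const (locus L) c)) (algHom_const w) -(algHom_const v).
- have [a <-] := em_surj y; rewrite -[RHS]/(w (em a)) w_em; exact: w'u.
Qed.
End Quotient.

Variables (f : O) (k : nat).
Hypothesis f_neq0 : f != 0.
Local Notation If := (gen_ideal [set f]).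
Local Notation I := (fat_ideal f k).

Section Equation.
Variable g : 'rV[O]_d.
Hypothesis g_fat : forall i, ideal_set I (g 0 i).

Definition fam_ideal : ideal (ext O d) := gen_ideal [set Ext f g].

Lemma fam_idealP u : ideal_set fam_ideal u <->
  exists a, ext_c u = ext_c a * f /\
    forall i, ext_l u 0 i = ext_c a * g 0 i + f * ext_l a 0 i.
Proof.
split=> [/principalP[a ->]|[a [uc ul]]].
  by exists a; split=> // i; rewrite /= !mxE.
apply/principalP; exists a; apply: ext_eq => [|i]; first exact: uc.
by rewrite ul /= !mxE.
Qed.

Lemma fam_solves : solves f (coord_quo fam_ideal) (proj_quo fam_ideal) g.
Proof.
apply: (etrans (esym (ext_cls_decomp fam_ideal (Ext f g)))); apply/ext_cls0P.
exact: sub_gen_ideal.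
Qed.

(** The ideal of the constant family of fat points. *)
Definition fat_fam_set : set (ext O d) :=
  [set u | ideal_set I (ext_c u) /\ forall i, ideal_set I (ext_l u 0 i)].
Lemma fat_fam0 : fat_fam_set 0.
Proof. by split=> [|i]; rewrite ?mxE; apply: ideal0. Qed.
Lemma fat_famD u v : fat_fam_set u -> fat_fam_set v -> fat_fam_set (u + v).
Proof.
by move=> [uc ul] [vc vl]; split=> [|i]; rewrite ?mxE; apply: idealD.
Qed.
Lemma fat_famM a u : fat_fam_set u -> fat_fam_set (a * u).
Proof.
move=> [uc ul]; split=> [|i]; first exact: idealM.
by rewrite !mxE; apply: idealD; [exact: idealM | rewrite mulrC; apply: idealM].
Qed.
Definition fat_fam_ideal := Ideal fat_fam0 fat_famD fat_famM.

Lemma fam_ideal_fat u : ideal_set fam_ideal u -> ideal_set fat_fam_ideal u.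
Proof.
apply: gen_ideal_sub => _ ->; split=> //; exact: fat_ideal_f.
Qed.

(** f + e_1 g_1 + ... + e_d g_d = 0 is the equation of a pointed deformation,
flat because f is not a zero divisor, and containing the constant family of fat
points because the g_i vanish on the fat point. *)
Lemma equation_realized :
  exists X : pointed_def (fat_point_mor f k) (fo_base K d), has_equation X g.
Proof.
have [||y /fam_idealP[a [/= a0 ay]] i|eX [eXE fX sX cX]] :=
  @quotient_deformation fam_ideal If.
- by move=> u /fam_idealP[a [-> _]]; apply/principalP; exists (ext_c a).
- by move=> x /principalP[h ->]; rewrite rmorphM; apply/smallMl/(solves_small fam_solves).
- apply/principalP; exists (ext_l a 0 i).
  by rewrite ay (series_mulIf f_neq0 (esym a0)) mul0r add0r mulrC.
have [||y []|eP [ePE fP sP cP]] // := @quotient_deformation fat_fam_ideal I.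
- by move=> u [].
- move=> x Ix; rewrite (_ : coord_quo _ x = 0); first exact: small0.
  by apply/ext_cls0P; split=> // i; rewrite mxE; apply: ideal0.
pose X := Deformation fX sX cX; pose P := Deformation fP sP cP.
have [u|inc incE] := factor_surj (u := ext_cls_hom fat_fam_ideal) (@ext_cls_surj fam_ideal).
  by move=> /ext_cls0P/fam_ideal_fat/ext_cls0P.
have inc_emb : embedding (inc : mor (tot P) (tot X)).
  by move=> b; have [u <-] := ext_cls_surj b; exists (ext_cls_hom fam_ideal u); apply: incE.
have inc_proj : mor_eq (comp (proj X) (inc : mor (tot P) (tot X))) (proj P).
  by move=> t; apply: incE.
have sub_cls x : sub_locus_fun I (clsH If x) = clsH I x.
  exact: (sub_locusE (@fat_point_sub _ _ f k)).
have inc_cart : cartesian (emb P) (fat_point_mor f k) (inc : mor (tot P) (tot X)) (emb X).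
  split=> [a|V u v uv].
    have [x <-] := ext_cls_surj a; rewrite -[LHS]/(eP (inc (ext_cls_hom _ x))) incE ePE.
    by rewrite -[RHS]/(sub_locus_fun I (eX (ext_cls_hom _ x))) eXE sub_cls.
  pose uH : algHom (tot P) V := u; pose vH : algHom (hypersurface f) V := v.
  have uvE x : uH (ext_cls_hom fat_fam_ideal x) = vH (clsH If (ext_c x)).
    by rewrite -incE -eXE; apply: uv.
  have surjI (y : fat_point f k) : exists x, clsH I x = y.
    by have [x ->] := clsH_surj y; exists x.
  have [x /clsH0P Ix|w wE] := factor_surj (u := compH vH (clsH If)) surjI.
    rewrite -[LHS]/(vH (clsH If (ext_c (ext_const d x)))) -uvE (ext_cls0P _ _).2 ?rmorph0 //.
    by split=> // i; rewrite mxE; apply: ideal0.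
  have w_eP b : w (eP b) = uH b.
    by have [x <-] := ext_cls_surj b; rewrite ePE uvE; apply: wE.
  exists w; split=> [b|y|w' w'u _ y].
  - exact: w_eP.
  - have [x ->] := clsH_surj y.
    by rewrite -[LHS]/(w (sub_locus_fun I (clsH If x))) sub_cls; apply: wE.
  - by have [b <-] := sP y; rewrite -[RHS]/(w (eP b)) w_eP; apply: w'u.
have surjI (y : fat_point f k) : exists x, clsH I x = y.
  by have [x ->] := clsH_surj y; exists x.
have [x /clsH0P Ix|q qE] := factor_surj (u := coord_quo fat_fam_ideal) surjI.
  by apply/ext_cls0P; split=> // i; rewrite mxE; apply: ideal0.
have q_triv : trivialization (q : mor (tot P) (fat_point f k)).
  split=> [V u v|y]; last first.
    have [x <-] := surjI y; rewrite -[LHS]/(eP (q (clsH I x))) qE.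
    exact: ePE.
  pose uH : algHom (fat_point f k) V := u; pose vH : algHom D V := v.
  have [x /ext_cls0P[Ic Il]|w wE] := factor_surj (u := ext_pairH (compH uH (clsH I)) vH)
    (@ext_cls_surj fat_fam_ideal).
    have u0 y : ideal_set I y -> compH uH (clsH I) y = 0.
      by move=> Iy; rewrite -[LHS]/(uH (clsH I y)) (clsH0P _ _).2 ?rmorph0.
    rewrite /= /ext_pair u0 // big1 ?addr0 // => i _.
    by rewrite u0 ?mulr0.
  have wq y : w (q y) = uH y.
    by have [x <-] := surjI y; rewrite qE [LHS]wE /= ext_pair_c.
  have wp t : w (proj_quo fat_fam_ideal t) = vH t by rewrite [LHS]wE /= ext_pair_base.
  exists w; split=> [y|t|w' w'u w'v].
  - exact: wq.
  - exact: wp.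
  apply: (ext_quo_hom_eq (w := (w' : algHom _ _))) => [x|t]; last by rewrite wp; apply: w'v.
  by rewrite -qE wq; apply: w'u.
pose Y := PointedDef inc_emb inc_proj inc_cart q_triv.
exists Y, (coord_quo fam_ideal); split=> [x|x|].
- exact: eXE.
- by rewrite -[RHS]/(q (clsH I x)) qE; apply: incE.
- exact: fam_solves.
Qed.
End Equation.
End Models.

(** * The tangent space *)

Section Classes.
Variables (K : fieldType) (n : nat) (f : series K n) (k : nat).
Hypotheses (f_neq0 : f != 0) (f_maxi : scoef f mon0 = 0).
Local Notation O := (series K n).
Local Notation I := (fat_ideal f k).
Local Notation J := (tjurina_ideal f k).
Local Notation pointed d := (pointed_def (fat_point_mor f k) (fo_base K d)).
Local Notation Defk d := (Def (fat_point_mor f k) (fo_base K d)).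

Lemma has_equation_eqJ d (X X' : pointed d) g h :
  has_equation X g -> has_equation X' g -> has_equation X h -> has_equation X' h.
Proof.
move=> [phi phiP] X'g [psi psiP]; apply: has_equation_change X'g _ => i.
exact: presents_unique psiP phiP i.
Qed.

Lemma pd_equivP d (X X' : pointed d) :
  pd_equiv (idm (fo_base K d)) X X' <-> exists g, has_equation X g /\ has_equation X' g.
Proof.
split=> [XX'|[g [Xg X'g]]]; last exact: equation_pd_equiv Xg X'g.
have [g X'g] := has_equation_exists f_neq0 f_maxi X'.
by exists g; split=> //; apply: pd_equiv_equation XX' X'g.
Qed.

Lemma def_classP d (X X' : pointed d) :
  def_class X = def_class X' <-> exists g, has_equation X g /\ has_equation X' g.
Proof.
split=> [[XX']|[g [Xg X'g]]].
  apply/pd_equivP; rewrite -[pd_equiv _ _ _]/(pd_class X X') XX'.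
  have [g X'g] := has_equation_exists f_neq0 f_maxi X'.
  by apply/pd_equivP; exists g.
apply: eq_exist => /=; apply/funext => Y; apply/propext; rewrite /pd_class.
split=> /pd_equivP[h [Zh Yh]]; apply/pd_equivP; exists h; split=> //.
  exact: has_equation_eqJ Xg X'g Zh.
exact: has_equation_eqJ X'g Xg Zh.
Qed.

Definition class_equation d (t : Defk d) (g : 'rV[O]_d) :=
  exists X, t = def_class X /\ has_equation X g.

Lemma def_class_surj d (t : Defk d) : exists X, t = def_class X.
Proof. by case: t => c [X cX]; exists X; apply: eq_exist. Qed.

Lemma class_equation_exists d (t : Defk d) : exists g, class_equation t g.
Proof.
have [X ->] := def_class_surj t; have [g Xg] := has_equation_exists f_neq0 f_maxi X.
by exists g, X.
Qed.

Lemma class_equation_rep d (X : pointed d) g :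
  class_equation (def_class X) g -> has_equation X g.
Proof.
by move=> [X' [/def_classP[h [Xh X'h]] X'g]]; apply: has_equation_eqJ X'h Xh X'g.
Qed.

Lemma class_equation_eqJ d (t : Defk d) g h : class_equation t g ->
  class_equation t h <-> forall i, ideal_set J (h 0 i - g 0 i).
Proof.
move=> [X [-> Xg]]; split=> [/class_equation_rep[psi psiP]|gh] => [i|].
  by have [phi phiP] := Xg; apply: presents_unique psiP phiP i.
by exists X; split=> //; apply: has_equation_change Xg gh.
Qed.

Lemma class_equation_fat d (t : Defk d) g i : class_equation t g -> ideal_set I (g 0 i).
Proof. by move=> [X [_ [phi phiP]]]; apply: presents_fat phiP i. Qed.

Lemma class_equation_inj d (t t' : Defk d) g :
  class_equation t g -> class_equation t' g -> t = t'.
Proof. by move=> [X [-> Xg]] [X' [-> X'g]]; apply/def_classP; exists g. Qed.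

Lemma class_equation_surj d (g : 'rV[O]_d) : (forall i, ideal_set I (g 0 i)) ->
  exists t : Defk d, class_equation t g.
Proof.
by move=> /(equation_realized f_neq0)[X Xg]; exists (def_class X), X.
Qed.

Lemma def_pullbackP d d' (M : 'M[K]_(d, d')) (t : Defk d) (t' : Defk d') g :
  class_equation t g ->
  def_pullback (fo_mor M : mor (fo_base K d') (fo_base K d)) t t' <->
  class_equation t' (pull_eq M g).
Proof.
move=> tg; split=> [[X [X' [tX t'X' XX']]]|[X' [-> X'g]]].
  move: tg; rewrite tX t'X' => /class_equation_rep Xg.
  by exists X'; split=> //; apply: pd_pullback_equation XX' Xg.
have [X [-> Xg]] := tg; exists X, X'; split=> //.
exact: equation_pd_pullback Xg X'g.
Qed.

(** A class of first order deformations is sent to the first order term of its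
equation modulo the Tjurina ideal. *)
Lemma coord_exists (t : Defk 1) : exists c : tjurina_quotient f k,
  forall g, class_equation t g <-> ideal_set I (g 0 0) /\ subquo_val c = cls J (g 0 0).
Proof.
have [g tg] := class_equation_exists t.
have gI : cls J (g 0 0) \in subquo_pred I.
  by apply/asboolP; exists (g 0 0) => //; apply: class_equation_fat tg.
exists (Subquo gI) => h; split=> [th|[hI /clsP gh]].
  split; first exact: class_equation_fat th.
  by apply/clsP; apply: ((class_equation_eqJ g th).1 tg 0).
apply/(class_equation_eqJ h tg) => i; rewrite ord1 -opprB -mulN1r.
exact: idealM.
Qed.

Definition def_coord (t : Defk 1) : tjurina_quotient f k := sval (cid (coord_exists t)).

Lemma def_coordP (t : Defk 1) g :
  class_equation t g <-> ideal_set I (g 0 0) /\ subquo_val (def_coord t) = cls J (g 0 0).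
Proof. by rewrite /def_coord; case: cid. Qed.

Lemma subquo_eq (u v : tjurina_quotient f k) : subquo_val u = subquo_val v -> u = v.
Proof. exact: val_inj. Qed.

Lemma subquo_rep (u : tjurina_quotient f k) :
  exists x, ideal_set I x /\ subquo_val u = cls J x.
Proof. by case: u => u /= /asboolP[x Ix ->]; exists x. Qed.

Lemma def_coord_bij : bijective def_coord.
Proof.
have coordS u : exists t, def_coord t = u.
  have [x [Ix ux]] := subquo_rep u.
  have [|t tx] := @class_equation_surj 1 (\row_i x); first by move=> i; rewrite mxE.
  by exists t; apply: subquo_eq; rewrite ux ((def_coordP _ _).1 tx).2 mxE.
have /choice[inv invK] := coordS.
exists inv => // t; have [g tg] := class_equation_exists t.
apply: class_equation_inj (tg); apply/def_coordP; rewrite invK.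
exact: (def_coordP t g).1 tg.
Qed.

Lemma def_coord_rep (t : Defk 1) x : ideal_set I x -> subquo_val (def_coord t) = cls J x ->
  class_equation t (\row_i x).
Proof. by move=> Ix tx; apply/def_coordP; rewrite mxE. Qed.

Lemma def_coordD (t1 t2 t : Defk 1) :
  tan_add t1 t2 t <-> def_coord t = def_coord t1 + def_coord t2.
Proof.
have E0 (g : 'rV[O]_2) : pull_eq (delta_mx 0 0 : 'M[K]_(2, 1)) g 0 0 = g 0 0.
  by rewrite mxE big_ord_recl big_ord1 !mxE /= scale1r scale0r addr0.
have E1 (g : 'rV[O]_2) : pull_eq (delta_mx 1 0 : 'M[K]_(2, 1)) g 0 0 = g 0 1.
  rewrite mxE big_ord_recl big_ord1 !mxE /= scale1r scale0r add0r.
  by congr (g _ _); apply: val_inj.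
have ED (g : 'rV[O]_2) : pull_eq (const_mx 1 : 'M[K]_(2, 1)) g 0 0 = g 0 0 + g 0 1.
  rewrite mxE big_ord_recl big_ord1 !mxE !scale1r.
  by congr (_ + g _ _); apply: val_inj.
split=> [[s [st1 st2 st]]|tE].
  have [g sg] := class_equation_exists s.
  have /def_coordP[_ e1] := (def_pullbackP _ _ sg).1 st1.
  have /def_coordP[_ e2] := (def_pullbackP _ _ sg).1 st2.
  have /def_coordP[_ e] := (def_pullbackP _ _ sg).1 st.
  by apply: subquo_eq; rewrite e ED raddfD /= -[in LHS]E0 -[in LHS]E1 -e1 -e2.
have [x1 [Ix1 e1]] := subquo_rep (def_coord t1).
have [x2 [Ix2 e2]] := subquo_rep (def_coord t2).
have [|s sg] := @class_equation_surj 2 (\row_i if i == 0 then x1 else x2).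
  by move=> i; rewrite mxE; case: eqP.
exists s; split; apply/(def_pullbackP _ _ sg)/def_coordP.
- by rewrite E0 mxE.
- by rewrite E1 mxE.
rewrite ED !mxE; split; first exact: idealD Ix1 Ix2.
rewrite tE -[LHS]/(subquo_val (def_coord t1) + subquo_val (def_coord t2)) e1 e2.
exact/esym/(raddfD (cls J)).
Qed.

Lemma def_coordZ c (t t' : Defk 1) :
  tan_scale c t t' <-> def_coord t' = c *: def_coord t.
Proof.
have EZ (g : 'rV[O]_1) : pull_eq (c%:M : 'M[K]_(1, 1)) g 0 0 = c *: g 0 0.
  by rewrite mxE big_ord1 mxE eqxx mulr1n.
have [x [Ix e]] := subquo_rep (def_coord t).
have tx := def_coord_rep Ix e.
rewrite /tan_scale (def_pullbackP _ _ tx) def_coordP EZ mxE (cls_scalable J) -e.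
split=> [[_ t'E]|->]; first exact: subquo_eq.
by split=> //; rewrite -mulr_algl; apply: idealM.
Qed.

Definition tjurina_tangent_space : TDef f k :=
  TangentSpace def_coord_bij def_coordD def_coordZ.
End Classes.

(** The operations on classes are determined by the functor, so that any two
linear structures inducing them agree. *)
Lemma tangent_space_unique (K : fieldType) (P X : germ K) (i : mor P X)
    (T T' : tangent_space i) : exists phi : {linear T -> T'}, bijective phi.
Proof.
have [inv invK Kinv] := tan_coord_bij T; have [inv' inv'K Kinv'] := tan_coord_bij T'.
pose phi (v : T) : T' := tan_coord T' (inv v).
have phiD : {morph phi : u v / u + v}.
  by move=> u v; apply/(@tan_coordD _ _ _ _ T')/(@tan_coordD _ _ _ _ T); rewrite !Kinv.
have phiZ : scalable phi.
  by move=> c v; apply/(@tan_coordZ _ _ _ _ T')/(@tan_coordZ _ _ _ _ T); rewrite !Kinv.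
have phiB : zmod_morphism phi.
  by move=> u v; rewrite phiD -scaleN1r phiZ scaleN1r.
pose phiL := HB.pack_for {linear T -> T'} phi
  (GRing.isZmodMorphism.Build _ _ phi phiB) (GRing.isScalable.Build _ _ _ _ phi phiZ).
exists phiL; exists (fun v => tan_coord T (inv' v)) => v.
  by rewrite /= /phi inv'K Kinv.
by rewrite /= /phi invK Kinv'.
Qed.

(** * Dimensions *)

Section Dimension.
Variables (R : realType) (K : fieldType).

Definition indep (V : lmodType K) r (v : 'I_r -> V) :=
  forall c : 'I_r -> K, \sum_i c i *: v i = 0 -> forall i, c i = 0.

Definition spanning (V : lmodType K) r (v : 'I_r -> V) :=
  forall x, exists c : 'I_r -> K, x = \sum_i c i *: v i.

Lemma sum_scale_mulmx (V : lmodType K) p q r (C : 'M[K]_(p, q)) (A : 'M[K]_(q, r))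
    (v : 'I_r -> V) l :
  \sum_i C l i *: (\sum_j A i j *: v j) = \sum_j (C *m A) l j *: v j.
Proof.
under eq_bigr => i _ do rewrite scaler_sumr.
rewrite exchange_big; apply: eq_bigr => j _; rewrite mxE scaler_suml.
by apply: eq_bigr => i _; rewrite scalerA.
Qed.

Lemma indep_row_free (V : lmodType K) m r (v : 'I_r -> V) (C : 'M[K]_(m, r)) :
  indep v -> row_free C -> indep (fun l => \sum_i C l i *: v i).
Proof.
move=> v_ind C_free c c0 l.
pose c' : 'rV[K]_m := \row_l c l; suff c'0 : c' = 0.
  by move: (congr1 (fun u : 'rV_m => u 0 l) c'0); rewrite !mxE.
apply: (row_free_inj C_free); rewrite mul0mx; apply/rowP => i; rewrite [RHS]mxE.
apply: (v_ind (fun i => (c' *m C) 0 i)); rewrite -[RHS]c0 -sum_scale_mulmx.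
by apply: eq_bigr => j _; rewrite mxE.
Qed.

(** Eliminating u linear conditions costs at most u independent vectors. *)
Lemma kernel_matrix r u (A : 'M[K]_(r, u)) : exists m (C : 'M[K]_(m, r)),
  [/\ row_free C, C *m A = 0 & (r <= m + u)%N].
Proof.
exists (\rank (kermx A)), (row_base (kermx A)); split.
- exact: row_base_free.
- by apply/sub_kermxP; rewrite eq_row_base.
- by rewrite mxrank_ker -leq_subLR subKn ?rank_leq_row ?rank_leq_col.
Qed.

Lemma indep_size_le (V : lmodType K) r u (v : 'I_r -> V) (s : 'I_u -> V) :
  indep v -> spanning s -> (r <= u)%N.
Proof.
move=> v_ind s_span; have /choice[a aE] := fun i => s_span (v i).
have [m [C [C_free CA rmu]]] := kernel_matrix (\matrix_(i, j) a i j).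
case: m C C_free CA rmu => [|m] C C_free CA rmu //.
have vC l : \sum_i C l i *: v i = 0.
  rewrite (eq_bigr (fun i => C l i *: \sum_j (\matrix_(i, j) a i j) i j *: s j)).
    by rewrite sum_scale_mulmx CA big1 // => j _; rewrite mxE scale0r.
  by move=> i _; rewrite aE; congr (_ *: _); apply: eq_bigr => j _; rewrite mxE.
(* The combinations C l vanish, so that their sum is a nontrivial relation. *)
have := indep_row_free v_ind C_free (c := fun=> 1); rewrite big1; last first.
  by move=> l _; rewrite vC scaler0.
by move=> /(_ erefl ord0)/eqP; rewrite oner_eq0.
Qed.

(** An independent family of maximal size spans. *)
Lemma basis_exists (V : lmodType K) M (s : 'I_M -> V) : spanning s ->
  exists u (b : 'I_u -> V), indep b /\ spanning b.
Proof.
move=> s_span; pose P r := `[< exists v : 'I_r -> V, indep v >].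
have P0 : exists r, P r by exists 0%N; apply/asboolP; exists (fun=> 0) => c _ [].
have PM r : P r -> (r <= M)%N.
  by move=> /asboolP[v v_ind]; apply: indep_size_le v_ind s_span.
case: (ex_maxnP P0 PM) => u /asboolP[b b_ind] u_max; exists u, b; split=> // x.
pose b' (i : 'I_u.+1) := if unlift ord0 i is Some j then b j else x.
have b'0 : b' ord0 = x by rewrite /b' unlift_none.
have b'S j : b' (lift ord0 j) = b j by rewrite /b' liftK.
have : ~ indep b'.
  by move=> b'_ind; have := u_max u.+1 (asboolT (ex_intro _ b' b'_ind)); rewrite ltnn.
move=> /existsNP[c /not_implyP[]]; rewrite big_ord_recl b'0.
under eq_bigr => j _ do rewrite b'S.
move=> c0 /existsNP[i ci].
have [cx|cx] := eqVneq (c ord0) 0.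
  case: ci; case: (unliftP ord0 i) => [j ->|-> //].
  by move: c0; rewrite cx scale0r add0r => /(b_ind (fun j => c (lift ord0 j))).
exists (fun j => - ((c ord0)^-1 * c (lift ord0 j))).
under eq_bigr => j _ do rewrite scaleNr -scalerA.
rewrite sumrN -scaler_sumr; move/eqP: c0; rewrite addr_eq0 => /eqP/esym/eqP.
by rewrite -eqr_opp opprK => /eqP ->; rewrite scalerN opprK scalerA mulVf // scale1r.
Qed.

Lemma dimension_basis (V : lmodType K) u (b : 'I_u -> V) :
  indep b -> spanning b -> dimension R V = (u%:R)%:E.
Proof.
move=> b_ind b_span; apply/eqP; rewrite eq_le; apply/andP; split.
  apply: ge_ereal_sup => _ [r [v v_ind] <-]; rewrite lee_fin ler_nat.
  exact: indep_size_le v_ind b_span.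
by apply: ereal_sup_ubound; exists u => //; exists b.
Qed.

Lemma dimension_iso (V W : lmodType K) (phi : {linear V -> W}) :
  bijective phi -> dimension R V = dimension R W.
Proof.
move=> [psi phiK psiK]; congr (ereal_sup (image _ _)); apply/seteqP.
split=> r [v v_ind].
  exists (phi \o v) => c /= c0; apply: v_ind; apply: (can_inj phiK).
  by rewrite linear0 linear_sum -[RHS]c0; apply: eq_bigr => i _; rewrite linearZ.
exists (psi \o v) => c /= c0; apply: v_ind; rewrite -[RHS](linear0 phi) -[in RHS]c0.
by rewrite linear_sum; apply: eq_bigr => i _; rewrite linearZ /= psiK.
Qed.

(** Rank-nullity for a surjection onto a finite-dimensional space; the source
may have infinite dimension. *)
Lemma dimension_kernel (V W U : lmodType K) (io : {linear W -> V}) (pi : {linear V -> U})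
    M (s : 'I_M -> U) :
  injective io -> (forall x, pi x = 0 <-> exists w, io w = x) ->
  (forall y, exists x, pi x = y) -> spanning s ->
  dimension R W = (dimension R V - dimension R U)%E.
Proof.
move=> io_inj ker_pi pi_surj /basis_exists[u [b [b_ind b_span]]].
rewrite (dimension_basis b_ind b_span).
have VW r (v : 'I_r -> V) : indep v -> exists m, (r <= m + u)%N /\
    exists w : 'I_m -> W, indep w.
  move=> v_ind; have /choice[a aE] := fun i => b_span (pi (v i)).
  have [m [C [C_free CA rmu]]] := kernel_matrix (\matrix_(i, j) a i j).
  exists m; split=> //; have /choice[w wE] l : exists w, io w = \sum_i C l i *: v i.
    apply/ker_pi; rewrite linear_sum.
    rewrite (eq_bigr (fun i => C l i *: \sum_j (\matrix_(i, j) a i j) i j *: b j)).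
      by rewrite sum_scale_mulmx CA big1 // => j _; rewrite mxE scale0r.
    move=> i _; rewrite linearZ /= aE; congr (_ *: _).
    by apply: eq_bigr => j _; rewrite mxE.
  exists w => c c0; apply: (indep_row_free v_ind C_free).
  rewrite -[RHS](linear0 io) -[in RHS]c0 linear_sum.
  by apply: eq_bigr => l _; rewrite linearZ /= wE.
have WV r (w : 'I_r -> W) : indep w -> exists v : 'I_(r + u) -> V, indep v.
  move=> w_ind; have /choice[x xE] := fun j => pi_surj (b j).
  pose v (i : 'I_(r + u)) := match split i with inl l => io (w l) | inr j => x j end.
  have vl l : v (lshift u l) = io (w l).
    by rewrite /v -[lshift u l]/(unsplit (inl l)) unsplitK.
  have vr j : v (rshift r j) = x j.
    by rewrite /v -[rshift r j]/(unsplit (inr j)) unsplitK.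
  exists v => c; rewrite big_split_ord /=.
  under eq_bigr => l _ do rewrite vl; under [X in _ + X]eq_bigr => j _ do rewrite vr.
  move=> c0; have cr j : c (rshift r j) = 0.
    apply: (b_ind (fun j => c (rshift r j))).
    rewrite -[RHS](linear0 pi) -[in RHS]c0 linearD !linear_sum [X in X + _]big1 ?add0r.
      by apply: eq_bigr => i _; rewrite linearZ /= xE.
    by move=> l _; rewrite linearZ /= (ker_pi _).2 ?scaler0 //; exists (w l).
  have cl l : c (lshift u l) = 0.
    apply: (w_ind (fun l => c (lshift u l))); apply: io_inj.
    rewrite linear0 linear_sum -[RHS]c0 [X in _ + X]big1 ?addr0.
      by apply: eq_bigr => i _; rewrite linearZ.
    by move=> j _; rewrite cr scale0r.
  by move=> i; case: (splitP i) => j ij; [rewrite -(cl j) | rewrite -(cr j)];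
    congr c; apply: val_inj.
apply/eqP; rewrite eq_le; apply/andP; split.
  apply: ge_ereal_sup => _ [r [w /WV[v v_ind]] <-].
  rewrite leeBrDr // -EFinD -natrD; apply: ereal_sup_ubound.
  by exists (r + u)%N => //; exists v.
rewrite leeBlDr //; apply: ge_ereal_sup => _ [r [v /VW[m [rmu [w w_ind]]]] <-].
apply: (@le_trans _ _ ((m%:R)%:E + (u%:R)%:E)%E).
  by rewrite -EFinD -natrD lee_fin ler_nat.
by apply: leeD2r; apply: ereal_sup_ubound; exists m => //; exists w.
Qed.
End Dimension.

Section TjurinaDimension.
Variables (R : realType) (K : fieldType) (n : nat) (f : series K n) (k : nat).
Local Notation O := (series K n).
Local Notation I := (fat_ideal f k).
Local Notation J := (tjurina_ideal f k).

(** A series without monomials of degree less than k lies in m^k, so that the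
remaining monomials span. *)
Lemma fat_point_spanning : exists M (s : 'I_M -> quo I), spanning s.
Proof.
pose X (m : mon n) : O := Series (fun l => (l == m)%:R).
exists #|{: bmon n k}|, (fun i => cls I (X (enum_val i : bmon n k))) => y.
have [x ->] := cls_surj y; exists (fun i => scoef x (enum_val i : bmon n k)).
transitivity (cls I (\sum_(m : bmon n k) scoef x m *: X m)); last first.
  by rewrite linear_sum big_enum_val; apply: eq_bigr => i _; rewrite linearZ.
apply/clsP/fat_idealP; exists 0, (x - \sum_(m : bmon n k) scoef x m *: X m).
split=> [|m mk]; first by rewrite mul0r add0r.
rewrite scoefB scoef_sum (bigD1 (mpoly.BMultinom mk)) //= eqxx mulr1 big1 ?addr0 ?subrr //.
move=> l lm; rewrite (_ : (m == l) = false) ?mulr0 //.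
by apply: contraNF lm => /eqP ml; apply/eqP/val_inj.
Qed.

Lemma tjurina_fat x : ideal_set J x -> ideal_set I x.
Proof.
move=> /tjurina_idealP[c [cI /principalP[a xE]]].
rewrite -[x](subrK (\sum_j c j * sderiv j f)); apply: idealD.
  by rewrite xE; apply/idealM/fat_ideal_f.
elim/big_ind: _ => [|y z|j _]; [exact: ideal0 | exact: idealD |].
by rewrite mulrC; apply/idealM/cI.
Qed.

Lemma dimension_tjurina_quotient : dimension R (tjurina_quotient f k) =
  (dimension R (tjurina_algebra f k) - dimension R (quo I))%E.
Proof.
have [M [s s_span]] := fat_point_spanning.
pose pi (u : tjurina_algebra f k) : quo I := sub_locus_fun I u.
have piE x : pi (cls J x) = cls I x by apply: sub_locusE tjurina_fat x.
have piB : zmod_morphism pi.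
  move=> u v; have [[x ->] [y ->]] := conj (cls_surj u) (cls_surj v).
  by rewrite -raddfB !piE raddfB.
have piZ : scalable pi.
  by move=> c u; have [x ->] := cls_surj u; rewrite -linearZ !piE linearZ.
pose piL := HB.pack_for {linear tjurina_algebra f k -> quo I} pi
  (GRing.isZmodMorphism.Build _ _ pi piB) (GRing.isScalable.Build _ _ _ _ pi piZ).
apply: (@dimension_kernel R K _ _ _ (\val : {linear tjurina_quotient f k -> tjurina_algebra f k})
  piL M s) => // [|u|y].
- exact: val_inj.
- have [x ->] := cls_surj u; rewrite /= piE; split=> [/cls0P Ix|[w wx]].
    have xI : cls J x \in subquo_pred I by apply/asboolP; exists x.
    by exists (Subquo xI).
  have [y [Iy wy]] := subquo_rep w; apply/cls0P.
  rewrite -[x](subrK y); apply: idealD => //; apply: tjurina_fat.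
  by apply/clsP; rewrite -wy -wx.
by have [x ->] := cls_surj y; exists (cls J x); apply: piE.
Qed.
End TjurinaDimension.

(** Every point is critical for the zero series. *)
Lemma isolated_singularity_neq0 (R : realType) n (f : series (R[i])%C n) :
  (0 < n)%N -> isolated_singularity f -> f != 0.
Proof.
move=> n_gt0 [_ _ _ [r [r_gt0 iso]]]; apply/eqP => f0.
pose z (_ : 'I_n) : (R[i])%C := r / 2.
have zr i : `|z i| < r.
  by rewrite ger0_norm /z ?divr_ge0 ?ler0n ?(ltW r_gt0) // ltr_pdivrMr ?ltr0n // ltr_pMr // ltr1n.
have z_crit : critical_point f z.
  move=> i; rewrite f0 /has_value.
  rewrite (_ : (fun d => _) = fun=> 0); first exact: cvg_cst.
  by apply/funext => d; rewrite big1 // => m _; rewrite /= mulr0 mul0r.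
have /eqP := iso z zr z_crit (Ordinal n_gt0).
by rewrite /z mulf_eq0 invr_eq0 pnatr_eq0 orbF gt_eqF.
Qed.

Theorem theorem1 (R : realType) (n : nat) (n_gt0 : (0 < n)%N)
    (f : series (R[i])%C n) (hf : isolated_singularity f) (k : nat) :
  inhabited (TDef f k) /\
  forall T : TDef f k,
    (exists phi : {linear T -> tjurina_quotient f k}, bijective phi) /\
    dimension R T = (dimension R (tjurina_algebra f k) - dimension R (quo (fat_ideal f k)))%E.
Proof.
have f_neq0 := isolated_singularity_neq0 n_gt0 hf; have [_ f_maxi _ _] := hf.
pose T0 := tjurina_tangent_space k f_neq0 f_maxi.
split=> [|T]; first exact: inhabits T0.
have [phi phi_bij] := tangent_space_unique T T0; split; first by exists phi.
by rewrite (dimension_iso R phi_bij) -dimension_tjurina_quotient.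
Qed.
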